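(* Let $H_L,H_R$ satisfy (H) and $F_0$ satisfy (F) (see context), and let $u_0:\mathbb{R}\to\mathbb{R}$ be Lipschitz continuous with $(u_0)_x\in L^\infty\cap BV(\mathbb{R})$. Let $\Delta t>0$ and $\Delta x>0$ satisfy the CFL condition $$\frac{\Delta t}{\Delta x}\le(2\mathfrak{L})^{-1},\qquad \mathfrak{L}=\max\{\mathfrak{L}_0,\mathfrak{L}_L,\mathfrak{L}_R\},$$ and let $u_\Delta$ be the numerical solution defined in the context. Then $u_\Delta$ converges locally uniformly, as $\Delta x\to0$, towards the unique $F_0$-viscosity solution $u$ of $$\begin{cases} u_t+H_L(u_x)=0, & t>0,\ x<0,\\ u_t+H_R(u_x)=0, & t>0,\ x>0,\\ u_t+F_0(u_x(t,0-),u_x(t,0+))=0,& t>0,\ x=0,\end{cases}$$ with initial condition $u=u_0$ on $\{0\}\times\mathbb{R}$.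
   Context: **Standing assumptions.** (H): for $\alpha\in\{L,R\}$, $H_\alpha:\mathbb{R}\to\mathbb{R}$ is $\mathfrak{L}_\alpha$-Lipschitz continuous, is not constant on any (nonempty) open interval, and $H_\alpha(p)\to+\infty$ as $|p|\to+\infty$. (F): $F_0:\mathbb{R}^2\to\mathbb{R}$ is $\mathfrak{L}_0$-Lipschitz continuous (in each variable, with constant $\mathfrak{L}_0$), $p_L\mapsto F_0(p_L,p_R)$ is non-decreasing, $p_R\mapsto F_0(p_L,p_R)$ is non-increasing, and $F_0(p_L,p_R)\to+\infty$ as $(p_L)_++(p_R)_-\to+\infty$, where $a_+=\max(0,a)$ and $a_-=\max(0,-a)$. **Numerical scheme.** For $\alpha\in\{L,R\}$, the Godunov flux is $g^{H_\alpha}(p^-,p^+)=\min_{[p^-,p^+]}H_\alpha$ if $p^-\le p^+$ and $g^{H_\alpha}(p^-,p^+)=\max_{[p^+,p^-]}H_\alpha$ if $p^+\le p^-$. Let $t_n=n\Delta t$ ($n\in\mathbb{N}$, including $0$) and $x_j=j\Delta x$ ($j\in\mathbb{Z}$). Set $f_j=g^{H_L}$ if $j\le-1$, $f_j=g^{H_R}$ if $j\ge1$, $f_0=F_0$. The scheme is $u^0_j=u_0(x_j)$ and, for $n\ge0$, $j\in\mathbb{Z}$, $$\frac{u^{n+1}_j-u^n_j}{\Delta t}+f_j\big(v^n_{j-\frac12},v^n_{j+\frac12}\big)=0,\qquad v^n_{j+\frac12}=\frac{u^n_{j+1}-u^n_j}{\Delta x}.$$ The function $u_\Delta$, with $\Delta=(\Delta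 t,\Delta x)$, is defined by $u_\Delta(t,x)=u^n_j+\frac{u^n_{j+1}-u^n_j}{\Delta x}(x-x_j)$ for $(t,x)\in[t_n,t_{n+1})\times[x_j,x_{j+1})$. **Viscosity solutions.** Let $Q_T=(0,T)\times\mathbb{R}$. A test function $\varphi\in C^1_\wedge(Q_T)$ is a continuous function on $Q_T$ whose restrictions to $(0,T)\times[0,+\infty)$ and to $(0,T)\times(-\infty,0]$ are continuously differentiable; $\partial_x^R\varphi$, $\partial_x^L\varphi$ denote the $x$-derivatives at $x=0$ of these two restrictions respectively. $\varphi$ touches $u$ from above (resp. below) at $X_0$ if $u(X_0)=\varphi(X_0)$ and $u\le\varphi$ (resp. $u\ge\varphi$) in a neighbourhood of $X_0$. An upper semi-continuous $u$ is an $F_0$-sub-solution if for every $\varphi\in C^1_\wedge(Q_T)$ touching $u$ from above at $X_0=(t_0,x_0)$ one has, at $X_0$: $\partial_t\varphi+H_L(\partial_x\varphi)\le0$ if $x_0<0$; $\partial_t\varphi+H_R(\partial_x\varphi)\le0$ if $x_0>0$; $\partial_t\varphi+\min(H_L(\partial_x^L\varphi),H_R(\partial_x^R\varphi),F_0(\partial_x^L\varphi,\partial_x^R\varphi))\le0$ if $x_0=0$. A lower semi-continuous $u$ is an $F_0$-super-solution if for every $\varphi\in C^1_\wedge(Q_T)$ touching $u$ from below at $X_0=(t_0,x_0)$ one has, at $X_0$: $\partial_t\varphi+H_L(\partial_x\varphi)\ge0$ if $x_0<0$; $\partial_t\varphi+H_R(\partial_x\varphi)\ge0$ if $x_0>0$;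 $\partial_t\varphi+\max(H_L(\partial_x^L\varphi),H_R(\partial_x^R\varphi),F_0(\partial_x^L\varphi,\partial_x^R\varphi))\ge0$ if $x_0=0$. A locally bounded $u$ is an $F_0$-viscosity solution if its upper semi-continuous envelope is an $F_0$-sub-solution and its lower semi-continuous envelope is an $F_0$-super-solution (on $(0,+\infty)\times\mathbb{R}$: for every $T>0$). *)

(* Defs.v *)
From HB Require Import structures.
From mathcomp Require Import all_boot all_order all_algebra.
From mathcomp Require Import all_classical all_reals all_analysis.
Set Implicit Arguments.
Unset Strict Implicit.
Unset Printing Implicit Defensive.
Import Order.TTheory GRing.Theory Num.Theory.
Import numFieldNormedType.Exports.
Local Open Scope classical_set_scope.
Local Open Scope ring_scope.

Section HamiltonJacobiJunction.
Context {R : realType}.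
Implicit Types (H : R -> R) (u phi : R * R -> R).

Definition pos_part (a : R) : R := Num.max 0 a.
Definition neg_part (a : R) : R := Num.max 0 (- a).

Definition hamiltonian_assumption (LH : R) H : Prop :=
  [/\ LH.-lipschitz H,
      forall a b : R, a < b -> ~ exists c, {in `]a, b[, forall p, H p = c}
    & forall A : R, exists B : R, forall p, B <= `|p| -> A <= H p].

Definition junction_assumption (L0 : R) (F0 : R -> R -> R) : Prop :=
  [/\ (forall pR, L0.-lipschitz (fun pL => F0 pL pR)) /\
      (forall pL, L0.-lipschitz (fun pR => F0 pL pR)),
      forall pR, {homo (fun pL => F0 pL pR) : p q / p <= q},
      forall pL, {homo (fun pR => F0 pL pR) : p q /~ p <= q}
    & forall A : R, exists B : R, forall pL pR,
        B <= pos_part pL + neg_part pR -> A <= F0 pL pR].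

(* Membership of the a.e. class [v] in BV(R): some representative has finite
   total variation on the whole line (integrability of [v] is not required). *)
Definition ae_bounded_variation (v : R -> R) : Prop :=
  exists w : R -> R, {ae lebesgue_measure, forall x, w x = v x} /\
    exists M : R, forall a b, a <= b -> (total_variation a b w <= M%:E)%E.

(* [v] is a version of the a.e. derivative of the Lipschitz function [u0]. *)
Definition ae_derivative (u0 v : R -> R) : Prop :=
  {ae lebesgue_measure, forall x : R, is_derive x 1 u0 (v x)}.

Definition initial_assumption (u0 : R -> R) : Prop :=
  (exists k : R, k.-lipschitz u0) /\
  exists v : R -> R, [/\ ae_derivative u0 v,
    v \in Lfun (@lebesgue_measure R) +oo%E & ae_bounded_variation v].

(* For continuous [H] the infimum and supremum are attained. *)
Definition godunov H (pm pp : R) : R :=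
  if pm <= pp then inf (H @` `[pm, pp]) else sup (H @` `[pp, pm]).

Definition flux (HL HR : R -> R) (F0 : R -> R -> R) (j : int) : R -> R -> R :=
  if j < 0 then godunov HL else if 0 < j then godunov HR else F0.

(* Discrete slope v_{j+1/2} of the grid function [U]. *)
Definition slope (dx : R) (U : int -> R) (j : int) : R :=
  (U (j + 1) - U j) / dx.

Fixpoint scheme (HL HR : R -> R) (F0 : R -> R -> R) (u0 : R -> R)
    (dt dx : R) (n : nat) : int -> R :=
  match n with
  | 0%N => fun j => u0 (j%:~R * dx)
  | m.+1 => fun j =>
      let U := scheme HL HR F0 u0 dt dx m in
      U j - dt * flux HL HR F0 j (slope dx U (j - 1)) (slope dx U j)
  end.

Definition u_Delta (HL HR : R -> R) (F0 : R -> R -> R) (u0 : R -> R)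
    (dt dx : R) (X : R * R) : R :=
  let j := Num.floor (X.2 / dx) in
  let U := scheme HL HR F0 u0 dt dx (Num.truncn (X.1 / dt)) in
  U j + slope dx U j * (X.2 - j%:~R * dx).

Definition Q (T : R) : set (R * R) := `]0, T[ `*` setT.
Definition QL (T : R) : set (R * R) := `]0, T[ `*` `]-oo, 0].
Definition QR (T : R) : set (R * R) := `]0, T[ `*` `[0, +oo[.
Definition Qbar : set (R * R) := `[0, +oo[ `*` setT.

(* Derivative of the restriction of [f] to [A]; one-sided at an endpoint. *)
Definition derive_within (A : set R) (f : R -> R) (x l : R) : Prop :=
  (f y - f x) / (y - x) @[y --> within A x^'] --> l.

(* The restriction of [phi] to [D] is C^1, with time derivative [phit] and space
   derivative [phix]. *)
Definition C1_on (D : set (R * R)) phi (phit phix : R * R -> R) : Prop :=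
  [/\ {within D, continuous phit}, {within D, continuous phix}
    & forall X, D X ->
        derive_within [set t | D (t, X.2)] (fun t => phi (t, X.2)) X.1 (phit X)
     /\ derive_within [set x | D (X.1, x)] (fun x => phi (X.1, x)) X.2 (phix X)].

(* The time derivatives of the two restrictions agree on x = 0, where both
   differentiate phi(., 0); hence a single [phit]. *)
Definition C1_wedge (T : R) phi (phit phixL phixR : R * R -> R) : Prop :=
  [/\ {within Q T, continuous phi},
      C1_on (QL T) phi phit phixL & C1_on (QR T) phi phit phixR].

Definition touches_above u phi (X : R * R) : Prop :=
  u X = phi X /\ \forall Y \near X, u Y <= phi Y.
Definition touches_below u phi (X : R * R) : Prop :=
  u X = phi X /\ \forall Y \near X, phi Y <= u Y.

Definition usc_on (D : set (R * R)) u : Prop :=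
  forall X, D X -> forall a, u X < a -> \forall Y \near within D (nbhs X), u Y < a.
Definition lsc_on (D : set (R * R)) u : Prop :=
  forall X, D X -> forall a, a < u X -> \forall Y \near within D (nbhs X), a < u Y.

Definition subsolution (HL HR : R -> R) (F0 : R -> R -> R) (T : R) u : Prop :=
  usc_on (Q T) u /\
  forall phi phit phixL phixR, C1_wedge T phi phit phixL phixR ->
  forall X, Q T X -> touches_above u phi X ->
  [/\ X.2 < 0 -> phit X + HL (phixL X) <= 0,
      0 < X.2 -> phit X + HR (phixR X) <= 0
    & X.2 = 0 -> phit X + Num.min (Num.min (HL (phixL X)) (HR (phixR X)))
                                  (F0 (phixL X) (phixR X)) <= 0].

Definition supersolution (HL HR : R -> R) (F0 : R -> R -> R) (T : R) u : Prop :=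
  lsc_on (Q T) u /\
  forall phi phit phixL phixR, C1_wedge T phi phit phixL phixR ->
  forall X, Q T X -> touches_below u phi X ->
  [/\ X.2 < 0 -> 0 <= phit X + HL (phixL X),
      0 < X.2 -> 0 <= phit X + HR (phixR X)
    & X.2 = 0 -> 0 <= phit X + Num.max (Num.max (HL (phixL X)) (HR (phixR X)))
                                       (F0 (phixL X) (phixR X))].

(* Semi-continuous envelopes of [u] restricted to [0, +oo[ x R, real-valued when
   [u] is locally bounded there. *)
Definition usc_env u (X : R * R) : R :=
  fine (limf_esup (EFin \o u) (within Qbar (nbhs X))).
Definition lsc_env u (X : R * R) : R :=
  fine (limf_einf (EFin \o u) (within Qbar (nbhs X))).

Definition locally_bounded_on (D : set (R * R)) u : Prop :=
  forall X, D X -> exists M, \forall Y \near within D (nbhs X), `|u Y| <= M.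

Definition viscosity_solution (HL HR : R -> R) (F0 : R -> R -> R) u : Prop :=
  locally_bounded_on Qbar u /\
  forall T, 0 < T -> subsolution HL HR F0 T (usc_env u) /\
                     supersolution HL HR F0 T (lsc_env u).

(* As lsc_env u <= u <= usc_env u on [Qbar], this contains u(0, .) = u0. *)
Definition initial_condition (u0 : R -> R) u : Prop :=
  forall x, usc_env u (0, x) = u0 x /\ lsc_env u (0, x) = u0 x.

Definition cauchy_solution (HL HR : R -> R) (F0 : R -> R -> R)
    (u0 : R -> R) u : Prop :=
  viscosity_solution HL HR F0 u /\ initial_condition u0 u.

Definition CFL (LL LR L0 dt dx : R) : Prop :=
  dt / dx <= (2 * Num.max L0 (Num.max LL LR))^-1.

End HamiltonJacobiJunction.

(* Main.v *)
Require Import Defs.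
From mathcomp Require Import all_boot all_order all_algebra.
From mathcomp Require Import all_classical all_reals all_analysis.
From mathcomp Require Import ring lra zify.
Set Implicit Arguments.
Unset Strict Implicit.
Unset Printing Implicit Defensive.
Import Order.TTheory GRing.Theory Num.Theory.
Import numFieldNormedType.Exports.
Local Open Scope classical_set_scope.
Local Open Scope ring_scope.

(** The scheme is monotone and commutes with constants, so its time increments
    are bounded by those of the first step; coercivity of the fluxes then bounds
    all discrete slopes, and u_Delta is Lipschitz up to O(dx). Its pointwise
    upper (resp. lower) limit as dx -> 0 is a Lipschitz sub-solution (resp.
    super-solution) with initial datum u0, by the Barles-Souganidis argument.
    Everything then follows from a comparison principle between an upper
    semi-continuous sub-solution u and a lower semi-continuous super-solution v.

    Comparison doubles the time variable only: one maximises
    u(t,x) - v(s,x) - k(t-s)^2 - eta t - exp(m(|x|+Kt-r)), where the last term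
    localises in a backward cone because all Hamiltonians are Lipschitz. Taking
    the supremum in t and the infimum in s separately gives functions U and V of
    x alone, with U - V maximal at the point x0, which satisfy stationary
    inequalities H(U') <= A and H(V') >= B with A < B near x0.
    For a slope p with A < H(p) < B, U - p x has no local maximum and V - p x no
    local minimum off x0, so both are monotone on each side of x0. On each side
    some such p satisfies U <= U(x0) + p(x-x0) and V >= V(x0) + p(x-x0). At
    the junction, with these slopes p_L and p_R, the two viscosity inequalities
    force F0(p_L,p_R) <= A and F0(p_L,p_R) >= B. *)

(** A penalty in x - y would give no hold on the pair of one-sided slopes that F0 couples at the
    junction; a common x avoids this, but then nothing links the slopes of U and V except the
    maximality of U - V. The two functions are not alike. Coercivity makes U Lipschitz, whereas -V
    satisfies an inequality for a dual, non-coercive Hamiltonian; V is therefore first capped by a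
    steep wedge V(x0) + M |x - x0|. Moreover the stationary inequalities are known only where U >
    U(x0) - d and V < V(x0) + d, since elsewhere the optimal time may be far from the reference time
    or at an end of the time interval. The gap A < B comes from eta t. The exponential costs
    nothing: its time derivative, K times its x-slope, dominates the change that this slope makes in
    any Hamiltonian. Requiring A < H(p) < B on each side serves to discard H_L and H_R from the
    relaxed junction conditions, a minimum for U and a maximum for V, so that only F0 is left. *)

Ltac clra := repeat match goal with
  | H : forall _, _ |- _ => clear H
  | x := _ |- _ => clearbody x
  end; lra.

(** * Maxima of semi-continuous functions and uniform radii by compactness *)

Lemma usc_compact_max (R : realType) (T : topologicalType) (K : set T)
    (f : T -> R) :
  compact K -> K !=set0 ->
  (forall x, K x -> forall a, f x < a -> \forall y \near x, K y -> f y < a) ->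
  exists2 x, K x & forall y, K y -> f y <= f x.
Proof.
move=> /compact_near_coveringP cK [k0 Kk0] usc.
apply: contrapT => noM.
(* The superlevel sets form a filter base. Without a maximum every x lies below some level f y, and
   so do its neighbours by semi-continuity; by compactness a point of K would then lie strictly
   below itself. *)
pose F := filter_from K (fun y0 => [set y | K y /\ f y0 <= f y]).
have FF : Filter F.
  apply: filter_from_filter; first by exists k0.
  move=> i j Ki Kj; have [le|lt] := leP (f i) (f j).
  - exists j => // y [Ky fy]; split; split=> //; exact: le_trans fy.
  - exists i => // y [Ky fy]; split; split=> //; apply: le_trans fy; exact: ltW.
have /cK : forall x, K x -> \forall x' \near x & y \near F,
    (fun y x' => K x' -> f x' < f y) y x'.
  move=> x Kx.
  have [y Ky fxy] : exists2 y, K y & f x < f y.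
    apply: contrapT => nex; apply: noM; exists x => // y Ky.
    by rewrite leNgt; apply/negP => lt; apply: nex; exists y.
  exists ([set x' | K x' -> f x' < f y], [set z | K z /\ f y <= f z]).
    split; first exact: usc.
    by exists y.
  move=> [x' z] /= [h1 [Kz h2]] Kx'; exact: lt_le_trans (h1 Kx') h2.
case=> y Ky hy.
have := hy y (conj Ky (lexx _)) y Ky Ky.
by rewrite ltxx.
Qed.

Lemma near1P (R : realType) (x : R) (P : R -> Prop) :
  (\forall y \near x, P y) <->
  exists2 e, 0 < e & forall y, `|y - x| < e -> P y.
Proof.
split.
  case/nbhs_ballP => e /= e0 h; exists e => // y yx; apply: h.
  by rewrite /ball /= distrC.
case=> e e0 h; apply/nbhs_ballP; exists e => //= y.
by rewrite /ball /= distrC => /h.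
Qed.

Lemma near2P (R : realType) (X : R * R) (P : R * R -> Prop) :
  (\forall Y \near X, P Y) <->
  exists2 e, 0 < e & forall t x, `|t - X.1| < e -> `|x - X.2| < e -> P (t, x).
Proof.
split.
  case/nbhs_ballP => e /= e0 h; exists e => // t x tX xX; apply: h.
  by split; rewrite /ball /= distrC.
case=> e e0 h; apply/nbhs_ballP; exists e => //= -[t x].
by case; rewrite /ball /= => h1 h2; apply: h; rewrite distrC.
Qed.

Lemma usc_segment_max (R : realType) (f : R -> R) (a b : R) : a <= b ->
  (forall x, a <= x <= b -> forall c, f x < c ->
    exists2 e, 0 < e & forall y, a <= y <= b -> `|y - x| < e -> f y < c) ->
  exists2 m, a <= m <= b & forall y, a <= y <= b -> f y <= f m.
Proof.
move=> ab usc.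
case: (@usc_compact_max R R `[a, b] f).
- exact: segment_compact.
- by exists a; rewrite /= in_itv /= lexx.
- move=> x; rewrite /= in_itv /= => xab c fxc.
  have [e e0 h] := usc x xab c fxc.
  by apply/near1P; exists e => // y yx; rewrite in_itv /= => yab; exact: h.
- move=> m; rewrite /= in_itv /= => mab h; by exists m.
Qed.

(** Compactness in the form used below: the scale [i] is shared by all points, so that radii found
    point by point become uniform. *)
Lemma cover_segment (R : realType) (a b : R) (P : R -> R -> Prop) :
  (forall t, a <= t <= b -> exists2 e, 0 < e & forall t' i, `|t' - t| < e ->
     0 < i < e -> P i t') ->
  exists2 e, 0 < e & forall i, 0 < i < e -> forall t, a <= t <= b -> P i t.
Proof.
move=> h.
have /compact_near_coveringP cK := @segment_compact R a b.
have /cK [] : forall t, [set` `[a, b]] t -> \forall t' \near t & i \near 0^'+, P i t'.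
  move=> t; rewrite /= in_itv /= => /h [e e0 he].
  exists ([set t' | `|t' - t| < e], [set i | 0 < i < e]).
    split; first by apply/near1P; exists e.
    rewrite /= /at_right /within /=; apply/near1P; exists e => // y.
    rewrite subr0 => ye y0; rewrite /= y0 /=; exact: le_lt_trans (ler_norm _) ye.
  by move=> [t' i] /= [h1 h2]; exact: he.
move=> e /= e0 he; exists e => // i /andP[i0 ie] t tab; apply: (he i); rewrite //= ?in_itv //.
by rewrite sub0r normrN gtr0_norm.
Qed.

(** * Slopes of sub- and super-solutions in one dimension *)

Section OneDimension.
Context {R : realType}.
Implicit Types (f g H : R -> R) (G : R -> Prop).
Implicit Types (A B C L M N a b c d e k m p q r rho s t x y z : R).

Definition usc_at f x := forall a, f x < a ->
  exists2 e, 0 < e & forall y, `|y - x| < e -> f y < a.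

(** This is how a sub-solution enters: a parabola touching f from above with slope p forces H p <=
    A, so contact is impossible for [G p := A < H p]. The free curvature c is what [tilt_parabola]
    exploits. *)
Definition no_contact f (r : R) G := forall x p c : R, 0 < x < r -> G p ->
  ~ (exists2 e, 0 < e &
      forall y, `|y - x| < e -> f y <= f x + p * (y - x) + c * (y - x) ^+ 2).

Definition tilt_incr f r p :=
  forall x y : R, 0 < x -> x < y -> y < r -> f x - p * x < f y - p * y.
Definition tilt_decr f r p :=
  forall x y : R, 0 < x -> x < y -> y < r -> f y - p * y <= f x - p * x.

(** Otherwise f - p t would reach its maximum over [x, z] at an interior point, where a line of
    slope p touches f from above. *)
Lemma quasiconvex_tilt f r G p x y z :
  (forall x, 0 < x < r -> usc_at f x) -> no_contact f r G -> G p ->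
  0 < x -> x < y -> y < z -> z < r ->
  f x - p * x <= f y - p * y -> f y - p * y < f z - p * z.
Proof.
move=> usc nc Gp x0 xy yz zr hxy; rewrite ltNge; apply/negP => hzy.
have [||m /andP[xm mz] hm] := @usc_segment_max R (fun t => f t - p * t) x z.
- lra.
- move=> t /andP[xt tz] c /= ftc.
  have [||e e0 he] := usc t _ ((c + p * t + f t) / 2); [lra|lra|].
  have d0 : 0 < (c + p * t - f t) / 2 / (`|p| + 1).
    by apply: divr_gt0; [lra|rewrite ltr_wpDl].
  exists (Num.min e ((c + p * t - f t) / 2 / (`|p| + 1))).
    by rewrite lt_min e0.
  move=> u _; rewrite lt_min => /andP[/he h1].
  rewrite ltr_pdivlMr ?ltr_wpDl// => h2.
  have h3 : - (p * (u - t)) <= `|u - t| * (`|p| + 1).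
    have := ler_norm (- (p * (u - t))); rewrite normrN normrM.
    have := normr_ge0 (u - t); lra.
  lra.
(* If the maximum sits at an endpoint, the assumed inequalities make y a maximiser too. *)
have [m' [/andP[xm' mz'] hm']] : exists m', x < m' < z /\
    forall t, x <= t <= z -> f t - p * t <= f m' - p * m'.
  have [mx|mx] := eqVneq m x.
    exists y; split; first lra; move=> t ht; have := hm _ ht; rewrite mx; lra.
  have [mz'|mz'] := eqVneq m z.
    exists y; split; first lra; move=> t ht; have := hm _ ht; rewrite mz'; lra.
  by exists m; split => //; rewrite !lt_neqAle xm mz eq_sym mx mz'.
apply: (nc m' p 0 _ Gp); first lra.
exists (Num.min (m' - x) (z - m')); first by rewrite lt_min; lra.
move=> t; rewrite lt_min !ltr_norml => /andP[/andP[? ?] /andP[? ?]].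
have := hm' t; lra.
Qed.

(** By [quasiconvex_tilt] one strict rise propagates to everything on its right. If rises occur
    arbitrarily close to 0, the tilted function increases on all of ]0, r[; if not, it is
    non-increasing near 0. *)
Lemma tilt_dichotomy f r G p :
  (forall x, 0 < x < r -> usc_at f x) -> no_contact f r G -> G p -> 0 < r ->
  tilt_incr f r p \/ exists2 r', 0 < r' & r' <= r /\ tilt_decr f r' p.
Proof.
move=> usc nc Gp r0.
have [h|h] := pselect (exists2 r', 0 < r' & r' <= r /\ tilt_decr f r' p).
  by right.
left => x y x0 xy yr.
have [x1 [y1 [x10 xy1 yx hxy]]] : exists x1 y1,
    [/\ 0 < x1, x1 < y1, y1 < x & f x1 - p * x1 < f y1 - p * y1].
  apply: contrapT => nex; apply: h; exists x => //; split; first lra.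
  move=> s t s0 st tx; rewrite leNgt; apply/negP => lt.
  by apply: nex; exists s, t.
have Q := @quasiconvex_tilt f r G p _ _ _ usc nc Gp.
have h1 : f y1 - p * y1 < f x - p * x by apply: (Q x1); lra.
apply: (Q y1); lra.
Qed.

(* A parabola whose slope runs through [q1, q2] would touch [f] from above. *)
Lemma tilt_parabola f r G q1 q2 p1 p2 x y :
  (forall x, 0 < x < r -> usc_at f x) -> no_contact f r G ->
  (forall p, q1 < p < q2 -> G p) -> q1 < p1 -> p2 < q2 ->
  0 < x -> x < y -> y < r ->
  (forall s t, x <= s -> s < t -> t <= y ->
     f s - p1 * s <= f t - p1 * t /\ f t - p2 * t <= f s - p2 * s) -> False.
Proof.
move=> usc nc GI qp1 qp2 x0 xy yr hst.
have p12 : p1 <= p2.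
  have [h1 h2] := hst x y (lexx _) xy (lexx _).
  have : (p1 - p2) * (y - x) <= 0 by lra.
  by rewrite pmulr_lle0; lra.
(* [phi] will have slope a < p1 at x and slope b > p2 at y, with the curvature k spreading the
   difference over [x, y]; all its slopes stay inside ]q1, q2[. *)
pose a := (q1 + p1) / 2; pose b := (p2 + q2) / 2.
have ab : a < b by rewrite /a /b; lra.
have ap : a < p1 by rewrite /a; lra.
have pb : p2 < b by rewrite /b; lra.
pose k := (b - a) / (y - x) / 2.
have k0 : 0 < k by rewrite /k !divr_gt0; lra.
have kE : 2 * k * (y - x) = b - a by rewrite /k; field; lra.
clearbody k.
pose phi z := a * (z - x) + k * (z - x) ^+ 2.
have [||m /andP[xm my] hm] := @usc_segment_max R (fun z => f z - phi z) x y.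
- lra.
- move=> t /andP[xt ty] c /= ftc.
  have [||e e0 he] := usc t _ ((c + phi t + f t) / 2); [lra|lra|].
  have d0 : 0 < (c + phi t - f t) / 2 / (`|a| + `|b| + 1).
    by apply: divr_gt0; [lra|rewrite ltr_wpDl // addr_ge0].
  exists (Num.min e ((c + phi t - f t) / 2 / (`|a| + `|b| + 1))).
    by rewrite lt_min e0.
  move=> u /andP[xu uy]; rewrite lt_min => /andP[/he h1].
  rewrite ltr_pdivlMr ?ltr_wpDl// ?addr_ge0// => h2.
  have h3 : - (phi u - phi t) <= `|u - t| * (`|a| + `|b| + 1).
    have E : phi u - phi t = (u - t) * (a + k * (u + t - 2 * x)).
      by rewrite /phi; ring.
    rewrite E; apply: (le_trans (ler_norm _)); rewrite normrN normrM.
    apply: ler_wpM2l => //.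
    have h4 : 0 <= k * (u + t - 2 * x) by rewrite mulr_ge0; lra.
    have h5 : k * (u + t - 2 * x) <= b - a.
      by rewrite -kE -mulrA mulrCA ler_pM2l //; lra.
    rewrite ler_norml; apply/andP; split.
      have := ler_norm (- a); rewrite normrN; have := normr_ge0 b; lra.
    have := ler_norm b; have := normr_ge0 a; lra.
  lra.
(* Near x, f rises at a rate of at least p1 > a, so f - phi is not maximal there; near y it rises at
   a rate of at most p2 < b, which excludes y. *)
have hx : m != x.
  apply/eqP => mx; subst m.
  pose h := Num.min (y - x) ((p1 - a) / k / 2).
  have h0 : 0 < h by rewrite lt_min !divr_gt0 //; lra.
  have hxy : h <= y - x by rewrite ge_min lexx.
  have hk : h * k < p1 - a.
    rewrite -ltr_pdivlMr // /h gt_min; apply/orP; right.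
    have : 0 < (p1 - a) / k by rewrite divr_gt0 //; lra.
    lra.
  have [h1 _] := hst x (x + h) (lexx _) ltac:(lra) ltac:(lra).
  have := hm (x + h) ltac:(lra).
  have E1 : phi (x + h) - phi x = (a + h * k) * h by rewrite /phi; ring.
  have : (a + h * k) * h < p1 * h by rewrite ltr_pM2r //; lra.
  lra.
have hy : m != y.
  apply/eqP => mx; subst m.
  pose h := Num.min (y - x) ((b - p2) / k / 2).
  have h0 : 0 < h by rewrite lt_min !divr_gt0 //; lra.
  have hxy : h <= y - x by rewrite ge_min lexx.
  have hk : h * k < b - p2.
    rewrite -ltr_pdivlMr // /h gt_min; apply/orP; right.
    have : 0 < (b - p2) / k by rewrite divr_gt0 //; lra.
    lra.
  have [_ h1] := hst (y - h) y ltac:(lra) ltac:(lra) (lexx _).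
  have := hm (y - h) ltac:(lra).
  have E1 : phi y - phi (y - h) = (b - h * k) * h.
    have -> : b = a + 2 * k * (y - x) by lra.
    by rewrite /phi; ring.
  have : p2 * h < (b - h * k) * h by rewrite ltr_pM2r //; lra.
  lra.
have {}xm : x < m by rewrite lt_neqAle xm eq_sym hx.
have {}my : m < y by rewrite lt_neqAle my hy.
apply: (nc m (a + 2 * k * (m - x)) k _ (GI _ _)).
- lra.
- have h4 : 0 < 2 * k * (m - x) by rewrite !mulr_gt0 //; lra.
  have h5 : 2 * k * (m - x) < b - a by rewrite -kE ltr_pM2l ?mulr_gt0 //; lra.
  rewrite /a /b in h4 h5 *; lra.
exists (Num.min (m - x) (y - m)); first by rewrite lt_min; lra.
move=> t; rewrite lt_min !ltr_norml => /andP[/andP[? ?] /andP[? ?]].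
have := hm t ltac:(lra).
have -> : phi t = phi m + (a + 2 * k * (m - x)) * (t - m) + k * (t - m) ^+ 2.
  by rewrite /phi; ring.
lra.
Qed.

(** Inside an interval of [G] the alternative of [tilt_dichotomy] cannot switch: increase with p1
    and decrease with p2 would confine the difference quotients of f near 0 to [p1, p2], which
    [tilt_parabola] excludes. *)
Lemma tilt_incr_interval f r G q1 q2 p1 p2 :
  (forall x, 0 < x < r -> usc_at f x) -> no_contact f r G -> 0 < r ->
  (forall p, q1 < p < q2 -> G p) -> q1 < p1 < q2 -> q1 < p2 < q2 ->
  tilt_incr f r p1 -> tilt_incr f r p2.
Proof.
move=> usc nc r0 GI hp1 hp2 inc1.
have [|[r' r'0 [r'r dec]]] := tilt_dichotomy usc nc (GI _ hp2) r0; first by [].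
exfalso; apply: (@tilt_parabola f r G q1 q2 p1 p2 (r' / 3) (r' / 2) usc nc GI).
all: try lra.
move=> s t s0 st ty; split.
  by apply: ltW; apply: inc1; lra.
by apply: dec; lra.
Qed.

(** The slope is the infimum of the q >= b with mid <= H q. That H stays below mid on the way is
    essential: the whole interval then consists of slopes with H < B, along which
    [tilt_incr_interval] can move. *)
Lemma first_crossing H L b mid C : (forall p q, `|H p - H q| <= L * `|p - q|) ->
  (forall p, C <= p -> mid <= H p) -> H b < mid ->
  exists2 p, b < p & H p = mid /\ forall q, b <= q -> q < p -> H q < mid.
Proof.
move=> Hlip Hco Hb.
have near_lt q m e : 0 < e -> e * (`|L| + 1) <= m - H q ->
    forall s, `|s - q| < e -> H s < m.
  move=> e0 eL s sq.
  have h1 := le_trans (ler_norm _) (Hlip s q).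
  have h2 : L * `|s - q| <= `|L| * `|s - q| by rewrite ler_wpM2r // ler_norm.
  have h3 : `|s - q| * (`|L| + 1) < e * (`|L| + 1).
    by rewrite ltr_pM2r // ltr_wpDl.
  have := normr_ge0 (s - q); lra.
have near_lt' q m : H q < m -> exists2 e, 0 < e & forall s, `|s - q| < e -> H s < m.
  move=> Hq; exists ((m - H q) / (`|L| + 1)).
    by apply: divr_gt0; [lra|rewrite ltr_wpDl].
  apply: near_lt; first by apply: divr_gt0; [lra|rewrite ltr_wpDl].
  by rewrite divfK // lt0r_neq0 // ltr_wpDl.
pose S := [set q | b <= q /\ mid <= H q].
have hS : has_inf S.
  split; last by exists b => q [].
  exists (Num.max b C); split; first by rewrite le_max lexx.
  by apply: Hco; rewrite le_max lexx orbT.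
pose p := inf S.
have bp : b <= p by apply: lb_le_inf; [exact: hS.1|by move=> q []].
have lo q : b <= q -> q < p -> H q < mid.
  move=> bq qp; rewrite ltNge; apply/negP => hq.
  have : p <= q by apply: ge_inf; [exact: hS.2|split].
  lra.
have Hp : mid <= H p.
  rewrite leNgt; apply/negP => /near_lt' [e e0 he].
  have [q [bq Hq] qp] := inf_adherent e0 hS.
  have pq : p <= q by apply: ge_inf; [exact: hS.2|split].
  have := he q; rewrite ger0_norm ?subr_ge0 // => /(_ ltac:(rewrite /p in pq *; lra)).
  lra.
have {}bp : b < p.
  by rewrite lt_neqAle bp andbT; apply/eqP => bpE; move: Hp; rewrite -bpE; lra.
exists p => //; split; last exact: lo.
apply/eqP; rewrite eq_le Hp andbT leNgt; apply/negP => Hgt.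
have HN : - H p < - mid by lra.
pose e := (H p - mid) / (`|L| + 1).
have e0 : 0 < e by apply: divr_gt0; [lra|rewrite ltr_wpDl].
have eE : e * (`|L| + 1) = H p - mid by rewrite /e divfK // lt0r_neq0 // ltr_wpDl.
pose q := Num.max b (p - e / 2).
have q1 : b <= q by rewrite le_max lexx.
have q2 : q < p by rewrite gt_max bp; lra.
have q3 : p - e / 2 <= q by rewrite le_max lexx orbT.
have := lo q q1 q2.
have h1 := le_trans (ler_norm _) (Hlip p q).
have h2 : L * `|p - q| <= `|L| * `|p - q| by rewrite ler_wpM2r // ler_norm.
have h3 : `|p - q| * (`|L| + 1) < e * (`|L| + 1).
  by rewrite ltr_pM2r ?ltr_wpDl // ger0_norm; lra.
have := normr_ge0 (p - q); lra.
Qed.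

End OneDimension.

(** * One-sided slopes at a maximum of the difference *)

Section OneSidedSlopes.
Context {R : realType}.
Implicit Types (f g H U V : R -> R) (G : R -> Prop).
Implicit Types (A B C L M N a b c d e k m p q r rho s t x y z : R).

Lemma le_limit0 (a b c x : R) : 0 < x ->
  (forall y, 0 < y -> y < x -> a <= b + c * y) -> a <= b.
Proof.
move=> x0 h; rewrite leNgt; apply/negP => ba.
pose y := Num.min (x / 2) ((a - b) / 2 / (`|c| + 1)).
have y0 : 0 < y.
  rewrite lt_min; apply/andP; split; first clra.
  by apply: divr_gt0; [clra|rewrite ltr_wpDl].
have yx : y < x by rewrite gt_min; apply/orP; left; clra.
have yc : y * (`|c| + 1) <= (a - b) / 2.
  by rewrite -ler_pdivlMr ?ltr_wpDl // ge_min lexx orbT.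
have := h y y0 yx.
have : c * y <= `|c| * y by rewrite ler_pM2r // ler_norm.
clra.
Qed.

(** f stands for the sub-solution and g for the super-solution. The search starts from the critical
    slope b, the supremum of the p with A < H p for which f - p x increases. There H b <= A, and the
    first slope beyond b at which H reaches the midpoint of A and B is the one wanted. *)
Lemma right_slope H L C f g r N N' A B :
  (forall p q, `|H p - H q| <= L * `|p - q|) ->
  (forall p, C <= `|p| -> B <= H p) -> A < B -> 0 < r ->
  (forall x y, 0 <= x -> x < y -> y < r -> `|f y - f x| <= N * (y - x)) ->
  (forall x, 0 < x < r -> `|g x - g 0| <= N' * x) ->
  (forall x, 0 < x < r -> usc_at (fun z => - g z) x) ->
  no_contact f r (fun p => A < H p) ->
  no_contact (fun z => - g z) r (fun p => H (- p) < B) ->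
  (forall x, 0 < x < r -> f x - g x <= f 0 - g 0) ->
  exists2 p, A < H p < B & exists2 r', 0 < r' &
    forall x, 0 < x < r' -> f x <= f 0 + p * x /\ g 0 + p * x <= g x.
Proof.
move=> Hlip Hco AB r0 fN gN gusc ncf ncg fg.
have fusc x : 0 < x < r -> usc_at f x.
  move=> /andP[x0 xr] a fxa.
  have N1 : 0 < `|N| + 1 by rewrite ltr_wpDl.
  exists (Num.min (Num.min x (r - x)) ((a - f x) / (`|N| + 1))).
    rewrite !lt_min x0 subr_gt0 xr /=; apply: divr_gt0 => //; clra.
  move=> y; rewrite !lt_min ltr_pdivlMr // => /andP[/andP[h1 h2] h3].
  have fyx : `|f y - f x| <= N * `|y - x|.
    move: h1 h2; rewrite !ltr_norml => /andP[h1 h1'] /andP[h2 h2'].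
    have [yx|xy|->] := ltgtP y x.
    - rewrite distrC [X in _ <= _ * X]distrC.
      rewrite (@gtr0_norm _ (x - y)) ?subr_gt0 //; apply: fN; clra.
    - rewrite (@gtr0_norm _ (y - x)) ?subr_gt0 //; apply: fN; clra.
    - by rewrite !subrr !normr0 mulr0.
  have := ler_norm (f y - f x).
  have : N * `|y - x| <= `|N| * `|y - x| by rewrite ler_wpM2r // ler_norm.
  have := normr_ge0 (y - x); clra.
pose S := [set p | A < H p /\ tilt_incr f r p].
have SN p : S p -> p <= N.
  move=> [_ inc]; have := inc (r / 3) (r / 2) ltac:(clra) ltac:(clra) ltac:(clra).
  have := fN (r / 3) (r / 2) ltac:(clra) ltac:(clra) ltac:(clra).
  rewrite ler_norml => /andP[_ h1] h2.
  rewrite leNgt; apply/negP => Np.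
  have : 0 < (p - N) * (r / 2 - r / 3) by rewrite mulr_gt0; clra.
  clra.
have incN q : q < - N -> tilt_incr f r q.
  move=> qN x y x0 xy yr; have := fN x y ltac:(clra) xy yr.
  rewrite ler_norml => /andP[h1 _].
  have : 0 < (- N - q) * (y - x) by rewrite mulr_gt0; clra.
  clra.
(* A very negative slope belongs to [S]: the Lipschitz bound makes the tilted f increase, and
   coercivity gives H >= B > A. *)
have hS : has_sup S.
  split; last by exists N => p /SN.
  exists (- `|N| - `|C| - 1); split.
    apply: lt_le_trans AB _; apply: Hco; rewrite ler0_norm.
      have := ler_norm C; have := normr_ge0 N; clra.
    have := normr_ge0 C; have := normr_ge0 N; clra.
  apply: incN; have := ler_norm N; have := normr_ge0 C; clra.
pose b := sup S.
have Sb p : A < H p -> p < b -> exists2 p', S p' & p < p'.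
  move=> Hp pb; have [|p' Sp' h] := @sup_adherent _ S (b - p) _ hS; first clra.
  exists p' => //; rewrite /b in h *; clra.
have bS p : S p -> p <= b by move=> Sp; apply: ub_le_sup => //; exact: hS.2.
have Hnbhs q (a : R) : H q < a -> exists2 e, 0 < e & forall s, `|s - q| < e -> H s < a.
  move=> Hq; have L1 : 0 < `|L| + 1 by rewrite ltr_wpDl.
  exists ((a - H q) / (`|L| + 1)); first by apply: divr_gt0; [clra|].
  move=> s; rewrite ltr_pdivlMr // => h.
  have h1 := le_trans (ler_norm _) (Hlip s q).
  have h2 : L * `|s - q| <= `|L| * `|s - q| by rewrite ler_wpM2r // ler_norm.
  have := normr_ge0 (s - q); clra.
have Hnbhs' q (a : R) : a < H q -> exists2 e, 0 < e & forall s, `|s - q| < e -> a < H s.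
  move=> Hq; have L1 : 0 < `|L| + 1 by rewrite ltr_wpDl.
  exists ((H q - a) / (`|L| + 1)); first by apply: divr_gt0; [clra|].
  move=> s; rewrite ltr_pdivlMr // => h.
  have h1 := le_trans (ler_norm _) (Hlip q s).
  have h2 : L * `|q - s| <= `|L| * `|q - s| by rewrite ler_wpM2r // ler_norm.
  rewrite distrC in h1 h2 *; have := normr_ge0 (s - q); clra.
(* If A < H b, this persists on an interval around b, along which increase passes from a slope of
   [S] just below b to one above b, against the supremum. *)
have HbA : H b <= A.
  rewrite leNgt; apply/negP => /Hnbhs' [e e0 he].
  have GI p : b - e < p < b + e -> A < H p.
    by move=> /andP[h1 h2]; apply: he; rewrite ltr_norml; clra.
  have [p' [Hp' inc] bp'] := Sb (b - e / 2) ltac:(apply: GI; clra) ltac:(clra).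
  have p'b : p' <= b by apply: bS.
  have : S (b + e / 2).
    split; first by apply: GI; clra.
    by apply: (tilt_incr_interval fusc ncf r0 GI _ _ inc); clra.
  move=> /bS; clra.
pose mid := (A + B) / 2.
have midA : A < mid by rewrite /mid; clra.
have midB : mid < B by rewrite /mid; clra.
have Hbm : H b < mid by clra.
have finish p : A < H p -> ~ S p ->
    exists2 r', 0 < r' & forall x, 0 < x < r' -> f x <= f 0 + p * x.
  move=> Hp nS; have [inc|[r' r'0 [r'r dec]]] := tilt_dichotomy fusc ncf Hp r0.
    by exfalso; apply: nS.
  exists r' => // x /andP[x0 xr'].
  suff : f x - p * x <= f 0 by clra.
  apply: (@le_limit0 _ _ (N - p) x) => // y y0 yx.
  have := dec y x y0 yx xr'.
  have := fN 0 y (lexx _) y0 ltac:(clra); rewrite ler_norml => /andP[_].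
  clra.
pose g' := fun z => - g z.
have rh0 : 0 < r / 2 by clra.
have rh1 : r / 2 < r by clra.
have [incg|[r' r'0 [r'r decg]]] :=
    @tilt_dichotomy _ g' r (fun p => H (- p) < B) (- b) gusc ncg
      ltac:(rewrite /= opprK; clra) r0.
(* Case where g - b x decreases. Moving left from b to the first slope -p with H (-p) = mid, g + p x
   still decreases, while f - p' x increases for some p' > -p; then f - g would exceed its value at
   0. *)
- have Hlip' p q : `|H (- p) - H (- q)| <= L * `|p - q|.
    by rewrite (le_trans (Hlip _ _)) // opprK addrC distrC.
  have [||p bp [Hp lt]] := @first_crossing _ (fun q => H (- q)) L (- b) mid `|C| Hlip'.
  - move=> p Cp; apply: le_trans (ltW midB) _; apply: Hco.
    rewrite normrN; apply: le_trans (ler_norm _) _; apply: le_trans Cp _.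
    exact: ler_norm.
  - by rewrite opprK.
  have [e e0 he] := Hnbhs (- p) B ltac:(clra).
  have [e' e'0 he'] := Hnbhs b B ltac:(clra).
  have incp : tilt_incr g' r p.
    apply: (@tilt_incr_interval _ g' r (fun p => H (- p) < B) (- b - e') (p + e)
      (- b) p gusc ncg r0 _ _ _ incg); try clra.
    move=> q /andP[q1 q2].
    have [qb|bq] := ltP q (- b).
      by apply: he'; rewrite ltr_norml; clra.
    have [qp|pq] := ltP q p; first by have := lt q bq qp; clra.
    by apply: he; rewrite ltr_norml; clra.
  have [p' [Hp' inc] pp'] := Sb (- p) ltac:(clra) ltac:(clra).
  have h1 : f 0 <= f (r / 2) - p' * (r / 2).
    apply: (@le_limit0 _ _ (N + p') (r / 2)); first exact: rh0.
    move=> y y0 yx; have := inc y (r / 2) y0 yx rh1.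
    have := fN 0 y (lexx _) y0 (lt_trans yx rh1); rewrite ler_norml => /andP[h _].
    clra.
  have h2 : - g 0 <= - g (r / 2) - p * (r / 2).
    apply: (@le_limit0 _ _ (N' + p) (r / 2)); first exact: rh0.
    move=> y y0 yx; have := incp y (r / 2) y0 yx rh1.
    have yr : 0 < y < r by rewrite y0 (lt_trans yx rh1).
    have := gN y yr; rewrite ler_norml => /andP[_ h].
    rewrite /g'; clra.
  have := fg (r / 2); rewrite rh0 rh1 => /(_ isT).
  have : 0 < (p' + p) * (r / 2) by rewrite mulr_gt0; clra.
  clra.
(* Case where g - b x is non-decreasing near 0, moving right from b. Since p > b is outside [S], f -
   p x is non-increasing near 0; and g - p x cannot decrease, or g - b x would decrease as well. *)
- have [||p bp [Hp lt]] := @first_crossing _ H L b mid `|C| Hlip.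
  - move=> p Cp; apply: le_trans (ltW midB) _; apply: Hco.
    apply: le_trans (ler_norm _) _; apply: le_trans Cp _; exact: ler_norm.
  - by [].
  have nSp : ~ S p by move=> /bS; clra.
  have [e e0 he] := Hnbhs p B ltac:(clra).
  have [e' e'0 he'] := Hnbhs b B ltac:(clra).
  have GI q : - p - e < q < - b + e' -> H (- q) < B.
    move=> /andP[q1 q2].
    have [qb|bq] := ltP (- q) b.
      by apply: he'; rewrite ltr_norml; clra.
    have [qp|pq] := ltP (- q) p; first by have := lt (- q) bq qp; clra.
    by apply: he; rewrite ltr_norml; clra.
  have [r1 r10 h1] := finish p ltac:(clra) nSp.
  have [incp|[r2 r20 [r2r decp]]] :=
    @tilt_dichotomy _ g' r (fun p => H (- p) < B) (- p) gusc ncg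
      ltac:(rewrite /= opprK; clra) r0.
    have incb : tilt_incr g' r (- b).
      by apply: (tilt_incr_interval gusc ncg r0 GI _ _ incp); clra.
    have := incb (r' / 3) (r' / 2) ltac:(clra) ltac:(clra) ltac:(clra).
    have := decg (r' / 3) (r' / 2) ltac:(clra) ltac:(clra) ltac:(clra).
    clra.
  exists p; first by rewrite Hp; clra.
  exists (Num.min r1 r2); first by rewrite lt_min r10.
  move=> x; rewrite lt_min => /andP[x0 /andP[xr1 xr2]]; split.
    by apply: h1; rewrite x0.
  suff : - g x + p * x <= - g 0 by clra.
  apply: (@le_limit0 _ _ (N' + p) x) => // y y0 yx.
  have := decp y x y0 yx xr2; rewrite /g'.
  have := gN y ltac:(clra); rewrite ler_norml => /andP[h _]; clra.
Qed.

Definition contact f (x p c : R) := exists2 e, 0 < e &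
  forall y, `|y - x| < e -> f y <= f x + p * (y - x) + c * (y - x) ^+ 2.

Lemma slope_unique (a p c e : R) : 0 < e ->
  (forall h, `|h| < e -> a * h <= p * h + c * h ^+ 2) -> a = p.
Proof.
move=> e0 he; apply/eqP; rewrite eq_le; apply/andP; split.
  apply: (@le_limit0 _ _ c e) => // h h0 hlt.
  have := he h ltac:(rewrite gtr0_norm //).
  by rewrite expr2 mulrA -mulrDl ler_pM2r.
apply: (@le_limit0 _ _ c e) => // h h0 hlt.
have := he (- h) ltac:(rewrite normrN gtr0_norm //).
rewrite sqrrN expr2 mulrA => h1.
have : p * h <= (a + c * h) * h by clra.
by rewrite ler_pM2r.
Qed.

(** Reduction to [right_slope] along xb + s x with s = 1 or -1. As V is only lower semi-continuous,
    it is replaced by its minimum g with a line V xb + M x, which bounds g from above near 0; the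
    maximality of U - V bounds it from below. *)
Lemma side_slope (s : R) H L U V xb rho N d A B : s ^+ 2 = 1 ->
  (forall p q, `|H p - H q| <= L * `|p - q|) ->
  (forall a, exists C, forall p, C <= `|p| -> a <= H p) -> A < B ->
  0 < rho -> 0 < d ->
  (forall x y, `|x - xb| < rho -> `|y - xb| < rho ->
     `|U x - U y| <= N * `|x - y|) ->
  (forall x, `|x - xb| < rho -> usc_at (fun z => - V z) x) ->
  (forall x p c, 0 < x < rho -> contact U (xb + s * x) p c -> H p <= A) ->
  (forall x p c, 0 < x < rho -> V (xb + s * x) < V xb + d ->
     contact (fun z => - V z) (xb + s * x) p c -> B <= H (- p)) ->
  (forall x, `|x - xb| < rho -> U x - V x <= U xb - V xb) ->
  exists2 p, A < H p < B & exists2 r, 0 < r & forall x, 0 < x < r ->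
    U (xb + s * x) <= U xb + p * (s * x) /\ V xb + p * (s * x) <= V (xb + s * x).
Proof.
move=> s2 Hlip Hco AB rho0 d0 UN Vusc subU supV UV.
have sn : `|s| = 1.
  by apply/eqP; rewrite -(@eqrXn2 _ 2) // ?normr_ge0 // expr1n -normrX s2 normr1.
have ss x : s * (s * x) = x by rewrite mulrA -expr2 s2 mul1r.
have [C HC] := Hco B.
(* M exceeds the Lipschitz constant of U, so that capping V keeps U - V maximal at xb, and the
   threshold C, so that contacts on the cap have H >= B. The choice r <= d / M keeps uncapped values
   of g below V xb + d. *)
pose M := `|N| + `|C| + 1.
have MN : N <= M by rewrite /M; have := ler_norm N; have := normr_ge0 C; clra.
have MC : C <= M by rewrite /M; have := ler_norm C; have := normr_ge0 N; clra.
have M0 : 0 < M by rewrite /M; have := normr_ge0 C; have := normr_ge0 N; clra.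
pose r := Num.min rho (d / M).
have r0 : 0 < r by rewrite lt_min rho0 divr_gt0.
have rrho : r <= rho by rewrite ge_min lexx.
have rM : r * M <= d by rewrite -ler_pdivlMr // ge_min lexx orbT.
have dist x : 0 <= x -> x < r -> `|xb + s * x - xb| < rho.
  by move=> x0 xr; rewrite addrAC subrr add0r normrM sn mul1r ger0_norm //; clra.
pose f x := U (xb + s * x).
pose g x := Num.min (V (xb + s * x)) (V xb + M * x).
have f0 : f 0 = U xb by rewrite /f mulr0 addr0.
have g0 : g 0 = V xb by rewrite /g !mulr0 !addr0 minxx.
have UN0 x : 0 <= x -> x < r -> `|U (xb + s * x) - U xb| <= N * x.
  move=> x0 xr; apply: (le_trans (UN _ _ (dist _ x0 xr) _)).
    by rewrite subrr normr0.
  by rewrite addrAC subrr add0r normrM sn mul1r ger0_norm.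
have UVx x : 0 <= x -> x < r ->
    U (xb + s * x) - V (xb + s * x) <= U xb - V xb.
  by move=> x0 xr; apply: UV; exact: dist.
have gV x : g x <= V (xb + s * x) by rewrite ge_min lexx.
have gM x : g x <= V xb + M * x by rewrite ge_min lexx orbT.
have tr e x (F : R -> R) c p (y : R) :
    (forall z, `|z - x| < e -> F (xb + s * z) <= F (xb + s * x) + p * (z - x)
        + c * (z - x) ^+ 2) -> `|y - (xb + s * x)| < e ->
    F y <= F (xb + s * x) + (s * p) * (y - (xb + s * x))
        + c * (y - (xb + s * x)) ^+ 2.
  move=> he ye; pose z := s * (y - xb).
  have yE : y = xb + s * z by rewrite /z ss; ring.
  have zE : s * (z - x) = y - (xb + s * x) by rewrite yE; ring.
  have := he z; rewrite -yE -(mul1r `|z - x|) -sn -normrM zE => /(_ ye).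
  have -> : (z - x) ^+ 2 = (s * (z - x)) ^+ 2 by rewrite exprMn s2 mul1r.
  have -> : p * (z - x) = s * p * (s * (z - x)).
    by rewrite [s * p]mulrC -mulrA ss.
  by rewrite zE.
have [||||||||||p Hp [r' r'0 h]] := @right_slope (fun p => H (s * p)) L C f g r N M A B.
- move=> p q; apply: (le_trans (Hlip _ _)).
  by rewrite -mulrBr normrM sn mul1r.
- by move=> p Cp; apply: HC; rewrite normrM sn mul1r.
- exact: AB.
- exact: r0.
- move=> x y x0 xy yr; rewrite /f; apply: (le_trans (UN _ _ _ _)).
  + by apply: dist; clra.
  + by apply: dist; clra.
  have -> : xb + s * y - (xb + s * x) = s * (y - x) by ring.
  by rewrite normrM sn mul1r ger0_norm // subr_ge0 ltW.
- move=> x /andP[x0 xr]; rewrite g0 ler_norml; apply/andP; split; last first.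
    by have := gM x; clra.
  suff : V xb - M * x <= g x by clra.
  rewrite le_min; apply/andP; split; last first.
    have : 0 < M * x by rewrite mulr_gt0.
    clra.
  have := UVx x (ltW x0) xr; have := UN0 x (ltW x0) xr.
  rewrite ler_norml => /andP[h1 h2] h3.
  have : N * x <= M * x by rewrite ler_pM2r.
  clra.
- move=> x /andP[x0 xr] a; rewrite ltrNl lt_min => /andP[h1 h2].
  have [|e e0 he] := Vusc (xb + s * x) (dist _ (ltW x0) xr) a; first by rewrite ltrNl.
  exists (Num.min e ((V xb + M * x + a) / M)).
    by rewrite lt_min e0 divr_gt0 //; clra.
  move=> y; rewrite lt_min ltr_pdivlMr // => /andP[ye yM].
  rewrite ltrNl lt_min; apply/andP; split.
    rewrite -ltrNl; apply: he.
    have -> : xb + s * y - (xb + s * x) = s * (y - x) by ring.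
    by rewrite normrM sn mul1r.
  have : - ((y - x) * M) <= `|y - x| * M.
    by rewrite -mulNr ler_pM2r //; have := ler_norm (- (y - x)); rewrite normrN.
  clra.
- move=> x p c /andP[x0 xr] Hp [e e0 he].
  have : H (s * p) <= A.
    apply: (subU x _ c); first clra.
    by exists e => // y; exact: tr.
  clra.
- move=> x p c /andP[x0 xr] Hp [e e0 he].
  have [ltx|lex] := ltP (V (xb + s * x)) (V xb + M * x).
    have gx : g x = V (xb + s * x) by rewrite /g min_l // ltW.
    suff : B <= H (- (s * p)) by rewrite -mulrN; clra.
    apply: (supV x _ c); first clra.
      apply: lt_le_trans ltx _; rewrite lerD2l.
      by apply: le_trans rM; rewrite mulrC ler_pM2r //; clra.
    exists e => // y; apply: (tr e x (fun z => - V z) c p) => z ze.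
    have := he z ze; rewrite gx; have := gV z; clra.
  have gx : g x = V xb + M * x by rewrite /g min_r.
  (* g lies below the line and meets it at x, so a parabola above -g at x is also above the line's
     opposite, and its slope is forced. *)
  have E : - M = p.
    apply: (@slope_unique _ _ c e e0) => h hlt.
    have := he (x + h); rewrite addrAC subrr add0r => /(_ hlt).
    have := gM (x + h); rewrite gx; clra.
  have : B <= H (s * - p).
    by apply: HC; rewrite normrM sn mul1r -E opprK ger0_norm // ltW.
  clra.
- move=> x /andP[x0 xr]; rewrite f0 g0 /f /g.
  have [h|h] := leP (V (xb + s * x)) (V xb + M * x); first exact: UVx (ltW x0) xr.
  have := UN0 x (ltW x0) xr; rewrite ler_norml => /andP[_].
  have : N * x <= M * x by rewrite ler_pM2r.
  clra.
exists (s * p) => //; exists r' => // x xr'; have [h1 h2] := h x xr'.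
rewrite f0 in h1; rewrite g0 in h2; rewrite -mulrA.
have E : s * (p * (s * x)) = p * x by rewrite mulrCA ss.
by rewrite E; split => //; exact: le_trans h2 (gV x).
Qed.

End OneSidedSlopes.

(** * Stationary inequalities at a junction and their comparison *)

Section Stationary.
Context {R : realType}.
Implicit Types (f g H U V : R -> R) (F : R -> R -> R).
Implicit Types (A B C L M N a b c d e k m p q r rho s t x y z xb : R).

(** A change of sign exchanges super-solutions with sub-solutions for the dual data. Coercivity is
    lost in the exchange, which is why U and V are treated differently. *)
Definition dualH H p : R := - H (- p).
Definition dualF F p q : R := - F (- p) (- q).

(** The restriction to values above U xb - d reflects the origin of U as a maximum over time: only
    there are the maximisers known to stay near the reference time. *)
Definition stationary_sub HL HR F A U xb r d : Prop :=
  (forall x p c, `|x - xb| < r -> U xb - d < U x -> contact U x p c ->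
     (x < 0 -> HL p <= A) /\ (0 < x -> HR p <= A)) /\
  (forall pL pR, `|xb| < r -> U xb - d < U 0 ->
     (exists2 e, 0 < e & forall y, `|y| < e ->
        U y <= U 0 + (if y <= 0 then pL else pR) * y) ->
     Num.min (Num.min (HL pL) (HR pR)) (F pL pR) <= A).

Definition coercive H := forall a, exists C, forall p, C <= `|p| -> a <= H p.

Lemma usc_atD_lip f g M x : usc_at f x ->
  (forall y, `|g y - g x| <= M * `|y - x|) -> usc_at (fun y => f y + g y) x.
Proof.
move=> fusc glip a fga.
have [|e e0 he] := fusc ((a - g x + f x) / 2); first clra.
have M1 : 0 < `|M| + 1 by rewrite ltr_wpDl.
exists (Num.min e ((a - g x - f x) / 2 / (`|M| + 1))).
  rewrite lt_min e0; apply: divr_gt0 => //; clra.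
move=> y; rewrite lt_min ltr_pdivlMr // => /andP[/he h1 h2].
have := le_trans (ler_norm _) (glip y).
have : M * `|y - x| <= `|M| * `|y - x| by rewrite ler_wpM2r // ler_norm.
have := normr_ge0 (y - x); clra.
Qed.

Lemma usc_at_segment_max f a b : a <= b ->
  (forall x, a <= x <= b -> usc_at f x) ->
  exists2 m, a <= m <= b & forall y, a <= y <= b -> f y <= f m.
Proof.
move=> ab h; apply: usc_segment_max => // x xab c /(h x xab)[e e0 he].
by exists e => // y _; exact: he.
Qed.

(** U lies below every cone of slope N with vertex near xb: a contact away from the vertex would
    have a slope of modulus N, which coercivity excludes. *)
Lemma stationary_sub_lipschitz HL HR F A U xb r d :
  coercive HL -> coercive HR -> coercive (fun p => F p p) ->
  0 < r -> 0 < d -> (forall x, `|x - xb| < r -> usc_at U x) ->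
  stationary_sub HL HR F A U xb r d ->
  exists2 rho, 0 < rho & exists N, forall x, `|x - xb| < rho ->
    [/\ `|x - xb| < r, U xb - d < U x &
        forall y, `|y - xb| < rho -> `|U x - U y| <= N * `|x - y|].
Proof.
move=> cHL cHR cF r0 d0 usc [int jun].
have [CL hL] := cHL (A + 1); have [CR hR] := cHR (A + 1).
have [CF hF] := cF (A + 1).
have [||e e0 he] := usc xb _ (U xb + 1).
- by rewrite subrr normr0.
- clra.
pose h := Num.min (r / 2) (e / 2).
have h0 : 0 < h by rewrite lt_min; clra.
have hr : h < r by rewrite gt_min; apply/orP; left; clra.
have hhe : h < e by rewrite gt_min; apply/orP; right; clra.
(* N passes the three coercivity thresholds, and 4 / h makes the cone too steep for a contact at
   distance h from xb, where U < U xb + 1. Below, rho N <= d keeps the contact value above U xb -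
   d. *)
pose N := `|CL| + `|CR| + `|CF| + 4 / h.
have h4 : 0 < 4 / h by apply: divr_gt0.
have [n1 n2 n3] : [/\ 0 <= `|CL|, 0 <= `|CR| & 0 <= `|CF|] by [].
have NL : CL <= N by rewrite /N; have := ler_norm CL; clra.
have NR : CR <= N by rewrite /N; have := ler_norm CR; clra.
have NF : CF <= N by rewrite /N; have := ler_norm CF; clra.
have N0 : 0 < N by rewrite /N; clra.
have Nh : 4 <= N * h by rewrite -ler_pdivrMr // /N; clra.
clearbody N.
pose rho := Num.min (h / 4) (d / N).
have rho0 : 0 < rho by rewrite lt_min divr_gt0 //= divr_gt0.
have rhoh : rho <= h / 4 by rewrite ge_min lexx.
have rhoN : rho * N <= d by rewrite -ler_pdivlMr // ge_min lexx orbT.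
clearbody rho.
have key x1 : `|x1 - xb| < rho -> forall y, `|y - xb| <= h ->
    U y <= U x1 + N * `|y - x1|.
  move=> x1b.
  have x1b' : `|xb - x1| < rho by rewrite distrC.
  have [||x2 x2b hx2] := @usc_at_segment_max (fun y => U y + - (N * `|y - x1|))
      (xb - h) (xb + h); first clra.
    move=> y yb; apply: (@usc_atD_lip _ _ N).
      by apply: usc; rewrite ltr_norml; clra.
    move=> z; rewrite opprK addrC -mulrBr normrM (gtr0_norm N0) ler_pM2l //.
    apply: (le_trans (ler_dist_dist _ _)).
    have -> : y - x1 - (z - x1) = - (z - y) by ring.
    by rewrite normrN.
  have Uxb : U xb - N * rho < U x2 - N * `|x2 - x1|.
    have := hx2 xb ltac:(clra).
    have : N * `|xb - x1| < N * rho by rewrite ltr_pM2l.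
    clra.
  have [x21|x21] := eqVneq x2 x1.
    move=> y; rewrite ler_distlC => yb; have := hx2 y ltac:(clra).
    rewrite x21 subrr normr0; clra.
  exfalso.
  have n21 : 0 < `|x2 - x1| by rewrite normr_gt0 subr_eq0.
  have Ux2 : U xb - d < U x2.
    have : 0 < N * `|x2 - x1| by rewrite mulr_gt0.
    clra.
  have x2h : `|x2 - xb| < h.
    rewrite lt_neqAle; apply/andP; split; last first.
      by rewrite ler_norml; clra.
    apply/eqP => E.
    have h1 := he x2 ltac:(by rewrite E).
    have : h <= `|x2 - x1| + `|x1 - xb|.
      by rewrite -E; apply: ler_distD.
    move=> h2.
    have : N * (h / 2) <= N * `|x2 - x1| by rewrite ler_pM2l //; clra.
    have : N * rho <= N * (h / 4) by rewrite ler_pM2l.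
    clra.
  have touch p : p = (if x1 < x2 then N else - N) ->
      forall y, `|y - x2| < Num.min `|x2 - x1| (h - `|x2 - xb|) ->
      U y <= U x2 + p * (y - x2).
    move=> -> y; rewrite lt_min => /andP[hy1 hy2].
    have yb : xb - h <= y <= xb + h.
      have : `|y - xb| <= h.
        have := ler_distD x2 y xb; clra.
      rewrite ler_norml; clra.
    have := hx2 y yb.
    move: hy1; case: (ltP x1 x2) => [lt|le].
      rewrite (@gtr0_norm _ (x2 - x1)) ?subr_gt0 // ltr_norml => /andP[h1 h2].
      rewrite ger0_norm; last clra.
      clra.
    rewrite (@ler0_norm _ (x2 - x1)) ?subr_le0 // ltr_norml => /andP[h1 h2].
    rewrite ler0_norm; last clra.
    clra.
  pose p := if x1 < x2 then N else - N.
  have pN : `|p| = N by rewrite /p; case: ifP => _; rewrite ?normrN gtr0_norm.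
  have m0 : 0 < Num.min `|x2 - x1| (h - `|x2 - xb|).
    by rewrite lt_min n21 subr_gt0.
  have cont : contact U x2 p 0.
    exists (Num.min `|x2 - x1| (h - `|x2 - xb|)) => // y hy.
    by rewrite mul0r addr0; exact: touch.
  have [hl hr'] := int x2 p 0 (lt_trans x2h hr) Ux2 cont.
  have [lt|gt|x20] := ltgtP x2 0.
  - have := hl lt; have := hL p; rewrite pN => /(_ NL); clra.
  - have := hr' gt; have := hR p; rewrite pN => /(_ NR); clra.
  (* Away from its vertex the cone is a line with the same slope on both sides of the junction, so F
     enters through its diagonal. *)
  have : Num.min (Num.min (HL p) (HR p)) (F p p) <= A.
    rewrite x20 sub0r normrN in x2h.
    rewrite x20 in Ux2.
    apply: jun => //; first exact: lt_trans x2h hr.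
    exists (Num.min `|x2 - x1| (h - `|x2 - xb|)) => // y hy.
    have := touch p erefl y; rewrite x20 !subr0 if_same; apply.
    by move: hy; rewrite x20.
  apply/negP; rewrite -ltNge !lt_min.
  have := hL p; have := hR p; have := hF p; rewrite pN.
  move=> /(_ NF) h1 /(_ NR) h2 /(_ NL) h3; clra.
exists rho => //; exists N => x xb'.
have Ux : U xb - d < U x.
  have := key x xb' xb; rewrite subrr normr0 => /(_ (ltW h0)).
  rewrite distrC.
  have : N * `|x - xb| < N * rho by rewrite ltr_pM2l.
  clra.
split=> //; first clra.
move=> y yb.
have h1 := key x xb' y ltac:(clra).
have h2 := key y yb x ltac:(clra).
rewrite ler_norml; rewrite (distrC y x) in h1; clra.
Qed.

(** Each side of xb supplies a slope with A < H < B. If pR <= pL, the line of slope pR touches U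
    from above and forces H pR <= A; otherwise it touches V from below and forces B <= H pR. *)
Lemma interior_contradiction H L U V xb rho N d A B :
  (forall p q, `|H p - H q| <= L * `|p - q|) -> coercive H -> A < B ->
  0 < rho -> 0 < d ->
  (forall x y, `|x - xb| < rho -> `|y - xb| < rho ->
     `|U x - U y| <= N * `|x - y|) ->
  (forall x, `|x - xb| < rho -> usc_at (fun z => - V z) x) ->
  (forall x p c, `|x - xb| < rho -> contact U x p c -> H p <= A) ->
  (forall x p c, `|x - xb| < rho -> V x < V xb + d ->
     contact (fun z => - V z) x p c -> B <= H (- p)) ->
  (forall x, `|x - xb| < rho -> U x - V x <= U xb - V xb) -> False.
Proof.
move=> Hlip Hco AB rho0 d0 UN Vusc subU supV UV.
have side s : s ^+ 2 = 1 -> `|s| = 1 ->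
    exists2 p, A < H p < B & exists2 r, 0 < r & forall x, 0 < x < r ->
    U (xb + s * x) <= U xb + p * (s * x) /\ V xb + p * (s * x) <= V (xb + s * x).
  move=> s2 sn.
  have dist x : 0 < x < rho -> `|xb + s * x - xb| < rho.
    move=> /andP[x0 xr].
    by rewrite addrAC subrr add0r normrM sn mul1r gtr0_norm.
  apply: (side_slope s2 Hlip Hco AB rho0 d0 UN Vusc _ _ UV).
    by move=> x p c /dist xr; exact: subU.
  by move=> x p c /dist xr; exact: supV.
have [pR hpR [r1 r10 hR]] := side 1 (expr1n _ _) (normr1 _).
have [pL hpL [r2 r20 hL]] := side (-1) (sqrr_sign _ 1) (normrN1 _).
have m0 : 0 < Num.min r1 r2 by rewrite lt_min r10.
have xb0 : `|xb - xb| < rho by rewrite subrr normr0.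
have cases y : `|y - xb| < Num.min r1 r2 ->
    [\/ y = xb, xb < y /\ (U y <= U xb + pR * (y - xb) /\ V xb + pR * (y - xb) <= V y)
     | y < xb /\ (U y <= U xb + pL * (y - xb) /\ V xb + pL * (y - xb) <= V y)].
  rewrite lt_min !ltr_norml => /andP[/andP[a1 a2] /andP[a3 a4]].
  have [lt|gt|->] := ltgtP y xb.
  - apply: Or33; split=> //.
    have := hL (xb - y) ltac:(clra).
    have -> : xb + -1 * (xb - y) = y by ring.
    by have -> : -1 * (xb - y) = y - xb by ring.
  - apply: Or32; split=> //.
    have := hR (y - xb) ltac:(clra).
    have -> : xb + 1 * (y - xb) = y by ring.
    by rewrite mul1r.
  - exact: Or31.
have [le|lt] := leP pR pL.
  have : H pR <= A; last clra.
  apply: (subU xb pR 0 xb0); exists (Num.min r1 r2) => // y /cases[->|[lty [h _]]|[lty [h _]]].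
  - by rewrite subrr mulr0 mul0r !addr0.
  - clra.
  have : 0 <= (pL - pR) * (xb - y) by rewrite mulr_ge0; clra.
  clra.
have : B <= H (- (- pR)); last by rewrite opprK; clra.
apply: (supV xb (- pR) 0 xb0); first clra.
exists (Num.min r1 r2) => // y /cases[->|[lty [_ h]]|[lty [_ h]]].
- by rewrite subrr mulr0 mul0r !addr0.
- clra.
have : 0 <= (pR - pL) * (xb - y) by rewrite mulr_ge0; clra.
clra.
Qed.

Lemma stationary_comparison HL HR F LL LR U V xb r d A B :
  (forall p q, `|HL p - HL q| <= LL * `|p - q|) ->
  (forall p q, `|HR p - HR q| <= LR * `|p - q|) ->
  coercive HL -> coercive HR -> coercive (fun p => F p p) ->
  A < B -> 0 < r -> 0 < d ->
  (forall x, `|x - xb| < r -> usc_at U x) ->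
  (forall x, `|x - xb| < r -> usc_at (fun z => - V z) x) ->
  stationary_sub HL HR F A U xb r d ->
  stationary_sub (dualH HL) (dualH HR) (dualF F) (- B) (fun z => - V z) xb r d ->
  (forall x, `|x - xb| < r -> U x - V x <= U xb - V xb) -> False.
Proof.
move=> HLlip HRlip cL cR cF AB r0 d0 Uusc Vusc Usub Vsup UV.
have [rho0 rho00 [N hN]] := stationary_sub_lipschitz cL cR cF r0 d0 Uusc Usub.
have [intU junU] := Usub; have [intV junV] := Vsup.
have hNr x : `|x - xb| < rho0 -> `|x - xb| < r by case/hN.
have subU x p c : `|x - xb| < rho0 -> contact U x p c ->
    (x < 0 -> HL p <= A) /\ (0 < x -> HR p <= A).
  by case/hN=> xr Ux _; exact: intU.
have supV x p c : `|x - xb| < rho0 -> V x < V xb + d ->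
    contact (fun z => - V z) x p c ->
    (x < 0 -> B <= HL (- p)) /\ (0 < x -> B <= HR (- p)).
  move=> /hNr xr Vx /(intV _ _ _ xr)[|h1 h2]; first clra.
  by split=> [/h1|/h2]; rewrite /dualH lerN2.
have UN rho : rho <= rho0 -> forall x y, `|x - xb| < rho -> `|y - xb| < rho ->
    `|U x - U y| <= N * `|x - y|.
  move=> rr x y xr yr; have [|_ _] := hN x; first exact: lt_le_trans rr.
  by apply; exact: lt_le_trans rr.
have Vu rho : rho <= rho0 -> forall x, `|x - xb| < rho ->
    usc_at (fun z => - V z) x.
  by move=> rr x xr; apply/Vusc/hNr; exact: lt_le_trans rr.
have UVr rho : rho <= rho0 -> forall x, `|x - xb| < rho ->
    U x - V x <= U xb - V xb.
  by move=> rr x xr; apply/UV/hNr; exact: lt_le_trans rr.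
have [lt|gt|xb0] := ltgtP xb 0.
- pose rho := Num.min rho0 (- xb).
  have rr : rho <= rho0 by rewrite ge_min lexx.
  have rx : rho <= - xb by rewrite ge_min lexx orbT.
  have rp : 0 < rho by rewrite lt_min rho00 oppr_gt0.
  have neg x : `|x - xb| < rho -> x < 0 by rewrite ltr_norml; clra.
  apply: (@interior_contradiction HL LL U V xb rho N d A B) => //.
  + exact: UN.
  + exact: Vu.
  + by move=> x p c xr /(subU _ _ _ (lt_le_trans xr rr))[h _]; exact/h/neg/xr.
  + move=> x p c xr Vx /(supV _ _ _ (lt_le_trans xr rr) Vx)[h _].
    exact/h/neg/xr.
  + exact: UVr.
- pose rho := Num.min rho0 xb.
  have rr : rho <= rho0 by rewrite ge_min lexx.
  have rx : rho <= xb by rewrite ge_min lexx orbT.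
  have rp : 0 < rho by rewrite lt_min rho00.
  have pos x : `|x - xb| < rho -> 0 < x by rewrite ltr_norml; clra.
  apply: (@interior_contradiction HR LR U V xb rho N d A B) => //.
  + exact: UN.
  + exact: Vu.
  + by move=> x p c xr /(subU _ _ _ (lt_le_trans xr rr))[_ h]; exact/h/pos/xr.
  + move=> x p c xr Vx /(supV _ _ _ (lt_le_trans xr rr) Vx)[_ h].
    exact/h/pos/xr.
  + exact: UVr.
have dist s x : `|s| = 1 -> 0 < x < rho0 -> `|xb + s * x - xb| < rho0.
  move=> sn /andP[x0 xr].
  by rewrite addrAC subrr add0r normrM sn mul1r gtr0_norm.
have [pR hpR [r1 r10 hR]] : exists2 p, A < HR p < B & exists2 r, 0 < r &
    forall x, 0 < x < r -> U (xb + 1 * x) <= U xb + p * (1 * x)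
    /\ V xb + p * (1 * x) <= V (xb + 1 * x).
  apply: (side_slope (expr1n _ _) HRlip cR AB rho00 d0 (UN _ (lexx _))
      (Vu _ (lexx _)) _ _ (UVr _ (lexx _))).
  + move=> x p c xr /(subU _ _ _ (dist _ _ (normr1 _) xr))[_]; apply.
    by rewrite xb0 add0r mul1r; case/andP: xr.
  + move=> x p c xr Vx /(supV _ _ _ (dist _ _ (normr1 _) xr) Vx)[_]; apply.
    by rewrite xb0 add0r mul1r; case/andP: xr.
have [pL hpL [r2 r20 hL]] : exists2 p, A < HL p < B & exists2 r, 0 < r &
    forall x, 0 < x < r -> U (xb + -1 * x) <= U xb + p * (-1 * x)
    /\ V xb + p * (-1 * x) <= V (xb + -1 * x).
  apply: (side_slope (sqrr_sign _ 1) HLlip cL AB rho00 d0 (UN _ (lexx _))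
      (Vu _ (lexx _)) _ _ (UVr _ (lexx _))).
  + move=> x p c xr /(subU _ _ _ (dist _ _ (normrN1 _) xr))[+ _]; apply.
    by rewrite xb0 add0r mulN1r oppr_lt0; case/andP: xr.
  + move=> x p c xr Vx /(supV _ _ _ (dist _ _ (normrN1 _) xr) Vx)[+ _]; apply.
    by rewrite xb0 add0r mulN1r oppr_lt0; case/andP: xr.
have m0 : 0 < Num.min r1 r2 by rewrite lt_min r10.
have cases y : `|y| < Num.min r1 r2 ->
    U y <= U 0 + (if y <= 0 then pL else pR) * y /\
    V 0 + (if y <= 0 then pL else pR) * y <= V y.
  rewrite lt_min !ltr_norml => /andP[/andP[a1 a2] /andP[a3 a4]].
  rewrite xb0 in hL hR.
  have [lt|gt|->] := ltgtP y 0.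
  - have := hL (- y) ltac:(clra).
    have -> : 0 + -1 * - y = y by ring.
    by have -> : -1 * - y = y by ring.
  - by have := hR y ltac:(clra); rewrite add0r mul1r.
  - by rewrite mulr0 !addr0.
have xr : `|xb| < r by rewrite xb0 normr0.
have h1 : Num.min (Num.min (HL pL) (HR pR)) (F pL pR) <= A.
  apply: junU => //; first by rewrite xb0; clra.
  by exists (Num.min r1 r2) => // y /cases[].
have h2 : Num.min (Num.min (dualH HL (- pL)) (dualH HR (- pR)))
    (dualF F (- pL) (- pR)) <= - B.
  apply: junV => //; first by rewrite xb0; clra.
  exists (Num.min r1 r2) => // y /cases[_].
  by case: ifP => _; clra.
(* The alternatives with HL pL or HR pR contradict A < HL pL < B and A < HR pR < B; what remains is
   F pL pR <= A and B <= F pL pR. *)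
move: h1 h2; rewrite /dualH /dualF !opprK !ge_min -!orbA.
move=> /or3P[?|?|?] /or3P[?|?|?]; clra.
Qed.

End Stationary.

(** * Wedge test functions and duality *)

Section TestFunctions.
Context {R : realType}.
Implicit Types (f g H U V : R -> R) (F : R -> R -> R) (u v phi : R * R -> R).
Implicit Types (A B C K L M N T a b c d e k l m p q r rho s t x y z xb : R).

Lemma derive_withinP (D : set R) f x l : derive_within D f x l <->
  forall e, 0 < e -> exists2 d, 0 < d & forall y, D y -> y != x ->
    `|y - x| < d -> `|(f y - f x) / (y - x) - l| < e.
Proof.
split.
  move=> /cvgrPdist_lt h e e0; have := h e e0.
  case/near1P => d d0 hd.
  exists d => // y Dy yx yd; rewrite distrC; exact: hd.
move=> h; apply/cvgrPdist_lt => e /h[d d0 hd].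
apply/near1P; exists d => // y yd yx Dy; rewrite distrC; exact: hd.
Qed.

Lemma is_derive_within (D : set R) f g x l : is_derive x 1 g l -> D x ->
  (forall y, D y -> f y = g y) -> derive_within D f x l.
Proof.
move=> dg Dx fg; apply/derive_withinP => e e0.
have := @ex_derive _ _ _ _ _ _ _ dg.
move=> /cvgP; rewrite -[lim _]/('D_1 g x) (@derive_val _ _ _ _ _ _ _ dg).
move=> /cvgrPdist_lt /(_ e e0)/near1P[d d0 hd].
exists d => // y Dy yx yd; rewrite !fg //.
have := hd (y - x); rewrite subr0 => /(_ yd); rewrite subr_eq0 => /(_ yx).
rewrite distrC /GRing.scale /= mulr1 subrK [_^-1 * _]mulrC.
exact.
Qed.

(** The restrictions of [wedge_test] in time and, on either half-line, in space all have this
    one-variable form. *)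
Lemma is_derive_test C k l p c y x : is_derive x 1
  (fun z => C + expR (k * z + l) + p * z + c * (z - y) ^+ 2)
  (k * expR (k * x + l) + p + 2 * c * (x - y)).
Proof.
have d1 : is_derive x 1 (fun z => k * z + l) k.
  have := is_deriveD (is_deriveZ k (is_derive_id x 1)) (is_derive_cst l x 1).
  by rewrite addr0 /GRing.scale /= mulr1.
have d2 := @is_derive1_comp R expR (fun z => k * z + l) x _ _
    (is_derive_expR (k * x + l)) d1.
have d3 := is_deriveZ p (is_derive_id x (1 : R)).
have d4 : is_derive x 1 (fun z => z - y) 1.
  have := is_deriveD (is_derive_id x 1) (is_derive_cst (- y) x 1).
  by rewrite addr0.
have d5 := is_deriveZ c (is_deriveX 2 d4).
have := is_deriveD (is_deriveD (is_deriveD (is_derive_cst C x 1) d2) d3) d5.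
move/is_derive_eq; apply.
by rewrite /GRing.scale /= add0r; ring.
Qed.

(** For large m this is tiny well inside the backward cone |x| + K t < r of speed K and huge well
    outside it. *)
Definition cone_weight m K (r : R) (X : R * R) : R :=
  expR (m * (`|X.2| + K * X.1 - r)).

(** The terms (x - |x|) / 2 and (x + |x|) / 2 are min(x, 0) and max(x, 0), so that pL acts on the
    left half-line and pR on the right one. *)
Definition wedge_test C a b c m K r t1 x1 pL pR (X : R * R) : R :=
  C + a * (X.1 - t1) + b * (X.1 - t1) ^+ 2 + cone_weight m K r X +
  pL * ((X.2 - `|X.2|) / 2) + pR * ((X.2 + `|X.2|) / 2) + c * (X.2 - x1) ^+ 2.

Lemma continuous_cone_weight m K r : continuous (@cone_weight m K r).
Proof.
move=> X; rewrite /cone_weight; apply: continuous_comp; last exact: continuous_expR.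
apply: cvgM; first exact: cvg_cst.
apply: cvgB; last exact: cvg_cst.
apply: cvgD; first by apply: cvg_norm; exact: cvg_snd.
by apply: cvgM; [exact: cvg_cst|exact: cvg_fst].
Qed.

Lemma wedge_test_C1 T C a b c m K r t1 x1 pL pR :
  C1_wedge T (wedge_test C a b c m K r t1 x1 pL pR)
    (fun X => m * K * cone_weight m K r X + a + 2 * b * (X.1 - t1))
    (fun X => - m * cone_weight m K r X + pL + 2 * c * (X.2 - x1))
    (fun X => m * cone_weight m K r X + pR + 2 * c * (X.2 - x1)).
Proof.
have cw := @continuous_cone_weight m K r.
have cfst : continuous (fun X : R * R => X.1) by move=> X; exact: cvg_fst.
have csnd : continuous (fun X : R * R => X.2) by move=> X; exact: cvg_snd.
have ccst (k : R) : continuous (fun X : R * R => k) by move=> X; exact: cvg_cst.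
have cD (f g : R * R -> R) : continuous f -> continuous g ->
    continuous (fun X => f X + g X) by move=> cf cg X; exact: cvgD (cf X) (cg X).
have cM (f g : R * R -> R) : continuous f -> continuous g ->
    continuous (fun X => f X * g X) by move=> cf cg X; exact: cvgM (cf X) (cg X).
have cN (f : R * R -> R) : continuous f -> continuous (fun X => - f X).
  by move=> cf X; exact: cvgN (cf X).
have cA (f : R * R -> R) : continuous f -> continuous (fun X => `|f X|).
  by move=> cf X; exact: cvg_norm (cf X).
have cX (f : R * R -> R) : continuous f -> continuous (fun X => f X ^+ 2).
  move=> cf; rewrite (_ : (fun X => _) = fun X => f X * f X); first exact: cM.
  by apply: boolp.funext => X; rewrite expr2.
have ct : continuous (fun X : R * R =>
    m * K * cone_weight m K r X + a + 2 * b * (X.1 - t1)).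
  by repeat first [exact: cfst|exact: cw|exact: ccst|apply: (cD)|apply: (cM)|apply: (cN)].
split.
- apply: continuous_subspaceT; rewrite /wedge_test.
  have cB (f : R * R -> R) k : continuous f -> continuous (fun X => f X - k).
    by move=> cf; exact: cD _ _ cf (ccst _).
  have cZ (f : R * R -> R) k : continuous f -> continuous (fun X => k * f X).
    by move=> cf; exact: cM _ _ (ccst _) cf.
  have half (f : R * R -> R) : continuous f -> continuous (fun X => f X / 2).
    by move=> cf; exact: cM _ _ cf (ccst _).
  have cm := half _ (cD _ _ csnd (cN _ (cA _ csnd))).
  have cp := half _ (cD _ _ csnd (cA _ csnd)).
  have s1 := cD _ _ (ccst C) (cZ _ a (cB _ t1 cfst)).
  have s2 := cD _ _ (cD _ _ s1 (cZ _ b (cX _ (cB _ t1 cfst)))) cw.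
  have s3 := cD _ _ (cD _ _ s2 (cZ _ pL cm)) (cZ _ pR cp).
  exact: cD _ _ s3 (cZ _ c (cX _ (cB _ x1 csnd))).
- split.
  + exact: continuous_subspaceT.
  + apply: continuous_subspaceT.
    by repeat first [exact: csnd|exact: cw|exact: ccst|apply: (cD)|apply: (cM)|apply: (cN)].
  move=> [t x] [/= tT xle]; move: (xle); rewrite /= in_itv /= => x0; split.
    pose C' := C + pL * ((x - `|x|) / 2) + pR * ((x + `|x|) / 2) +
      c * (x - x1) ^+ 2 - a * t1.
    have := @is_derive_test C' (m * K) (m * (`|x| - r)) a b t1 t.
    rewrite /cone_weight /=.
    have -> : m * (`|x| + K * t - r) = m * K * t + m * (`|x| - r) by ring.
    move/is_derive_within; apply; first by split.
    move=> s _; rewrite /wedge_test /cone_weight /= /C'.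
    have -> : m * (`|x| + K * s - r) = m * K * s + m * (`|x| - r) by ring.
    ring.
  pose C' := C + a * (t - t1) + b * (t - t1) ^+ 2.
  have := @is_derive_test C' (- m) (m * (K * t - r)) pL c x1 x.
  rewrite /cone_weight /= ler0_norm //.
  have -> : m * (- x + K * t - r) = - m * x + m * (K * t - r) by ring.
  move/is_derive_within; apply; first by split.
  move=> y [_]; rewrite /= in_itv /= => y0.
  rewrite /wedge_test /cone_weight /= ler0_norm //.
  have -> : m * (- y + K * t - r) = - m * y + m * (K * t - r) by ring.
  by rewrite /C'; field.
- split.
  + exact: continuous_subspaceT.
  + apply: continuous_subspaceT.
    by repeat first [exact: csnd|exact: cw|exact: ccst|apply: (cD)|apply: (cM)|apply: (cN)].
  move=> [t x] [/= tT xle]; move: (xle); rewrite /= in_itv /= andbT => x0; split.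
    pose C' := C + pL * ((x - `|x|) / 2) + pR * ((x + `|x|) / 2) +
      c * (x - x1) ^+ 2 - a * t1.
    have := @is_derive_test C' (m * K) (m * (`|x| - r)) a b t1 t.
    rewrite /cone_weight /=.
    have -> : m * (`|x| + K * t - r) = m * K * t + m * (`|x| - r) by ring.
    move/is_derive_within; apply; first by split.
    move=> s _; rewrite /wedge_test /cone_weight /= /C'.
    have -> : m * (`|x| + K * s - r) = m * K * s + m * (`|x| - r) by ring.
    ring.
  pose C' := C + a * (t - t1) + b * (t - t1) ^+ 2.
  have := @is_derive_test C' m (m * (K * t - r)) pR c x1 x.
  rewrite /cone_weight /= ger0_norm //.
  have -> : m * (x + K * t - r) = m * x + m * (K * t - r) by ring.
  move/is_derive_within; apply; first by split.
  move=> y [_]; rewrite /= in_itv /= andbT => y0.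
  rewrite /wedge_test /cone_weight /= ger0_norm //.
  have -> : m * (y + K * t - r) = m * y + m * (K * t - r) by ring.
  by rewrite /C'; field.
Qed.

(** The weight drops out of the inequality. With z = m times its value at (t1, x1), it shifts the
    left and right slopes by -z and z and the time derivative by K z, and K z bounds the effect of
    these shifts: LL z, LR z, or 2 L0 z for F, both of whose arguments move. *)
Lemma subsolution_test HL HR F LL LR L0 K m r T u t1 x1 a b c pL pR :
  (forall p q, `|HL p - HL q| <= LL * `|p - q|) ->
  (forall p q, `|HR p - HR q| <= LR * `|p - q|) ->
  (forall p p' q, `|F p q - F p' q| <= L0 * `|p - p'|) ->
  (forall p q q', `|F p q - F p q'| <= L0 * `|q - q'|) ->
  0 <= m -> LL <= K -> LR <= K -> L0 + L0 <= K ->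
  subsolution HL HR F T u -> 0 < t1 < T ->
  (exists2 e, 0 < e & forall t x, `|t - t1| < e -> `|x - x1| < e ->
     u (t, x) <= u (t1, x1) + a * (t - t1) + b * (t - t1) ^+ 2 +
       (cone_weight m K r (t, x) - cone_weight m K r (t1, x1)) +
       (pL * ((x - `|x|) / 2) + pR * ((x + `|x|) / 2)) -
       (pL * ((x1 - `|x1|) / 2) + pR * ((x1 + `|x1|) / 2)) + c * (x - x1) ^+ 2) ->
  [/\ x1 < 0 -> a + HL pL <= 0, 0 < x1 -> a + HR pR <= 0
    & x1 = 0 -> a + Num.min (Num.min (HL pL) (HR pR)) (F pL pR) <= 0].
Proof.
move=> HLlip HRlip F1 F2 m0 LLK LRK L0K [_ sub] t1T [e e0 he].
pose C := u (t1, x1) - cone_weight m K r (t1, x1) -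
  (pL * ((x1 - `|x1|) / 2) + pR * ((x1 + `|x1|) / 2)).
have Q1 : Q T (t1, x1) by split => //=; rewrite in_itv.
have touch : touches_above u (wedge_test C a b c m K r t1 x1 pL pR) (t1, x1).
  split; first by rewrite /wedge_test /C /= !subrr expr0n /= !mulr0; ring.
  apply/near2P; exists e => // t x tt xx.
  apply: le_trans (he t x tt xx) _.
  by rewrite /wedge_test /C /=; clra.
have := sub _ _ _ _ (wedge_test_C1 T C a b c m K r t1 x1 pL pR) _ Q1 touch.
set z := m * cone_weight m K r (t1, x1).
have z0 : 0 <= z by rewrite mulr_ge0 // expR_ge0.
rewrite /= !subrr !mulr0 !addr0.
have -> : m * K * cone_weight m K r (t1, x1) = K * z by rewrite /z; ring.
have -> : - m * cone_weight m K r (t1, x1) = - z by rewrite /z; ring.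
rewrite -/z.
have hl : HL pL <= HL (- z + pL) + K * z.
  have := le_trans (ler_norm _) (HLlip pL (- z + pL)).
  have -> : pL - (- z + pL) = z by ring.
  rewrite ger0_norm //; have : LL * z <= K * z by rewrite ler_wpM2r.
  clra.
have hr : HR pR <= HR (z + pR) + K * z.
  have := le_trans (ler_norm _) (HRlip pR (z + pR)).
  have -> : pR - (z + pR) = - z by ring.
  rewrite normrN ger0_norm //; have : LR * z <= K * z by rewrite ler_wpM2r.
  clra.
have hf : F pL pR <= F (- z + pL) (z + pR) + K * z.
  have := le_trans (ler_norm _) (F1 pL (- z + pL) pR).
  have := le_trans (ler_norm _) (F2 (- z + pL) pR (z + pR)).
  have -> : pL - (- z + pL) = z by ring.
  have -> : pR - (z + pR) = - z by ring.
  rewrite normrN ger0_norm //.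
  have : (L0 + L0) * z <= K * z by rewrite ler_wpM2r.
  clra.
case=> h1 h2 h3; split.
- by move/h1; clra.
- by move/h2; clra.
move/h3 => h.
have : Num.min (Num.min (HL pL) (HR pR)) (F pL pR) <=
   Num.min (Num.min (HL (- z + pL)) (HR (z + pR))) (F (- z + pL) (z + pR)) + K * z.
  rewrite -lerBlDr !le_min !lerBlDr !ge_min hl hr hf /= !orbT //.
clra.
Qed.

Lemma C1_onN (D : set (R * R)) phi phit phix :
  C1_on D phi phit phix -> C1_on D (\- phi) (\- phit) (\- phix).
Proof.
have cN (f : R * R -> R) : {within D, continuous f} -> {within D, continuous (\- f)}.
  by move=> cf X; apply: cvgN; exact: cf.
have dN (E : set R) f x l : derive_within E f x l ->
    derive_within E (fun y => - f y) x (- l).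
  move=> /derive_withinP h; apply/derive_withinP => e /h[d d0 hd].
  exists d => // y Ey yx yd.
  have := hd y Ey yx yd; rewrite -normrN; congr (`|_| < e); ring.
move=> [c1 c2 h]; split; [exact: cN|exact: cN|].
by move=> X /h[h1 h2]; split; apply: dN.
Qed.

Lemma C1_wedgeN T phi phit phixL phixR : C1_wedge T phi phit phixL phixR ->
  C1_wedge T (\- phi) (\- phit) (\- phixL) (\- phixR).
Proof.
move=> [c hl hr]; split; [|exact: C1_onN|exact: C1_onN].
by move=> X; apply: cvgN; exact: c.
Qed.

Lemma oppr_max3 a b c :
  - Num.max (Num.max a b) c = Num.min (Num.min (- a) (- b)) (- c).
Proof. by rewrite !oppr_max. Qed.

Lemma supersolution_dual HL HR F T v : supersolution HL HR F T v ->
  subsolution (dualH HL) (dualH HR) (dualF F) T (\- v).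
Proof.
move=> [lsc sup]; split.
  move=> X QX a va; have := lsc X QX (- a); rewrite ltrNl => /(_ va).
  by apply: filterS => Y /=; rewrite ltrNl.
move=> phi phit phixL phixR C1 X QX [vX near].
have := sup _ _ _ _ (C1_wedgeN C1) X QX.
case.
  split; first by rewrite /= -vX /= opprK.
  by apply: filterS near => Y /=; rewrite lerNl.
rewrite /dualH /dualF /= => h1 h2 h3; split; [move/h1|move/h2|move/h3]; try clra.
by rewrite -oppr_max3; clra.
Qed.

Lemma subsolution_dual HL HR F T v :
  subsolution (dualH HL) (dualH HR) (dualF F) T (\- v) ->
  supersolution HL HR F T v.
Proof.
move=> [usc sub]; split.
  move=> X QX a va; have := usc X QX (- a); rewrite ltrN2 => /(_ va).
  by apply: filterS => Y /=; rewrite ltrN2.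
move=> phi phit phixL phixR C1 X QX [vX near].
have := sub _ _ _ _ (C1_wedgeN C1) X QX.
case.
  split; first by rewrite /= vX.
  by apply: filterS near => Y /=; rewrite lerN2.
rewrite /dualH /dualF /= !opprK => h1 h2 h3.
split; [move/h1|move/h2|move/h3]; try clra.
by rewrite -oppr_max3; clra.
Qed.

End TestFunctions.

(** * Comparison principle *)

Section Slices.
Context {R : realType}.
Implicit Types (f g H U V W : R -> R) (F : R -> R -> R) (u v phi : R * R -> R).
Implicit Types (A B C K L M N T a b c d e k l m p q r rho s t x y z xb tb : R).

Lemma near3P (X : R * R * R) (P : R * R * R -> Prop) :
  (exists2 e, 0 < e & forall t s x, `|t - X.1.1| < e -> `|s - X.1.2| < e ->
     `|x - X.2| < e -> P (t, s, x)) ->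
  \forall Y \near X, P Y.
Proof.
case=> e e0 h; apply/nbhs_ballP; exists e => //= -[[t s] x].
case=> -[]; rewrite /ball /= => h1 h2 h3.
by apply: h; rewrite distrC.
Qed.

Lemma cone_weight_near m K r (X : R * R) e : 0 < e ->
  exists2 d, 0 < d & forall t x, `|t - X.1| < d -> `|x - X.2| < d ->
    `|cone_weight m K r (t, x) - cone_weight m K r X| < e.
Proof.
move=> e0; have /cvgrPdist_lt/(_ e e0) := @continuous_cone_weight R m K r X.
case/near2P => d d0 hd; exists d => // t x tX xX.
by rewrite distrC; exact: hd.
Qed.

Lemma quad_near (a k tb t e : R) : 0 < e ->
  exists2 d, 0 < d & forall s, `|s - t| < d ->
    `|(a * (s - tb) + k * (s - tb) ^+ 2) - (a * (t - tb) + k * (t - tb) ^+ 2)| < e.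
Proof.
move=> e0.
pose B := `|a| + `|k| * (1 + 2 * `|t - tb|) + 1.
have k0 : 0 <= `|k| * (1 + 2 * `|t - tb|).
  by rewrite mulr_ge0 // addr_ge0 // mulr_ge0.
have B0 : 0 < B by rewrite /B; have := normr_ge0 a; clra.
exists (Num.min 1 (e / B)); first by rewrite lt_min ltr01 divr_gt0.
move=> s; rewrite lt_min ltr_pdivlMr // => /andP[s1 s2].
have -> : a * (s - tb) + k * (s - tb) ^+ 2 - (a * (t - tb) + k * (t - tb) ^+ 2) =
   (s - t) * (a + k * ((s - t) + 2 * (t - tb))) by ring.
rewrite normrM; apply: le_lt_trans s2; apply: ler_wpM2l => //.
apply: (le_trans (ler_normD _ _)); rewrite normrM.
have : `|s - t + 2 * (t - tb)| <= 1 + 2 * `|t - tb|.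
  apply: (le_trans (ler_normD _ _)); rewrite normrM (@ger0_norm _ 2) //; clra.
move=> /(ler_wpM2l (normr_ge0 k)); rewrite /B; clra.
Qed.

(* The function tilted by its time-quadratic is maximised over time slice by
   slice; near [xb] the maximisers stay near [tb], so that the maximum solves a
   stationary inequality. *)
Lemma slice_stationary HL HR F LL LR L0 K m r0 T T1 u tb xb l k k0 s :
  (forall p q, `|HL p - HL q| <= LL * `|p - q|) ->
  (forall p q, `|HR p - HR q| <= LR * `|p - q|) ->
  (forall p p' q, `|F p q - F p' q| <= L0 * `|p - p'|) ->
  (forall p q q', `|F p q - F p q'| <= L0 * `|q - q'|) ->
  0 <= m -> LL <= K -> LR <= K -> L0 + L0 <= K ->
  subsolution HL HR F T u -> usc_on Qbar u -> 0 < tb < T1 -> T1 <= T ->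
  0 < k0 -> 0 <= k -> 0 < s ->
  let G t x := u (t, x) - cone_weight m K r0 (t, x)
     - (l * (t - tb) + k * (t - tb) ^+ 2) in
  (forall t, 0 <= t <= T1 -> G t xb <= G tb xb - k0 * (t - tb) ^+ 2) ->
  exists U, [/\ U xb = G tb xb, forall x, usc_at U x,
    forall x, exists2 t, 0 <= t <= T1 & U x = G t x
    & exists2 r', 0 < r' & exists2 d, 0 < d &
      stationary_sub HL HR F (- l + s) U xb r' d].
Proof.
move=> HLlip HRlip F1 F2 m0 LLK LRK L0K sub usc /andP[tb0 tbT] T1T k00 kk0 s0.
move=> G strict.
have T10 : 0 <= T1 by clra.
have Gusc t x c : 0 <= t <= T1 -> G t x < c -> exists2 e, 0 < e &
    forall t' x', 0 <= t' <= T1 -> `|t' - t| < e -> `|x' - x| < e -> G t' x' < c.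
  move=> tT Gc; pose e := (c - G t x) / 3.
  have e0 : 0 < e by rewrite /e; clra.
  have QX : Qbar (t, x) by split => //=; rewrite in_itv /= andbT; clra.
  have /near2P[/= d1 d10 h1] := usc (t, x) QX (u (t, x) + e) ltac:(clra).
  have [/= d2 d20 h2] := cone_weight_near m K r0 (t, x) e0.
  have [d3 d30 h3] := quad_near l k tb t e0.
  exists (Num.min d1 (Num.min d2 d3)); first by rewrite !lt_min d10 d20.
  move=> t' x' t'T; rewrite !lt_min => /and3P[a1 a2 a3] /and3P[b1 b2 b3].
  have Q' : Qbar (t', x') by split => //=; rewrite in_itv /= andbT; clra.
  have := h1 t' x' a1 b1 Q'.
  have := h2 t' x' a2 b2; rewrite ltr_norml => /andP[c1 c2].
  have := h3 t' a3; rewrite ltr_norml => /andP[c3 c4].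
  move: c1 c2 c3 c4; rewrite /G /e /G; clra.
have [tau htau] : {tau : R -> R & forall x, 0 <= tau x <= T1 /\
    forall t, 0 <= t <= T1 -> G t x <= G (tau x) x}.
  apply: (@boolp.choice _ _ (fun x t => 0 <= t <= T1 /\
    forall t', 0 <= t' <= T1 -> G t' x <= G t x)) => x.
  have [||t tT ht] := @usc_segment_max R (fun t => G t x) 0 T1; first clra.
    move=> t tT c /(Gusc _ _ _ tT)[e e0 he]; exists e => // t' t'T t't.
    by apply: he => //; rewrite subrr normr0.
  by exists t.
pose U x := G (tau x) x.
have Umax t x : 0 <= t <= T1 -> G t x <= U x by move=> tT; exact: (htau x).2.
have Uxb : U xb = G tb xb.
  apply/eqP; rewrite eq_le Umax ?andbT; last clra.
  apply: le_trans (strict _ (htau xb).1) _.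
  by rewrite gerBl mulr_ge0 ?sqr_ge0 // ltW.
exists U; split => //.
(* At x the bound G t x < c holds for every t; [cover_segment] keeps it for all t at once when x
   moves slightly. *)
- move=> x c Uc.
  have [t tT|e e0 he] := @cover_segment R 0 T1
      (fun i t => forall x', 0 <= t <= T1 -> `|x' - x| < i -> G t x' < c).
    have [|e e0 he] := Gusc t x c tT; first exact: le_lt_trans (Umax _ _ tT) Uc.
    exists e => // t' i t't /andP[i0 ie] x' t'T x'i.
    by apply: he => //; exact: lt_trans ie.
  exists (e / 2); first clra.
  move=> y yx; apply: (he (e / 2)) => //; first clra.
    exact: (htau y).1.
  exact: (htau y).1.
- by move=> x; exists (tau x) => //; exact: (htau x).1.
(* Times within h of tb are interior, and there the slope l + 2 k (t - tb) of the time quadratic is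
   at least l - s. *)
pose h := Num.min (Num.min tb (T1 - tb)) (s / (2 * k + 1)).
have k1 : 0 < 2 * k + 1 by clra.
have h0 : 0 < h by rewrite !lt_min tb0 subr_gt0 tbT /= divr_gt0.
have htb : h <= tb by rewrite !ge_min lexx.
have hT1 : h <= T1 - tb by rewrite !ge_min lexx orbT.
have hs : h * (2 * k + 1) <= s by rewrite -ler_pdivlMr // ge_min lexx orbT.
clearbody h.
(* At xb, times at distance h or more from tb give a value at least 2 d below U xb; one d is left
   for the passage to nearby x. *)
pose d := k0 * h ^+ 2 / 2.
have d0 : 0 < d by rewrite /d divr_gt0 // mulr_gt0 // exprn_gt0.
have [t tT|e e0 he] := @cover_segment R 0 T1 (fun i t => forall x, 0 <= t <= T1 ->
    `|x - xb| < i -> `|t - tb| < h \/ G t x < U xb - d).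
  have [lt|le] := ltP `|t - tb| h.
    exists (h - `|t - tb|); first by rewrite subr_gt0.
    move=> t' i t't _ x _ _; left.
    by have := ler_distD t t' tb; clra.
  have [|e e0 he] := Gusc t xb (U xb - d) tT.
    apply: le_lt_trans (strict _ tT) _; rewrite Uxb ltrD2l ltrN2.
    have : k0 * h ^+ 2 <= k0 * (t - tb) ^+ 2.
      rewrite ler_pM2l // -[X in _ <= X]real_normK ?num_real //.
      by rewrite lerXn2r // nnegrE ltW.
    rewrite /d; move: d0; rewrite /d; clra.
  exists e => // t' i t't /andP[i0 ie] x t'T x'i; right.
  by apply: he => //; exact: lt_trans ie.
exists (e / 2); first clra.
exists d => //.
have maximiser x : `|x - xb| < e / 2 -> U xb - d < U x ->
    exists2 t1, `|t1 - tb| < h & U x = G t1 x.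
  move=> xe Ux; exists (tau x) => //.
  have [|//|] := he (e / 2) _ (tau x) (htau x).1 x (htau x).1 xe; first clra.
  by rewrite -/(U x); clra.
have concl t1 : `|t1 - tb| < h -> forall p, l + 2 * k * (t1 - tb) + p <= 0 ->
    p <= - l + s.
  move=> t1h p.
  have : k * `|t1 - tb| <= k * h by rewrite ler_wpM2l // ltW.
  have : k * (tb - t1) <= k * `|t1 - tb|.
    by rewrite ler_wpM2l // distrC ler_norm.
  clra.
have test := @subsolution_test R HL HR F LL LR L0 K m r0 T u _ _ _ _ _ _ _
  HLlip HRlip F1 F2 m0 LLK LRK L0K sub.
(* U dominates every slice G t, so a test function above U at x1, together with the weight and the
   time quadratic, lies above u near (t1, x1). *)
have main x1 pL pR c t1 : U x1 = G t1 x1 -> `|t1 - tb| < h ->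
    (exists2 e, 0 < e & forall x, `|x - x1| < e -> U x <= U x1 +
       (pL * ((x - `|x|) / 2) + pR * ((x + `|x|) / 2)) -
       (pL * ((x1 - `|x1|) / 2) + pR * ((x1 + `|x1|) / 2)) + c * (x - x1) ^+ 2) ->
    [/\ x1 < 0 -> HL pL <= - l + s, 0 < x1 -> HR pR <= - l + s
      & x1 = 0 -> Num.min (Num.min (HL pL) (HR pR)) (F pL pR) <= - l + s].
  move=> Ux1 t1h [e1 e10 he1].
  have t1I : 0 < t1 < T1 by move: t1h; rewrite ltr_norml; clra.
  have [||h1 h2 h3] := test t1 x1 (l + 2 * k * (t1 - tb)) k c pL pR; first clra.
    exists (Num.min e1 (Num.min t1 (T1 - t1))); first by rewrite !lt_min e10; clra.
    move=> t x; rewrite !lt_min => /and3P[_ a1 a2] /and3P[xe _ _].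
    have tT : 0 <= t <= T1 by move: a1 a2; rewrite !ltr_norml; clra.
    have := Umax t x tT; have := he1 x xe; rewrite Ux1 /G; clra.
  by split=> [/h1|/h2|/h3]; exact: concl.
split.
  move=> x p c xe Ux [e1 e10 he1].
  have [t1 t1h Ut1] := maximiser x xe Ux.
  have [|h1 h2 _] := main x p p c t1 Ut1 t1h; last by [].
  exists e1 => // y ye; apply: le_trans (he1 y ye) _.
  by rewrite le_eqVlt; apply/orP; left; apply/eqP; field.
move=> pL pR xe U0 [e1 e10 he1].
have [||t1 t1h Ut1] := maximiser 0 => //.
  by rewrite sub0r normrN.
have [|_ _ ] := main 0 pL pR 0 t1 Ut1 t1h; last exact.
exists e1 => // y; rewrite subr0 => /he1 /le_trans; apply.
rewrite normr0 subrr addr0 !mul0r !mulr0 addr0 !addr0 subr0 lerD2l.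
case: (leP y 0) => y0.
  by rewrite ler0_norm // opprK; clra.
by rewrite gtr0_norm //; clra.
Qed.

Lemma stationary_sub_shrink HL HR F A U xb r d r' d' : r' <= r -> d' <= d ->
  stationary_sub HL HR F A U xb r d -> stationary_sub HL HR F A U xb r' d'.
Proof.
move=> rr dd [h1 h2]; split.
  move=> x p c xr Ux; apply: h1; first exact: lt_le_trans rr.
  by apply: le_lt_trans Ux; rewrite lerD2l lerN2.
move=> pL pR xr Ux; apply: h2; first exact: lt_le_trans rr.
by apply: le_lt_trans Ux; rewrite lerD2l lerN2.
Qed.

End Slices.

(** * Doubling of the time variable *)

Section Comparison.
Context {R : realType}.
Implicit Types (f g H U V W : R -> R) (F : R -> R -> R) (u v phi : R * R -> R).
Implicit Types (A B C K L M N T a b c d e k l m p q r rho s t x y z xb tb : R).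

Lemma usc_on_near D u X a : usc_on D u -> D X -> u X < a ->
  exists2 e, 0 < e & forall t x, `|t - X.1| < e -> `|x - X.2| < e ->
    D (t, x) -> u (t, x) < a.
Proof. by move=> usc DX uX; have /near2P := usc X DX a uX. Qed.

Lemma usc_on_box_bound u T r : usc_on Qbar u -> 0 <= T -> 0 <= r ->
  exists M, forall t x, 0 <= t <= T -> - r <= x <= r -> u (t, x) <= M.
Proof.
move=> usc T0 r0.
case: (@usc_compact_max R (R * R)%type ([set` `[0, T]] `*` [set` `[- r, r]]) u).
- exact: compact_setX (@segment_compact R 0 T) (@segment_compact R (- r) r).
- by exists (0, 0); split; rewrite /= in_itv /=; clra.
- move=> [t x] [/=]; rewrite !in_itv /= => tT xr c uc.
  have Q : Qbar (t, x) by split => //=; rewrite in_itv /= andbT; clra.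
  have [e e0 he] := usc_on_near usc Q uc.
  apply/near2P; exists e => // t' x' t't x'x [/=]; rewrite !in_itv /= => t'T _.
  by apply: he => //; split => //=; rewrite in_itv /= andbT; clra.
move=> [t x] _ h; exists (u (t, x)) => t' x' t'T x'r.
by apply: h; split; rewrite /= in_itv.
Qed.

Lemma lsc_onN D u : lsc_on D u -> usc_on D (\- u).
Proof.
move=> lsc X DX a; rewrite /= ltrNl => /(lsc X DX).
by apply: filterS => Y /=; rewrite ltrNl.
Qed.

Lemma doubling_usc u w k eta m K r0 t s x c : usc_on Qbar u -> usc_on Qbar w ->
  0 <= t -> 0 <= s ->
  u (t, x) + w (s, x) - (k * (t - s) ^+ 2 + eta * t + cone_weight m K r0 (t, x)) < c ->
  exists2 e, 0 < e & forall t' s' x', `|t' - t| < e -> `|s' - s| < e ->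
    `|x' - x| < e -> 0 <= t' -> 0 <= s' ->
    u (t', x') + w (s', x') -
      (k * (t' - s') ^+ 2 + eta * t' + cone_weight m K r0 (t', x')) < c.
Proof.
move=> uscu uscw t0 s0 Sc.
pose e := (c - (u (t, x) + w (s, x) -
  (k * (t - s) ^+ 2 + eta * t + cone_weight m K r0 (t, x)))) / 5.
have e0 : 0 < e by rewrite divr_gt0 // subr_gt0.
have Qt : Qbar (t, x) by split => //=; rewrite in_itv /= andbT.
have Qs : Qbar (s, x) by split => //=; rewrite in_itv /= andbT.
have ltDe a : a < a + e by rewrite ltrDl.
have [/= d1 d10 h1] := usc_on_near uscu Qt (ltDe _).
have [/= d2 d20 h2] := usc_on_near uscw Qs (ltDe _).
have [/= d3 d30 h3] := cone_weight_near m K r0 (t, x) e0.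
have [d4 d40 h4] := quad_near 0 k 0 (t - s) e0.
have [d5 d50 h5] := quad_near eta 0 0 t e0.
exists (Num.min (d4 / 2) (Num.min (Num.min d1 d2) (Num.min d3 d5))).
  by rewrite !lt_min d10 d20 d30 d50 divr_gt0.
move=> t' s' x' /=; rewrite !lt_min.
move=> /and3P[t4 /andP[t1 t2] /andP[t3 t5]].
move=> /and3P[s4 /andP[s1 s2] /andP[s3 s5]].
move=> /and3P[x4 /andP[x1 x2] /andP[x3 x5]] t'0 s'0.
have Qt' : Qbar (t', x') by split => //=; rewrite in_itv /= andbT.
have Qs' : Qbar (s', x') by split => //=; rewrite in_itv /= andbT.
have b1 := h1 t' x' t1 x1 Qt'.
have b2 := h2 s' x' s2 x2 Qs'.
have := h3 t' x' t3 x3; rewrite ltr_norml => /andP[b3 _].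
have := h5 t' t5; rewrite ltr_norml => /andP[b5 _].
have := h4 (t' - s').
have -> : t' - s' - (t - s) = (t' - t) + (s - s') by ring.
have ts : `|t' - t + (s - s')| < d4.
  have := ler_normD (t' - t) (s - s'); rewrite (distrC s s').
  by clear -t4 s4; lra.
move=> /(_ ts); rewrite ltr_norml => /andP[b4 _].
rewrite !subr0 !mul0r ?add0r ?addr0 in b3 b4 b5.
clear -b1 b2 b3 b4 b5; rewrite /e in b1 b2 b3 b4 b5; lra.
Qed.

(** Expansion of the penalty about (a, b). The linear part splits between t and s, and the remaining
    square of a difference lies between 0 and twice the sum of the squares, which decouples the two
    times. *)
Lemma doubling_square k a b s t : 0 <= k ->
  k * (a - b) ^+ 2 + 2 * k * (a - b) * ((t - a) - (s - b)) <=
  k * (t - s) ^+ 2 <=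
  k * (a - b) ^+ 2 + 2 * k * (a - b) * ((t - a) - (s - b))
    + 2 * k * (t - a) ^+ 2 + 2 * k * (s - b) ^+ 2.
Proof.
move=> k0.
have E : k * (t - s) ^+ 2 = k * (a - b) ^+ 2 + 2 * k * (a - b) * ((t - a) - (s - b))
  + k * ((t - a) - (s - b)) ^+ 2 by ring.
have h1 : 0 <= k * ((t - a) - (s - b)) ^+ 2 by rewrite mulr_ge0 ?sqr_ge0.
have h2 : 0 <= k * ((t - a) + (s - b)) ^+ 2 by rewrite mulr_ge0 ?sqr_ge0.
by rewrite E; apply/andP; split; lra.
Qed.

Lemma doubling_contradiction HL HR F LL LR L0 K m r0 eta k T1 T Rr tb sb xb u w :
  (forall p q, `|HL p - HL q| <= LL * `|p - q|) ->
  (forall p q, `|HR p - HR q| <= LR * `|p - q|) ->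
  (forall p p' q, `|F p q - F p' q| <= L0 * `|p - p'|) ->
  (forall p q q', `|F p q - F p q'| <= L0 * `|q - q'|) ->
  coercive HL -> coercive HR -> coercive (fun p => F p p) ->
  0 <= m -> LL <= K -> LR <= K -> L0 + L0 <= K ->
  subsolution HL HR F T u ->
  subsolution (dualH HL) (dualH HR) (dualF F) T w ->
  usc_on Qbar u -> usc_on Qbar w ->
  0 < eta -> 0 < k -> T1 <= T -> 0 < tb < T1 -> 0 < sb < T1 -> `|xb| < Rr ->
  (forall t s x, 0 <= t <= T1 -> 0 <= s <= T1 -> - Rr <= x <= Rr ->
     u (t, x) + w (s, x) - (k * (t - s) ^+ 2 + eta * t + cone_weight m K r0 (t, x))
     <= u (tb, xb) + w (sb, xb)
        - (k * (tb - sb) ^+ 2 + eta * tb + cone_weight m K r0 (tb, xb))) ->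
  False.
Proof.
move=> HLlip HRlip F1 F2 cL cR cF m0 LLK LRK L0K sub sup uscu uscw eta0 k0 T1T.
move=> tbT sbT xbR' Smax.
have tbT' : 0 <= tb <= T1 by case/andP: tbT => ? ?; rewrite !ltW.
have sbT' : 0 <= sb <= T1 by case/andP: sbT => ? ?; rewrite !ltW.
have xbR : - Rr <= xb <= Rr by rewrite -ler_norml ltW.
have sq t a : 0 <= k * (t - a) ^+ 2 by rewrite mulr_ge0 ?sqr_ge0 // ltW.
have [k30 e30] : 0 <= 3 * k /\ 0 < eta / 3 by split; lra.
(* This linear coefficient enters the two slices with opposite signs. Each slice gets the quadratic
   3 k: 2 k pays for decoupling the penalty and k makes the maximum in time strict at xb. Each slice
   gives up eta / 3, which leaves A and B apart by eta / 3. *)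
pose lam := 2 * k * (tb - sb).
pose r := Rr - `|xb|.
have rpos : 0 < r by rewrite /r subr_gt0.
have inR x : `|x - xb| < r -> - Rr <= x <= Rr.
  move=> h; rewrite -ler_norml; have := ler_distD xb x 0.
  by rewrite !subr0; move: h; rewrite /r; lra.
have [|U [Uxb Uusc Uatt [ru ru0 [du du0 Ustat]]]] :=
  @slice_stationary R HL HR F LL LR L0 K m r0 T T1 u tb xb (lam + eta)
    (3 * k) k (eta / 3) HLlip HRlip F1 F2 m0 LLK LRK L0K sub uscu tbT T1T k0 k30 e30.
  move=> t tT; have A := Smax t sb xb tT sbT' xbR.
  have /andP[_ B] := doubling_square tb sb sb t (ltW k0).
  have C := sq t tb.
  rewrite !subrr !mulr0 expr0n /= !mulr0.
  by clear -A B C; rewrite /lam; lra.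
have dlip H L : (forall p q, `|H p - H q| <= L * `|p - q|) ->
    forall p q, `|dualH H p - dualH H q| <= L * `|p - q|.
  move=> Hlip p q; rewrite /dualH opprK addrC (le_trans (Hlip _ _)) //.
  by rewrite opprK addrC.
(* With m = 0 the weight in this slice is the constant 1, since the localising term is carried by u
   alone. *)
have [|||W [Wxb Wusc Watt [rv rv0 [dv dv0 Wstat]]]] :=
  @slice_stationary R (dualH HL) (dualH HR) (dualF F) LL LR L0 K 0 0 T T1
    w sb xb (- lam) (3 * k) k (eta / 3) (dlip _ _ HLlip) (dlip _ _ HRlip) _ _
    (lexx _) LLK LRK L0K sup uscw sbT T1T k0 k30 e30.
- move=> p p' q; rewrite /dualF opprK addrC (le_trans (F1 _ _ _)) //.
  by rewrite opprK addrC.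
- move=> p p' q; rewrite /dualF opprK addrC (le_trans (F2 _ _ _)) //.
  by rewrite opprK addrC.
- move=> s sT; have A := Smax tb s xb tbT' sT xbR.
  have /andP[_ B] := doubling_square tb sb s tb (ltW k0).
  have C := sq s sb.
  rewrite /cone_weight /= !mul0r !subrr !mulr0 expr0n /= !mulr0.
  by clear -A B C; rewrite /lam; lra.
pose V z := - W z.
have WE : (fun z => - V z) = W by apply: boolp.funext => z; rewrite /V opprK.
pose rr := Num.min r (Num.min ru rv).
pose dd := Num.min du dv.
have rr0 : 0 < rr by rewrite !lt_min rpos ru0.
have dd0' : 0 < dd by rewrite lt_min du0.
have rrr : rr <= r by rewrite ge_min lexx.
have rru : rr <= ru by rewrite !ge_min lexx orbT.
have rrv : rr <= rv by rewrite !ge_min lexx !orbT.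
apply: (@stationary_comparison R HL HR F LL LR U V xb rr dd
  (- (lam + eta) + eta / 3) (- (lam + eta / 3)) HLlip HRlip cL cR cF _ rr0 dd0').
- by clear -eta0; lra.
- by move=> x _.
- by move=> x _; rewrite WE.
- by apply: stationary_sub_shrink Ustat => //; rewrite ge_min lexx.
- rewrite WE opprK; rewrite opprK in Wstat.
  by apply: stationary_sub_shrink Wstat => //; rewrite ge_min lexx orbT.
move=> x xr.
have xR : - Rr <= x <= Rr by apply: inR; exact: lt_le_trans rrr.
have [t tT Ut] := Uatt x; have [s sT Ws] := Watt x.
rewrite /V !opprK Uxb Wxb Ut Ws.
have A := Smax t s x tT sT xR.
have /andP[_ B] := doubling_square tb sb s t (ltW k0).
have C := sq t tb; have D := sq s sb.
rewrite /lam {2 4}/cone_weight /= !mul0r !subrr !mulr0 expr0n /= !mulr0.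
by clear -A B C D; lra.
Qed.

Lemma comparison HL HR F LL LR L0 u v :
  (forall p q, `|HL p - HL q| <= LL * `|p - q|) ->
  (forall p q, `|HR p - HR q| <= LR * `|p - q|) ->
  (forall p p' q, `|F p q - F p' q| <= L0 * `|p - p'|) ->
  (forall p q q', `|F p q - F p q'| <= L0 * `|q - q'|) ->
  coercive HL -> coercive HR -> coercive (fun p => F p p) ->
  (forall T, 0 < T -> subsolution HL HR F T u) ->
  (forall T, 0 < T -> supersolution HL HR F T v) ->
  usc_on Qbar u -> lsc_on Qbar v -> (forall x, u (0, x) <= v (0, x)) ->
  forall X, Qbar X -> u X <= v X.
Proof.
move=> HLlip HRlip F1 F2 cL cR cF sub sup uscu lscv init [T0 X0] [/= + _].
rewrite in_itv /= andbT => T00.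
rewrite leNgt; apply/negP => vu.
pose sg := u (T0, X0) - v (T0, X0).
have sg0 : 0 < sg by rewrite subr_gt0.
pose v' : R * R -> R := \- v.
have uscv : usc_on Qbar v' by exact: lsc_onN.
have v'E X : v' X = - v X by [].
pose K := `|LL| + `|LR| + (`|L0| + `|L0|) + 1.
have [K0 LLK LRK L0K] : [/\ 0 < K, LL <= K, LR <= K & L0 + L0 <= K].
  have := normr_ge0 LL; have := normr_ge0 LR; have := normr_ge0 L0.
  have := ler_norm LL; have := ler_norm LR; have := ler_norm L0.
  by rewrite /K; split; clra.
clearbody K.
(* At (T0, X0) one has |x| + K t = rs. The weight turns from small to large around r0 = rs + 1, and
   T1 is the time at which the cone of size Rr = rs + 2 closes. *)
pose rs := `|X0| + K * T0.
have rs0 : 0 <= rs by rewrite addr_ge0 // mulr_ge0 // ltW.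
pose Rr := rs + 2.
have Rr2 : 2 <= Rr by rewrite /Rr; clra.
pose T1 := Rr / K.
have T10 : 0 < T1 by rewrite divr_gt0 //; clra.
have T1K : K * T1 = Rr by rewrite /T1 mulrC divfK // gt_eqF.
have [Mu hMu] := @usc_on_box_bound u T1 Rr uscu (ltW T10) ltac:(clra).
have [Mv hMv] := @usc_on_box_bound v' T1 Rr uscv (ltW T10) ltac:(clra).
pose M := `|Mu| + `|Mv|.
have M0 : 0 <= M by rewrite addr_ge0.
have hM t s x : 0 <= t <= T1 -> 0 <= s <= T1 -> - Rr <= x <= Rr ->
    u (t, x) + v' (s, x) <= M.
  move=> tT sT xR; rewrite /M; apply: lerD.
    exact: le_trans (hMu _ _ tT xR) (ler_norm _).
  exact: le_trans (hMv _ _ sT xR) (ler_norm _).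
(* By exp y >= 1 + y, the weight exp(-m) at (T0, X0) is at most sg / 4, and the weight exceeds the
   bound M of u - v as soon as |x| + K t >= Rr - 1/2. *)
pose m := 4 / sg + 4 * M.
have m40 : 0 < 4 / sg by rewrite divr_gt0.
have m0 : 0 < m by rewrite /m; clra.
pose r0 := rs + 1.
have cwS : cone_weight m K r0 (T0, X0) <= sg / 4.
  rewrite /cone_weight /= /r0 /rs.
  have -> : m * (`|X0| + K * T0 - (`|X0| + K * T0 + 1)) = - m by ring.
  rewrite expRN -[X in _ <= X]invrK lef_pV2 ?posrE ?expR_gt0 //; last first.
    by rewrite invr_gt0; clra.
  rewrite invf_div; apply: le_trans (expR_ge1Dx m); rewrite /m; clra.
have cwB t x : Rr - 2^-1 <= `|x| + K * t -> M < cone_weight m K r0 (t, x).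
  move=> h; rewrite /cone_weight /=.
  apply: lt_le_trans (expR_ge1Dx _).
  have : m * 2^-1 <= m * (`|x| + K * t - r0).
    by rewrite ler_pM2l // /r0; move: h; rewrite /Rr; clra.
  rewrite {1}/m; clra.
have cw0 t x : 0 < cone_weight m K r0 (t, x) by exact: expR_gt0.
pose eta := sg / 4 / (T0 + 1).
have eta0 : 0 < eta by rewrite !divr_gt0 //; clra.
have etaT : eta * T0 <= sg / 4.
  have : eta * (T0 + 1) = sg / 4 by rewrite /eta divfK // gt_eqF; clra.
  clra.
have [tau tau0 htau] : exists2 tau, 0 < tau & forall t s x, 0 <= t < tau ->
    0 <= s < tau -> - Rr <= x <= Rr -> u (t, x) + v' (s, x) < sg / 2.
  have [x xR|e e0 he] := @cover_segment R (- Rr) Rr (fun i x => forall t s,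
      0 <= t < i -> 0 <= s < i -> u (t, x) + v' (s, x) < sg / 2).
    have Q0 : Qbar (0, x) by split => //=; rewrite in_itv /= lexx.
    have [|/= d1 d10 h1] := usc_on_near uscu Q0 (a := u (0, x) + sg / 4); first clra.
    have [|/= d2 d20 h2] := usc_on_near uscv Q0 (a := v' (0, x) + sg / 4); first clra.
    exists (Num.min d1 d2); first by rewrite lt_min d10.
    move=> y i; rewrite !lt_min => /andP[y1 y2] /and3P[i0 i1 i2] t s.
    move=> /andP[t0 ti] /andP[s0 si].
    have := h1 t y; rewrite subr0 ger0_norm // => /(_ (lt_trans ti i1) y1).
    have := h2 s y; rewrite subr0 ger0_norm // => /(_ (lt_trans si i2) y2).
    move=> a1 a2.
    have {}a1 : v' (s, y) < v' (0, x) + sg / 4.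
      by apply: a1; split => //=; rewrite in_itv /= andbT.
    have {}a2 : u (t, y) < u (0, x) + sg / 4.
      by apply: a2; split => //=; rewrite in_itv /= andbT.
    have := init x; rewrite (v'E (0, x)) in a1; clra.
  exists (e / 2); first clra.
  by move=> t s x ht hs xR; apply: (he (e / 2)) => //; clra.
(* d will bound the gap between the two times at the maximum. With d <= tau / 2, a vanishing time
   would bring both below tau, where u - v < sg / 2; with K d <= 1/4, the time s stays before T1
   like t. *)
pose d := Num.min (tau / 2) (1 / 4 / K).
have d0 : 0 < d by rewrite lt_min !divr_gt0.
have dtau : d <= tau / 2 by rewrite ge_min lexx.
have dK : K * d <= 1 / 4 by rewrite mulrC -ler_pdivlMr // ge_min lexx orbT.
clearbody d.
(* A time gap of d then costs M + 1, more than u - v can offer. *)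
pose k := (M + 1) / d ^+ 2.
have dd0 : 0 < d ^+ 2 by rewrite exprn_gt0.
have k0 : 0 < k by rewrite divr_gt0 //; clra.
have kd : k * d ^+ 2 = M + 1 by rewrite /k divfK // gt_eqF.
clearbody k.
pose S (X : R * R * R) := u (X.1.1, X.2) + v' (X.1.2, X.2) -
  (k * (X.1.1 - X.1.2) ^+ 2 + eta * X.1.1 + cone_weight m K r0 (X.1.1, X.2)).
case: (@usc_compact_max R (R * R * R)%type
  (([set` `[0, T1]] `*` [set` `[0, T1]]) `*` [set` `[- Rr, Rr]]) S).
- exact: compact_setX (compact_setX (@segment_compact R 0 T1)
    (@segment_compact R 0 T1)) (@segment_compact R (- Rr) Rr).
- by exists (0, 0, 0); do ![split]; rewrite /= in_itv /=; clra.
- move=> [[t s] x] [[/=]]; rewrite !in_itv /= => tT sT xR c Sc.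
  have [e e0 he] := doubling_usc uscu uscv (proj1 (andP tT)) (proj1 (andP sT)) Sc.
  apply: near3P; exists e => // t' s' x' t't s's x'x [[/=]]; rewrite !in_itv /=.
  by move=> /andP[t'0 _] /andP[s'0 _] _; exact: he.
move=> [[tb sb] xb] [[/=]]; rewrite !in_itv /= => tbT sbT xbR Smax.
have {}Smax t s x : 0 <= t <= T1 -> 0 <= s <= T1 -> - Rr <= x <= Rr ->
    S (t, s, x) <= S (tb, sb, xb).
  by move=> tT sT xR; apply: Smax; do ![split]; rewrite /= in_itv.
(* At (T0, T0, X0) the penalty vanishes, and the weight and eta T0 each take at most a quarter of
   sg. *)
have Sbig : sg / 2 <= S (tb, sb, xb).
  have T0T1 : 0 <= T0 <= T1.
    rewrite T00 /= -(ler_pM2l K0) T1K /Rr /rs.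
    by have := normr_ge0 X0; clra.
  have X0R : - Rr <= X0 <= Rr.
    rewrite -ler_norml /Rr /rs; have := normr_ge0 X0.
    have : 0 <= K * T0 by rewrite mulr_ge0 // ltW.
    clra.
  apply: le_trans (Smax T0 T0 X0 T0T1 T0T1 X0R).
  rewrite /S /= subrr expr0n /= mulr0 add0r v'E.
  move: etaT cwS; rewrite /sg; clra.
have ksq : 0 <= k * (tb - sb) ^+ 2 by rewrite mulr_ge0 ?sqr_ge0 // ltW.
have etb : 0 <= eta * tb by rewrite mulr_ge0 //; clra.
have cwb := cw0 tb xb.
have uvb := hM tb sb xb tbT sbT xbR.
have SE : S (tb, sb, xb) = u (tb, xb) + v' (sb, xb) -
  (k * (tb - sb) ^+ 2 + eta * tb + cone_weight m K r0 (tb, xb)) by [].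
have tsd : `|tb - sb| < d.
  rewrite ltNge; apply/negP => le.
  have h : k * d ^+ 2 <= k * (tb - sb) ^+ 2.
    rewrite ler_pM2l // -[X in _ <= X]real_normK ?num_real //.
    by rewrite lerXn2r // nnegrE ltW.
  rewrite kd in h; rewrite SE in Sbig; clear -h Sbig sg0 etb cwb uvb; lra.
have cone : `|xb| + K * tb < Rr - 2^-1.
  rewrite ltNge; apply/negP => /cwB h; rewrite SE in Sbig.
  by clear -h Sbig sg0 ksq etb uvb; lra.
have late : ~ (tb < tau /\ sb < tau).
  move=> [h1 h2]; have /andP[tb_0 _] := tbT; have /andP[sb_0 _] := sbT.
  have := htau tb sb xb; rewrite tb_0 h1 sb_0 h2 => /(_ isT isT xbR) h.
  by rewrite SE in Sbig; clear -h Sbig ksq etb cwb; lra.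
have /andP[dlo dhi] : - d < tb - sb < d by rewrite -ltr_norml.
have tb0 : 0 < tb.
  rewrite ltNge; apply/negP => h; apply: late.
  by clear -h dlo dtau tau0; split; lra.
have sb0 : 0 < sb.
  rewrite ltNge; apply/negP => h; apply: late.
  by clear -h dhi dtau tau0; split; lra.
have Kts : K * sb <= K * tb + K * d.
  by rewrite -mulrDr ler_pM2l //; clear -dlo; lra.
have nx0 := normr_ge0 xb.
have tbT1 : tb < T1 by rewrite -(ltr_pM2l K0) T1K; clear -cone nx0; lra.
have sbT1 : sb < T1.
  by rewrite -(ltr_pM2l K0) T1K; clear -cone nx0 Kts dK; lra.
have Ktb : 0 < K * tb by rewrite mulr_gt0.
have xbR' : `|xb| < Rr by clear -cone Ktb; lra.
apply: (@doubling_contradiction HL HR F LL LR L0 K m r0 eta k T1 (T1 + 1) Rr tb sb xb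
  u v' HLlip HRlip F1 F2 cL cR cF (ltW m0) LLK LRK L0K
  (sub _ (ltr_wpDl (ltW T10) ltr01))
  (supersolution_dual (sup _ (ltr_wpDl (ltW T10) ltr01))) uscu uscv).
- exact: eta0.
- exact: k0.
- by rewrite lerDl.
- by rewrite tb0.
- by rewrite sb0.
- exact: xbR'.
- by move=> t s x tT sT xR; exact: Smax.
Qed.

End Comparison.

(** * Godunov flux and discrete estimates *)

Section Scheme.
Context {R : realType}.
Implicit Types (H : R -> R) (F f : R -> R -> R).
Implicit Types (A B C K L M N T a b c d e k l m p q r rho s t x y z dt dx : R).

Definition monotone_flux L f := forall a a' b b', a <= a' -> b' <= b ->
  f a b <= f a' b' <= f a b + L * (a' - a) + L * (b - b').

Definition coercive_flux f := forall A, exists B, forall a b,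
  f a b <= A -> a <= B /\ - B <= b.

Lemma lip_segment_max H L a b : (forall p q, `|H p - H q| <= L * `|p - q|) ->
  a <= b -> exists2 m, a <= m <= b & forall y, a <= y <= b -> H y <= H m.
Proof.
move=> Hlip ab; apply: usc_at_segment_max => // x _ c Hc.
have c0 y : `|0 - 0 : R| <= 0 * `|y - x| by rewrite subrr normr0 mul0r.
have L1 : 0 < `|L| + 1 by rewrite ltr_wpDl.
exists ((c - H x) / (`|L| + 1)); first by rewrite divr_gt0 // subr_gt0.
move=> y; rewrite ltr_pdivlMr // => h.
have h1 := le_trans (ler_norm _) (Hlip y x).
have h2 : L * `|y - x| <= `|L| * `|y - x| by rewrite ler_wpM2r // ler_norm.
have := normr_ge0 (y - x); clra.
Qed.

Lemma lip_segment_min H L a b : (forall p q, `|H p - H q| <= L * `|p - q|) ->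
  a <= b -> exists2 m, a <= m <= b & forall y, a <= y <= b -> H m <= H y.
Proof.
move=> Hlip ab.
have [|m mab hm] := @lip_segment_max (fun p => - H p) L a b _ ab.
  by move=> p q; rewrite opprK addrC distrC.
by exists m => // y /hm; rewrite lerN2.
Qed.

Lemma godunov_min H L a b : (forall p q, `|H p - H q| <= L * `|p - q|) ->
  a <= b -> exists2 m, a <= m <= b & godunov H a b = H m /\
    forall q, a <= q <= b -> godunov H a b <= H q.
Proof.
move=> Hlip ab; have [m mab hm] := lip_segment_min Hlip ab.
have lb : lbound (H @` `[a, b]) (H m).
  by move=> _ [q /= + <-]; rewrite in_itv /=; exact: hm.
have Hm : (H @` `[a, b]) (H m) by exists m => //=; rewrite in_itv.
have E : godunov H a b = H m.
  rewrite /godunov ab; apply/eqP; rewrite eq_le; apply/andP; split.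
    by apply: ge_inf => //; exists (H m).
  by apply: lb_le_inf => //; exists (H m).
by exists m => //; rewrite E.
Qed.

Lemma godunov_max H L a b : (forall p q, `|H p - H q| <= L * `|p - q|) ->
  b <= a -> exists2 m, b <= m <= a & godunov H a b = H m /\
    forall q, b <= q <= a -> H q <= godunov H a b.
Proof.
(* On the diagonal the definition takes the infimum, which over a single point is also the
   supremum. *)
move=> Hlip ba; rewrite /godunov; case: ifPn => [ab|_].
  have E : a = b by apply/eqP; rewrite eq_le ab ba.
  subst b; have [m mab [Em hm]] := godunov_min Hlip ab.
  rewrite /godunov lexx in Em hm.
  have ma : m = a by apply/eqP; rewrite eq_le andbC.
  exists m => //; split=> // q qa.
  have -> : q = a by apply/eqP; rewrite eq_le andbC.
  by rewrite Em ma.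
have [m mab hm] := lip_segment_max Hlip ba.
have ub : ubound (H @` `[b, a]) (H m).
  by move=> _ [q /= + <-]; rewrite in_itv /=; exact: hm.
have Hm : (H @` `[b, a]) (H m) by exists m => //=; rewrite in_itv.
have E : sup (H @` `[b, a]) = H m.
  apply/eqP; rewrite eq_le; apply/andP; split.
    by apply: ge_sup => //; exists (H m).
  by apply: ub_le_sup => //; exists (H m).
by exists m => //; rewrite E.
Qed.

Lemma godunov_diag H L p : (forall p q, `|H p - H q| <= L * `|p - q|) ->
  godunov H p p = H p.
Proof.
move=> Hlip; have [m mp [-> _]] := godunov_min Hlip (lexx p).
by congr H; apply/eqP; rewrite eq_le andbC.
Qed.

(** Reversing the sign of H and exchanging the arguments turns minima into maxima; the behaviour in
    the second argument then follows from that in the first. *)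
Lemma godunovN H L a b : (forall p q, `|H p - H q| <= L * `|p - q|) ->
  godunov (fun p => - H p) b a = - godunov H a b.
Proof.
move=> Hlip.
have NHlip p q : `|- H p - - H q| <= L * `|p - q| by rewrite opprK addrC distrC.
have [ab|ba] := leP a b.
  have [m mab [Em hm]] := godunov_min Hlip ab.
  have [n nab [En hn]] := godunov_max NHlip ab.
  apply/eqP; rewrite eq_le Em hn // En lerN2 andbT.
  by rewrite -Em; exact: hm.
have [m mab [Em hm]] := godunov_max Hlip (ltW ba).
have [n nab [En hn]] := godunov_min NHlip (ltW ba).
apply/eqP; rewrite eq_le Em hn // En lerN2 /=.
by rewrite -Em; exact: hm.
Qed.

(** Moving a to a' alters the segment only between a and a', where H varies by at most L (a' - a).
    When a' passes b, the value H b separates the old minimum from the new maximum. *)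
Lemma godunov_left H L a a' b : (forall p q, `|H p - H q| <= L * `|p - q|) ->
  a <= a' -> godunov H a b <= godunov H a' b <= godunov H a b + L * (a' - a).
Proof.
move=> Hlip aa'.
have L0 : 0 <= L.
  by have := Hlip 1 0; rewrite subr0 normr1 mulr1; exact: le_trans.
have up p q : q <= p -> a <= q -> p <= a' -> H p <= H q + L * (a' - a).
  move=> qp aq pa'; have := le_trans (ler_norm _) (Hlip p q).
  rewrite ger0_norm ?subr_ge0 //.
  have : L * (p - q) <= L * (a' - a) by rewrite ler_wpM2l //; clra.
  clra.
have e0 : 0 <= L * (a' - a) by rewrite mulr_ge0 // subr_ge0.
have [a'b|ba'] := leP a' b.
  have [m mab [Em hm]] := godunov_min Hlip (le_trans aa' a'b).
  have [n nab [En hn]] := godunov_min Hlip a'b.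
  apply/andP; split; first by rewrite En; apply: hm; clra.
  have [ma'|a'm] := leP a' m.
    by have := hn m; rewrite -Em => /(_ ltac:(clra)); clra.
  apply: le_trans (hn a' _) _; first by rewrite lexx.
  by rewrite Em; apply: up => //; clra.
have [n nab [En hn]] := godunov_max Hlip (ltW ba').
have [ab|ba] := leP a b.
  have [m mab [Em hm]] := godunov_min Hlip ab.
  apply/andP; split.
    by apply: (@le_trans _ _ (H b)); [apply: hm|apply: hn]; clra.
  by rewrite En Em; apply: up; clra.
have [m mab [Em hm]] := godunov_max Hlip (ltW ba).
apply/andP; split; first by rewrite Em; apply: hn; clra.
have [na|an] := leP n a.
  by rewrite En; have := hm n ltac:(clra); clra.
apply: (@le_trans _ _ (H a + L * (a' - a))).
  by rewrite En; apply: up; clra.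
by rewrite lerD2r; apply: hm; clra.
Qed.

Lemma godunov_flux H L M : (forall p q, `|H p - H q| <= L * `|p - q|) -> L <= M ->
  monotone_flux M (godunov H).
Proof.
move=> Hlip LM a a' b b' aa' b'b.
have NHlip p q : `|- H p - - H q| <= L * `|p - q| by rewrite opprK addrC distrC.
have /andP[h1 h2] := godunov_left b Hlip aa'.
have := godunov_left a' NHlip b'b.
rewrite !(godunovN _ _ Hlip) => /andP[h3 h4].
have : L * (a' - a) <= M * (a' - a) by rewrite ler_wpM2r // subr_ge0.
have : L * (b - b') <= M * (b - b') by rewrite ler_wpM2r // subr_ge0.
by move=> h5 h6; apply/andP; split; clra.
Qed.

Lemma godunov_coercive H L : (forall p q, `|H p - H q| <= L * `|p - q|) ->
  coercive H -> coercive_flux (godunov H).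
Proof.
move=> Hlip Hco A; have [B hB] := Hco (A + 1).
have hB' p : p <= - B -> A + 1 <= H p.
  by move=> pB; apply: hB; have := ler_norm (- p); rewrite normrN; clra.
have hB2 p : B <= p -> A + 1 <= H p.
  by move=> pB; apply: hB; have := ler_norm p; clra.
exists B => a b; have [ab|ba] := leP a b.
  have [m mab [Em hm]] := godunov_min Hlip ab; rewrite Em => HA.
  split; rewrite leNgt; apply/negP => h.
    have := hB2 m ltac:(clra); clra.
  have := hB' m ltac:(clra); clra.
have [m mab [Em hm]] := godunov_max Hlip (ltW ba) => HA.
split; rewrite leNgt; apply/negP => h.
  have := hm a ltac:(clra); have := hB2 a ltac:(clra); clra.
have := hm b ltac:(clra); have := hB' b ltac:(clra); clra.
Qed.

(** Raising the data lifts the first slope and lowers the second by at most e = (v0 - u0) / dx each.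
    The flux term thus grows by at most 2 L dt e, and the CFL condition, factor 2 included, bounds
    this by v0 - u0. *)
Lemma flux_step_le L f dt dx um u0 up vm v0 vp : monotone_flux L f -> 0 <= L ->
  0 < dt -> 0 < dx -> 2 * L * dt <= dx -> um <= vm -> u0 <= v0 -> up <= vp ->
  u0 - dt * f ((u0 - um) / dx) ((up - u0) / dx) <=
  v0 - dt * f ((v0 - vm) / dx) ((vp - v0) / dx).
Proof.
move=> mf L0 dt0 dx0 cfl hm h0 hp.
pose e := (v0 - u0) / dx.
have e0 : 0 <= e by rewrite divr_ge0 ?subr_ge0 // ltW.
pose a := (u0 - um) / dx; pose b := (up - u0) / dx.
have ae : (v0 - vm) / dx <= a + e.
  by rewrite /a /e -mulrDl ler_pM2r ?invr_gt0 //; clra.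
have be : b - e <= (vp - v0) / dx.
  by rewrite /b /e -mulrBl ler_pM2r ?invr_gt0 //; clra.
have /andP[h1 _] := mf _ _ _ _ ae be.
have /andP[_ h2] := mf a (a + e) b (b - e) ltac:(clra) ltac:(clra).
have : dt * f ((v0 - vm) / dx) ((vp - v0) / dx) <= dt * (f a b + 2 * L * e).
  by rewrite ler_pM2l //; clra.
have : 2 * L * dt * e <= dx * e by rewrite ler_wpM2r.
have -> : dx * e = v0 - u0 by rewrite /e mulrC divfK // gt_eqF.
rewrite -/a -/b; clra.
Qed.

Lemma int_lipschitz (V : int -> R) c : (forall j, `|V (j + 1) - V j| <= c) ->
  forall i j, `|V i - V j| <= c * `|i%:~R - j%:~R|.
Proof.
move=> h.
have aux (i : int) (n : nat) : `|V (i + n%:Z) - V i| <= c * n%:R.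
  elim: n => [|n IHn]; first by rewrite addr0 subrr normr0 mulr0.
  have -> : i + n.+1%:Z = (i + n%:Z) + 1 by rewrite -addrA -PoszD addn1.
  have := ler_distD (V (i + n%:Z)) (V (i + n%:Z + 1)) (V i).
  have := h (i + n%:Z); rewrite -natr1; clra.
move=> i j; wlog ij : i j / j <= i => [hw|].
  have [|/ltW] := leP j i; first exact: hw.
  by rewrite (distrC (V i)) (distrC (i%:~R)); exact: hw.
have [n nE] : exists n : nat, i = j + n%:Z.
  by exists `|i - j|%N; rewrite gez0_abs ?subr_ge0 // [j + _]addrC subrK.
rewrite nE; apply: le_trans (aux _ _) _.
by rewrite intrD addrAC subrr add0r -pmulrn ger0_norm.
Qed.

Lemma nat_lipschitz (V : nat -> R) c : (forall n, `|V n.+1 - V n| <= c) ->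
  forall n m : nat, `|V n - V m| <= c * `|n%:R - m%:R|.
Proof.
move=> h.
have aux (i n : nat) : `|V (i + n)%N - V i| <= c * n%:R.
  elim: n => [|n IHn]; first by rewrite addn0 subrr normr0 mulr0.
  rewrite addnS.
  have := ler_distD (V (i + n)%N) (V (i + n).+1) (V i).
  have := h (i + n)%N; rewrite -natr1; clra.
move=> i j; wlog ij : i j / (j <= i)%N => [hw|].
  have [|/ltnW] := leqP j i; first exact: hw.
  by rewrite (distrC (V i)) (distrC (i%:R)); exact: hw.
have -> : i = (j + (i - j))%N by rewrite subnKC.
apply: le_trans (aux _ _) _.
by rewrite natrD addrAC subrr add0r ger0_norm.
Qed.

(** [Num.truncn] is 0 on negative numbers. Writing [Num.max a 0] lets the estimates hold on the
    whole plane, negative times included, where [u_Delta] repeats its initial row. *)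
Lemma truncn_bounds a : Num.max a 0 - 1 <= (Num.truncn a)%:R <= Num.max a 0.
Proof.
have [a0|a0] := leP 0 a.
  have /andP[h1 h2] := truncn_itv a0; rewrite -natr1 in h2.
  by rewrite h1 andbT; clra.
have -> : Num.truncn a = 0%N by apply/truncn0Pn; rewrite -ltNge; clra.
clra.
Qed.

Lemma truncn_dist a b :
  `|(Num.truncn a)%:R - (Num.truncn b)%:R : R| <= `|a - b| + 1.
Proof.
have := truncn_bounds a; have := truncn_bounds b.
set na := (Num.truncn a)%:R; set nb := (Num.truncn b)%:R.
have h1 := ler_norm (a - b); have h2 := ler_norm (b - a).
rewrite (distrC b a) in h2.
move=> /andP[b1 b2] /andP[a1 a2]; rewrite ler_norml.
move: a1 a2 b1 b2; case: (leP a 0) => ?; case: (leP b 0) => ?; clra.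
Qed.

Lemma floor_dist a b :
  `|(Num.floor a)%:~R - (Num.floor b)%:~R : R| <= `|a - b| + 1.
Proof.
have := floor_itv a; have := floor_itv b; rewrite !intrD => /andP[b1 b2] /andP[a1 a2].
have h1 := ler_norm (a - b); have h2 := ler_norm (b - a).
rewrite (distrC b a) in h2; rewrite ler_norml; clra.
Qed.

Lemma flux_cases (P : (R -> R -> R) -> Prop) HL HR F j :
  P (godunov HL) -> P (godunov HR) -> P F -> P (flux HL HR F j).
Proof. by rewrite /flux; case: ifP => // _; case: ifP. Qed.

Lemma slope_le dx (V : int -> R) c j : 0 < dx -> 0 <= c ->
  `|slope dx V j| <= c -> `|V (j + 1) - V j| <= c * dx.
Proof.
move=> dx0 c0; rewrite /slope normrM normfV (gtr0_norm dx0).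
by rewrite ler_pdivrMr.
Qed.

(** * Uniform estimates for the scheme *)

Section Estimates.
Variables (HL HR : R -> R) (F : R -> R -> R) (u0 : R -> R).
Variables (L kappa : R).
Hypotheses (L_gt0 : 0 < L).
Hypotheses (flux_mono : forall j, monotone_flux L (flux HL HR F j))
  (flux_coer : forall j, coercive_flux (flux HL HR F j)).
Hypotheses (kappa_ge0 : 0 <= kappa)
  (u0_lip : forall x y, `|u0 x - u0 y| <= kappa * `|x - y|).

Definition adm dt dx := [/\ 0 < dt, 0 < dx & 2 * L * dt <= dx].

Let U dt dx n := scheme HL HR F u0 dt dx n.

Lemma schemeS dt dx n j : U dt dx n.+1 j = U dt dx n j -
  dt * flux HL HR F j ((U dt dx n j - U dt dx n (j - 1)) / dx)
                      ((U dt dx n (j + 1) - U dt dx n j) / dx).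
Proof. by rewrite /U /= /slope subrK. Qed.

Lemma scheme_init_slope dt dx j : 0 < dx ->
  `|(U dt dx 0 (j + 1) - U dt dx 0 j) / dx| <= kappa.
Proof.
move=> dx0; rewrite normrM normfV (gtr0_norm dx0) ler_pdivrMr //.
apply: le_trans (u0_lip _ _) _.
by rewrite intrD mulrDl addrAC subrr add0r mul1r gtr0_norm.
Qed.

(** Uniformity in j holds because only three fluxes occur; each varies by at most 4 L kappa while
    both slopes range over [-kappa, kappa]. *)
Lemma flux_bound : exists2 C : R, 0 <= C & forall j a b, `|a| <= kappa -> `|b| <= kappa ->
  `|flux HL HR F j a b| <= C.
Proof.
have aux f : monotone_flux L f -> forall a b, `|a| <= kappa -> `|b| <= kappa ->
    `|f a b| <= `|f 0 0| + 4 * L * kappa.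
  move=> mf a b; rewrite !ler_norml => /andP[a1 a2] /andP[b1 b2].
  have /andP[h1 h2] := mf (- kappa) a kappa b a1 b2.
  have /andP[h3 h4] := mf (- kappa) 0 kappa 0 ltac:(clra) kappa_ge0.
  have := ler_norm (f 0 0); have := ler_norm (- f 0 0); rewrite normrN.
  have : L * (a - - kappa) <= L * (2 * kappa) by rewrite ler_pM2l //; clra.
  have : L * (kappa - b) <= L * (2 * kappa) by rewrite ler_pM2l //; clra.
  move=> *; apply/andP; split; clra.
have h0 := @flux_mono 0; have h1 := @flux_mono 1; have hm := @flux_mono (-1).
pose c (f : R -> R -> R) := `|f 0 0|.
exists (c (flux HL HR F 0) + c (flux HL HR F 1) + c (flux HL HR F (-1)) + 4 * L * kappa).
  by rewrite /c !addr_ge0 // !mulr_ge0 // ltW.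
have n0 : 0 <= c (flux HL HR F 0) by exact: normr_ge0.
have n1 : 0 <= c (flux HL HR F 1) by exact: normr_ge0.
have nm : 0 <= c (flux HL HR F (-1)) by exact: normr_ge0.
move=> j a b ha hb.
have := aux _ h0 a b ha hb; have := aux _ h1 a b ha hb; have := aux _ hm a b ha hb.
rewrite -/(c _) -/(c _) -/(c _).
move: n0 n1 nm; rewrite {2 4 6 8}/flux /=.
rewrite /flux; case: (ltgtP j 0) => //= _; clra.
Qed.

Lemma scheme_time : exists2 C : R, 0 <= C & forall dt dx, adm dt dx ->
  forall n j, `|U dt dx n.+1 j - U dt dx n j| <= C * dt.
Proof.
have [C C0 hC] := flux_bound; exists C => // dt dx [dt0 dx0 cfl].
elim=> [|n IHn] j.
  rewrite schemeS addrAC subrr add0r normrN normrM (gtr0_norm dt0) mulrC.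
  rewrite ler_pM2r //; apply: hC; last exact: scheme_init_slope.
  by have := @scheme_init_slope dt dx (j - 1) dx0; rewrite subrK.
have hle i : U dt dx n.+1 i <= U dt dx n i + C * dt.
  by have := IHn i; rewrite ler_norml; clra.
have hge i : U dt dx n i - C * dt <= U dt dx n.+1 i.
  by have := IHn i; rewrite ler_norml; clra.
have tr (e x y z : R) : (x + e - (y + e)) / z = (x - y) / z by congr (_ / _); ring.
have h1 := flux_step_le (@flux_mono j) (ltW L_gt0) dt0 dx0 cfl
  (hle (j - 1)) (hle j) (hle (j + 1)).
have h2 := flux_step_le (@flux_mono j) (ltW L_gt0) dt0 dx0 cfl
  (hge (j - 1)) (hge j) (hge (j + 1)).
rewrite !tr -schemeS in h1 h2.
rewrite (schemeS _ _ n j) in h1 h2 *; rewrite ler_norml; clra.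
Qed.

(* A bounded numerical flux bounds its first slope from above and its second
   slope from below, and every slope occurs in both positions. *)
Lemma scheme_space : exists2 M : R, 0 <= M & forall dt dx, adm dt dx ->
  forall n j, `|slope dx (U dt dx n) j| <= M.
Proof.
have [C C0 hC] := scheme_time.
have [B0 h0] := @flux_coer 0 C; have [B1 h1] := @flux_coer 1 C.
have [Bm hm] := @flux_coer (-1) C.
pose M := `|B0| + `|B1| + `|Bm|.
have M0 : 0 <= M by rewrite !addr_ge0.
have n0 := normr_ge0 B0; have n1 := normr_ge0 B1; have nm := normr_ge0 Bm.
have l0 := ler_norm B0; have l1 := ler_norm B1; have lm := ler_norm Bm.
have hM j a b : flux HL HR F j a b <= C -> a <= M /\ - M <= b.
  rewrite /M; move: h0 h1 hm; rewrite /flux /=.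
  move=> h0 h1 hm; case: (ltgtP j 0) => _ /=.
  - by move/hm => [? ?]; split; clra.
  - by move/h1 => [? ?]; split; clra.
  - by move/h0 => [? ?]; split; clra.
exists M => // dt dx a n j; have [dt0 dx0 _] := a.
have key i : flux HL HR F i ((U dt dx n i - U dt dx n (i - 1)) / dx)
                      ((U dt dx n (i + 1) - U dt dx n i) / dx) <= C.
  have := hC dt dx a n i; rewrite schemeS addrAC subrr add0r normrN normrM.
  rewrite (gtr0_norm dt0) mulrC ler_pM2r //; exact: le_trans (ler_norm _).
have [h _] := hM _ _ _ (key (j + 1)); have [_ h'] := hM _ _ _ (key j).
by rewrite addrK in h; rewrite /slope ler_norml h h'.
Qed.

Lemma u_Delta_grid dt dx n j : 0 < dt -> 0 < dx ->
  u_Delta HL HR F u0 dt dx (n%:R * dt, j%:~R * dx) = U dt dx n j.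
Proof.
move=> dt0 dx0; rewrite /u_Delta /= !mulfK ?gt_eqF // natrK intrKfloor.
by rewrite subrr mulr0 addr0.
Qed.

Lemma u_Delta_lipschitz : exists2 C : R, 0 <= C & forall dt dx, adm dt dx ->
  (forall X Y, `|u_Delta HL HR F u0 dt dx X - u_Delta HL HR F u0 dt dx Y| <=
     C * (`|X.1 - Y.1| + `|X.2 - Y.2| + dx)) /\
  (forall x, `|u_Delta HL HR F u0 dt dx (0, x) - u0 x| <= C * dx).
Proof.
have Lpos := L_gt0; have kpos := kappa_ge0.
have [C C0 hC] := scheme_time; have [M M0 hM] := scheme_space.
(* The CFL condition gives C dt <= D dx, so the error of one time step is also a multiple of dx. *)
pose D := C / (2 * L).
have D0 : 0 <= D by rewrite divr_ge0 // mulr_ge0 // ltW.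
exists (3 * M + C + D + kappa); first by rewrite !addr_ge0 // mulr_ge0.
move=> dt dx a; have [dt0 dx0 cfl] := a.
have dtdx : C * dt <= D * dx.
  have -> : C * dt = D * (2 * L * dt) by rewrite mulrA /D divfK // gt_eqF // mulr_gt0.
  by rewrite ler_wpM2l.
have nodal X : `|u_Delta HL HR F u0 dt dx X -
    U dt dx (Num.truncn (X.1 / dt)) (Num.floor (X.2 / dx))| <= M * dx.
  rewrite /u_Delta addrAC subrr add0r normrM.
  have := hM dt dx a (Num.truncn (X.1 / dt)) (Num.floor (X.2 / dx)).
  move=> /ler_pM; apply => //.
  have := floor_itv (X.2 / dx); rewrite intrD.
  rewrite ler_pdivlMr // ltr_pdivrMr // => /andP[h1 h2].
  by rewrite ger0_norm ?subr_ge0 //; lra.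
have spc n i j : `|U dt dx n i - U dt dx n j| <= M * dx * `|i%:~R - j%:~R|.
  apply: int_lipschitz => {}i; apply: slope_le => //; exact: hM.
have tim j (n m : nat) : `|U dt dx n j - U dt dx m j| <= C * dt * `|n%:R - m%:R|.
  exact: (nat_lipschitz (fun n => hC dt dx a n j)).
have scale (s s' h : R) : 0 < h -> (`|s / h - s' / h| + 1) * h = `|s - s'| + h.
  move=> h0; rewrite mulrDl mul1r -mulrBl normrM normfV (gtr0_norm h0) divfK //.
  by rewrite gt_eqF.
split.
  move=> X Y.
  set n := Num.truncn (X.1 / dt); set j := Num.floor (X.2 / dx).
  set m := Num.truncn (Y.1 / dt); set i := Num.floor (Y.2 / dx).
  have h1 := nodal X; have h2 := nodal Y; rewrite -/n -/m -/i -/j in h1 h2.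
  have h3 := spc n j i; have h4 := tim i n m.
  have h5 : C * dt * `|n%:R - m%:R| <= C * `|X.1 - Y.1| + C * dt.
    rewrite -mulrDr -scale // mulrAC [C * _ * _]mulrAC -!mulrA ler_wpM2l //.
    by rewrite mulrC ler_pM2r //; exact: truncn_dist.
  have h6 : M * dx * `|j%:~R - i%:~R| <= M * `|X.2 - Y.2| + M * dx.
    rewrite -mulrDr -scale // -!mulrA ler_wpM2l //.
    by rewrite mulrC ler_pM2r //; exact: floor_dist.
  have := ler_distD (U dt dx n j) (u_Delta HL HR F u0 dt dx X) (u_Delta HL HR F u0 dt dx Y).
  have := ler_distD (U dt dx m i) (U dt dx n j) (u_Delta HL HR F u0 dt dx Y).
  have := ler_distD (U dt dx n i) (U dt dx n j) (U dt dx m i).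
  rewrite (distrC (U dt dx m i)).
  have x0 : 0 <= `|X.1 - Y.1| by []; have y0 : 0 <= `|X.2 - Y.2| by [].
  have : 0 <= (2 * M + C + D + kappa) * `|X.2 - Y.2| by rewrite mulr_ge0 //; lra.
  have : 0 <= (3 * M + D + kappa) * `|X.1 - Y.1| by rewrite mulr_ge0 //; lra.
  have : 0 <= (C + kappa) * dx by rewrite mulr_ge0 //; lra.
  lra.
move=> x; have := nodal (0, x); rewrite /= mul0r truncn0.
set j := Num.floor (x / dx) => h1.
have := ler_distD (U dt dx 0 j) (u_Delta HL HR F u0 dt dx (0, x)) (u0 x).
have h2 : `|U dt dx 0 j - u0 x| <= kappa * dx.
  apply: le_trans (u0_lip _ _) _; rewrite ler_wpM2l //.
  have := floor_itv (x / dx); rewrite intrD -/j.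
  rewrite ler_pdivlMr // ltr_pdivrMr // => /andP[a1 a2].
  by rewrite ler0_norm ?subr_le0 //; lra.
have : 0 <= (2 * M + C + D) * dx by rewrite mulr_ge0 //; lra.
lra.
Qed.

End Estimates.

End Scheme.

(** * Limits of the scheme *)

Section Consistency.
Context {R : realType}.
Implicit Types (f df H : R -> R) (F : R -> R -> R) (u phi : R * R -> R).
Implicit Types (W : R -> R -> R * R -> R).
Implicit Types (A B C K L M N T a b c d e k l p q r rho s t x y z dt dx : R).

Lemma MVT_within (D : set R) f df a b : a <= b ->
  (forall x, a <= x <= b -> D x /\ derive_within D f x (df x)) ->
  exists2 c, a <= c <= b & f b - f a = df c * (b - a).
Proof.
move=> ab h.
have [||c] := @MVT_segment R f df a b ab; last first.
- by rewrite in_itv /= => cab E; exists c.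
- apply/subspace_continuousP => x; rewrite /= in_itv /= => xab.
  apply/cvgrPdist_lt => e e0.
  have [_ /derive_withinP /(_ 1 ltr01)[d d0 hd]] := h x xab.
  have l1 : 0 < `|df x| + 1 by rewrite ltr_wpDl.
  apply/near1P; exists (Num.min d (e / (`|df x| + 1))).
    by rewrite lt_min d0 divr_gt0.
  move=> y; rewrite lt_min ltr_pdivlMr // => /andP[y1 y2]; rewrite /= in_itv /= => yab.
  have [->|yx] := eqVneq y x; first by rewrite subrr normr0.
  have := hd y (h y yab).1 yx y1.
  have yx0 : 0 < `|y - x| by rewrite normr_gt0 subr_eq0.
  move=> hq; apply: le_lt_trans y2.
  have -> : f x - f y = - ((f y - f x) / (y - x) * (y - x)).
    by rewrite divfK ?opprB // subr_eq0.
  rewrite normrN normrM mulrC ler_pM2l //.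
  have := ler_normD ((f y - f x) / (y - x) - df x) (df x).
  by rewrite subrK; clra.
move=> x; rewrite in_itv /= => /andP[ax xb].
have xab : a <= x <= b by rewrite !ltW.
have cv : (fun k : R => k^-1 *: (f (k *: (1 : R) + x) - f x)) @ 0^' --> df x.
  apply/cvgrPdist_lt => e e0.
  have [_ /derive_withinP /(_ e e0)[d d0 hd]] := h x xab.
  apply/near1P; exists (Num.min d (Num.min (x - a) (b - x))).
    by rewrite !lt_min d0 !subr_gt0 ax.
  move=> k; rewrite subr0 !lt_min => /andP[k1 /andP[k2 k3]] k0.
  have kab : a <= k + x <= b by move: k2 k3; rewrite !ltr_norml; clra.
  have := hd (k + x) (h _ kab).1; rewrite addrK => hk.
  rewrite distrC /GRing.scale /= mulr1 mulrC; apply: hk.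
    by rewrite -subr_eq0 addrK.
  exact: k1.
apply: DeriveDef; first by apply/cvg_ex; exists (df x).
exact: cvg_lim cv.
Qed.

Lemma within_near (D : set (R * R)) (g : R * R -> R) X e :
  {within D, continuous g} -> D X -> 0 < e ->
  exists2 d, 0 < d & forall t x, `|t - X.1| < d -> `|x - X.2| < d ->
    D (t, x) -> `|g (t, x) - g X| < e.
Proof.
move=> /subspace_continuousP cg DX e0.
have /cvgrPdist_lt /(_ e e0) := cg X DX.
move=> /near2P[d d0 hd]; exists d => // t x tX xX Dtx.
by rewrite distrC; exact: hd.
Qed.

(** The mean value theorem turns continuity of the partial derivatives into uniform increments.
    Space increments on one side of 0 at a time suffice for the scheme, because 0 is a grid node and
    no cell straddles it. *)
Lemma C1_wedge_increments T phi phit phixL phixR X e :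
  C1_wedge T phi phit phixL phixR -> Q T X -> 0 < e ->
  exists2 d, 0 < d &
    [/\ forall s t x, `|s - X.1| < d -> `|t - X.1| < d -> `|x - X.2| < d -> s <= t ->
          `|phi (t, x) - phi (s, x) - phit X * (t - s)| <= e * (t - s),
        forall t x y, `|t - X.1| < d -> `|x - X.2| < d -> `|y - X.2| < d ->
          x <= y -> y <= 0 ->
          `|phi (t, y) - phi (t, x) - phixL X * (y - x)| <= e * (y - x)
      & forall t x y, `|t - X.1| < d -> `|x - X.2| < d -> `|y - X.2| < d ->
          x <= y -> 0 <= x ->
          `|phi (t, y) - phi (t, x) - phixR X * (y - x)| <= e * (y - x)].
Proof.
move=> [_ [ctL cxL dL] [ctR cxR dR]] [/= + _] e0; rewrite in_itv /= => X1T.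
have QLE t x : 0 < t < T -> x <= 0 -> QL T (t, x).
  by move=> tT x0; split; rewrite /= in_itv.
have QRE t x : 0 < t < T -> 0 <= x -> QR T (t, x).
  by move=> tT x0; split; rewrite /= in_itv /= ?andbT.
have [d1 d10 hL] : exists2 d, 0 < d & forall t x, `|t - X.1| < d -> `|x - X.2| < d ->
    0 < t < T -> x <= 0 -> `|phit (t, x) - phit X| < e /\ `|phixL (t, x) - phixL X| < e.
  have [X20|X20] := leP X.2 0.
    have QX : QL T X by rewrite [X]surjective_pairing; exact: QLE.
    have [d1 d10 h1] := within_near ctL QX e0.
    have [d2 d20 h2] := within_near cxL QX e0.
    exists (Num.min d1 d2); first by rewrite lt_min d10.
    move=> t x; rewrite !lt_min => /andP[t1 t2] /andP[x1 x2] tT x0.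
    by split; [apply: h1|apply: h2] => //; exact: QLE.
  (* Here X lies strictly on the right, and this radius keeps the left half-plane out of reach. *)
  exists X.2 => // t x _ xX _ x0; exfalso.
  by move: xX; rewrite ltr_norml; clra.
have [d2 d20 hR] : exists2 d, 0 < d & forall t x, `|t - X.1| < d -> `|x - X.2| < d ->
    0 < t < T -> 0 <= x -> `|phit (t, x) - phit X| < e /\ `|phixR (t, x) - phixR X| < e.
  have [X20|X20] := leP 0 X.2.
    have QX : QR T X by rewrite [X]surjective_pairing; exact: QRE.
    have [d3 d30 h1] := within_near ctR QX e0.
    have [d4 d40 h2] := within_near cxR QX e0.
    exists (Num.min d3 d4); first by rewrite lt_min d30.
    move=> t x; rewrite !lt_min => /andP[t1 t2] /andP[x1 x2] tT x0.
    by split; [apply: h1|apply: h2] => //; exact: QRE.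
  exists (- X.2) => [|t x _ xX _ x0]; first by rewrite oppr_gt0.
  by exfalso; move: xX; rewrite ltr_norml; clra.
pose d := Num.min (Num.min d1 d2) (Num.min X.1 (T - X.1)).
have dd x z : `|x - z| < d -> `|x - z| < d1 /\ `|x - z| < d2.
  by rewrite !lt_min => /andP[/andP[]].
have tI t : `|t - X.1| < d -> 0 < t < T.
  by rewrite !lt_min !ltr_norml => /andP[_ /andP[h1 h2]]; clra.
have mid a b z y : `|a - z| < d -> `|b - z| < d -> a <= y <= b -> `|y - z| < d.
  by rewrite !ltr_norml => h1 h2 h3; clra.
have conc a b c p (q : R) : a <= b -> `|c - p| < e -> q = c * (b - a) ->
    `|q - p * (b - a)| <= e * (b - a).
  move=> ab cp ->; rewrite -mulrBl normrM [X in _ * X]ger0_norm ?subr_ge0 //.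
  by rewrite ler_wpM2r ?subr_ge0 // ltW.
exists d; first by rewrite !lt_min d10 d20; clra.
split.
- move=> s t x sX tX xX st.
  have [x0|x0] := leP x 0.
    have [|c cst E] := @MVT_within [set t | QL T (t, x)] (fun t => phi (t, x))
        (fun t => phit (t, x)) s t st.
      move=> y yst; have yT := tI y (mid _ _ _ _ sX tX yst).
      by split; [exact: QLE|exact: (dL _ (QLE y x yT x0)).1].
    have cX := mid _ _ _ _ sX tX cst.
    apply: conc st _ E.
    exact: (hL c x (dd _ _ cX).1 (dd _ _ xX).1 (tI c cX) x0).1.
  have [|c cst E] := @MVT_within [set t | QR T (t, x)] (fun t => phi (t, x))
      (fun t => phit (t, x)) s t st.
    move=> y yst; have yT := tI y (mid _ _ _ _ sX tX yst).
    by split; [exact: QRE (ltW x0)|exact: (dR _ (QRE y x yT (ltW x0))).1].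
  have cX := mid _ _ _ _ sX tX cst.
  apply: conc st _ E.
  exact: (hR c x (dd _ _ cX).2 (dd _ _ xX).2 (tI c cX) (ltW x0)).1.
- move=> t x y tX xX yX xy y0; have tT := tI t tX.
  have [|c cst E] := @MVT_within [set x | QL T (t, x)] (fun x => phi (t, x))
      (fun x => phixL (t, x)) x y xy.
    move=> z /andP[_ zy]; have z0 := le_trans zy y0.
    by split; [exact: QLE|exact: (dL _ (QLE t z tT z0)).2].
  have cX := mid _ _ _ _ xX yX cst.
  have c0 : c <= 0 by clra.
  apply: conc xy _ E.
  exact: (hL t c (dd _ _ tX).1 (dd _ _ cX).1 tT c0).2.
- move=> t x y tX xX yX xy x0; have tT := tI t tX.
  have [|c cst E] := @MVT_within [set x | QR T (t, x)] (fun x => phi (t, x))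
      (fun x => phixR (t, x)) x y xy.
    move=> z /andP[xz _]; have z0 := le_trans x0 xz.
    by split; [exact: QRE|exact: (dR _ (QRE t z tT z0)).2].
  have cX := mid _ _ _ _ xX yX cst.
  have c0 : 0 <= c by clra.
  apply: conc xy _ E.
  exact: (hR t c (dd _ _ tX).2 (dd _ _ cX).2 tT c0).2.
Qed.

Lemma grid_max (P : nat -> int -> bool) (g : nat -> int -> R) (N : nat) n0 j0 :
  P n0 j0 -> (forall n j, P n j -> (n < N)%N /\ (`|j| < N)%N) ->
  exists n j, P n j /\ forall n' j', P n' j' -> g n' j' <= g n j.
Proof.
move=> P0 bnd.
pose J (i : 'I_(N + N)) : int := (i : nat)%:Z - N%:Z.
have JP n j : P n j -> exists2 z : 'I_N * 'I_(N + N), n = z.1 & j = J z.2.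
  move=> /bnd[nN jN].
  have lt : (`|(j + N%:Z)%R| < N + N)%N.
    by rewrite -ltz_nat gez0_abs; lia.
  exists (Ordinal nN, Ordinal lt) => //=; rewrite /J /= gez0_abs ?addrK //.
  by lia.
have [z0 n0E j0E] := JP _ _ P0.
pose PP (z : 'I_N * 'I_(N + N)) := P z.1 (J z.2).
have PP0 : PP z0 by rewrite /PP -n0E -j0E.
case: (arg_maxP (fun w : 'I_N * 'I_(N + N) => g w.1 (J w.2)) PP0) => w Pw hw.
exists w.1, (J w.2); split => // n j /[dup] Pnj /JP[z' nE jE].
by rewrite nE jE; apply: hw; rewrite /PP -nE -jE.
Qed.

End Consistency.

(** * Upper limits of equi-Lipschitz families *)

Section UpperLimit.
Context {R : realType}.
Implicit Types (u phi : R * R -> R) (W : R -> R -> R * R -> R) (X Y : R * R).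
Implicit Types (a b c d e k l p q r rho s t x y z dt dx C L : R).

(** The limit superior over admissible meshes as dx -> 0, as the infimum of the eventual bounds. X
    can stay fixed because the equi-Lipschitz bound controls nearby points up to O(dx). *)
Definition upper_limit L W X : R := inf [set a | exists2 d, 0 < d &
  forall dt dx, adm L dt dx -> dx < d -> W dt dx X <= a].

Definition lower_limit L W X : R :=
  - upper_limit L (fun dt dx X => - W dt dx X) X.

Definition equi_lipschitz L C (u0 : R -> R) W := forall dt dx, adm L dt dx ->
  (forall X Y, `|W dt dx X - W dt dx Y| <=
     C * (`|X.1 - Y.1| + `|X.2 - Y.2| + dx)) /\
  (forall x, `|W dt dx (0, x) - u0 x| <= C * dx).

Lemma equi_lipschitzN L C (u0 : R -> R) W : equi_lipschitz L C u0 W ->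
  equi_lipschitz L C (fun x => - u0 x) (fun dt dx X => - W dt dx X).
Proof.
move=> h dt dx /h[h1 h2]; split.
  by move=> X Y; rewrite opprK addrC distrC.
by move=> x; rewrite opprK addrC distrC.
Qed.

Lemma adm_exists L d : 0 < L -> 0 < d -> exists dt dx, adm L dt dx /\ dx < d.
Proof.
move=> L0 d0; exists (d / 2 / (2 * L)), (d / 2); split; last by clra.
split; [|by rewrite divr_gt0|].
  by rewrite !divr_gt0 // mulr_gt0.
by rewrite mulrC divfK // gt_eqF // mulr_gt0.
Qed.

Lemma equi_lipschitz_bound L C (u0 : R -> R) W : 0 <= C -> equi_lipschitz L C u0 W ->
  forall dt dx X, adm L dt dx -> dx <= 1 ->
  `|W dt dx X - u0 X.2| <= C * (`|X.1| + 2).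
Proof.
move=> C0 h dt dx X a dx1; have [h1 h2] := h dt dx a.
have := h1 X (0, X.2); rewrite /= subrr normr0 addr0 subr0 => h3.
have := h2 X.2; have := ler_distD (W dt dx (0, X.2)) (W dt dx X) (u0 X.2).
have : C * dx <= C * 1 by rewrite ler_wpM2l.
clra.
Qed.

Lemma upper_limit_has_inf L C (u0 : R -> R) W X : 0 < L -> 0 <= C ->
  equi_lipschitz L C u0 W ->
  has_inf [set a | exists2 d, 0 < d &
    forall dt dx, adm L dt dx -> dx < d -> W dt dx X <= a].
Proof.
move=> L0 C0 h; split.
  exists (u0 X.2 + C * (`|X.1| + 2)); exists 1 => // dt dx a dx1.
  have := equi_lipschitz_bound C0 h X a (ltW dx1); rewrite ler_norml; clra.
exists (u0 X.2 - C * (`|X.1| + 2)) => b [d d0 hd].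
have [|dt [dx [a dxd]]] := @adm_exists L (Num.min 1 d) L0.
  by rewrite lt_min ltr01.
move: dxd; rewrite lt_min => /andP[dx1 dxd].
have := equi_lipschitz_bound C0 h X a (ltW dx1); rewrite ler_norml.
by have := hd _ _ a dxd; clra.
Qed.

Lemma upper_limit_gt L C (u0 : R -> R) W X a : 0 < L -> 0 <= C -> equi_lipschitz L C u0 W ->
  upper_limit L W X < a ->
  exists2 d, 0 < d & forall dt dx, adm L dt dx -> dx < d -> W dt dx X < a.
Proof.
move=> L0 C0 h la; have hi := upper_limit_has_inf X L0 C0 h.
have la0 : 0 < a - upper_limit L W X by rewrite subr_gt0.
have [b [d d0 hd] ba] := inf_adherent la0 hi.
exists d => // dt dx ad dxd; apply: le_lt_trans (hd _ _ ad dxd) _.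
by move: ba; rewrite /upper_limit; clra.
Qed.

Lemma upper_limit_le L C (u0 : R -> R) W X a d : 0 < L -> 0 <= C -> equi_lipschitz L C u0 W ->
  0 < d -> (forall dt dx, adm L dt dx -> dx < d -> W dt dx X <= a) ->
  upper_limit L W X <= a.
Proof.
move=> L0 C0 h d0 hd; apply: ge_inf; last by exists d.
by have [] := upper_limit_has_inf X L0 C0 h.
Qed.

Lemma upper_limit_lt L C (u0 : R -> R) W X a d : 0 < L -> 0 <= C -> equi_lipschitz L C u0 W ->
  a < upper_limit L W X -> 0 < d ->
  exists dt dx, [/\ adm L dt dx, dx < d & a < W dt dx X].
Proof.
move=> L0 C0 h al d0; apply: contrapT => nex.
have : upper_limit L W X <= a; last by clra.
apply: (upper_limit_le L0 C0 h d0) => dt dx ad dxd.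
rewrite leNgt; apply/negP => lt; apply: nex; by exists dt, dx.
Qed.

Lemma upper_limit_lipschitz_le L C (u0 : R -> R) W X Y : 0 < L -> 0 <= C ->
  equi_lipschitz L C u0 W ->
  upper_limit L W X <= upper_limit L W Y + C * (`|X.1 - Y.1| + `|X.2 - Y.2|).
Proof.
move=> L0 C0 h.
apply: (@le_limit0 _ _ _ (1 + C) 1) => // e e0 _.
have [|d d0 hd] := upper_limit_gt (X := Y) (a := upper_limit L W Y + e) L0 C0 h.
  by rewrite ltrDl.
apply: (upper_limit_le (d := Num.min d e) L0 C0 h); first by rewrite lt_min d0.
move=> dt dx ad; rewrite lt_min => /andP[dxd dxe].
have := (h dt dx ad).1 X Y; have := hd _ _ ad dxd.
have := ler_norm (W dt dx X - W dt dx Y).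
have : C * dx <= C * e by rewrite ler_wpM2l // ltW.
clra.
Qed.

Lemma upper_limit_lipschitz L C (u0 : R -> R) W X Y : 0 < L -> 0 <= C ->
  equi_lipschitz L C u0 W ->
  `|upper_limit L W X - upper_limit L W Y| <= C * (`|X.1 - Y.1| + `|X.2 - Y.2|).
Proof.
move=> L0 C0 h.
have h1 := upper_limit_lipschitz_le X Y L0 C0 h.
have := upper_limit_lipschitz_le Y X L0 C0 h.
by rewrite (distrC Y.1) (distrC Y.2) ler_norml; clra.
Qed.

Lemma upper_limit_init L C (u0 : R -> R) W x : 0 < L -> 0 <= C -> equi_lipschitz L C u0 W ->
  upper_limit L W (0, x) = u0 x.
Proof.
move=> L0 C0 h; apply/eqP; rewrite eq_le; apply/andP; split.
  apply: (@le_limit0 _ _ _ C 1) => // e e0 _.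
  apply: (upper_limit_le (d := e) L0 C0 h) => // dt dx ad dxe.
  have := (h dt dx ad).2 x; rewrite ler_norml.
  have : C * dx <= C * e by rewrite ler_wpM2l // ltW.
  clra.
apply: (@le_limit0 _ _ _ (1 + C) 1) => // e e0 _.
have [|d d0 hd] := upper_limit_gt (X := (0, x)) (a := upper_limit L W (0, x) + e) L0 C0 h.
  by rewrite ltrDl.
have [|dt [dx [ad dxd]]] := @adm_exists L (Num.min d e) L0.
  by rewrite lt_min d0.
move: dxd; rewrite lt_min => /andP[dxd dxe].
have := (h dt dx ad).2 x; rewrite ler_norml.
have : C * dx <= C * e by rewrite ler_wpM2l // ltW.
have := hd _ _ ad dxd.
clra.
Qed.

Lemma upper_limit_uniform L C (u0 : R -> R) W (K : set (R * R)) e : 0 < L -> 0 <= C ->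
  equi_lipschitz L C u0 W -> compact K -> 0 < e ->
  exists2 d, 0 < d & forall dt dx, adm L dt dx -> dx < d ->
    forall X, K X -> W dt dx X <= upper_limit L W X + e.
Proof.
move=> L0 C0 h /compact_near_coveringP cK e0.
pose P i X := forall dt dx, adm L dt dx -> dx < i ->
  W dt dx X <= upper_limit L W X + e.
have /cK : forall X, K X -> \forall X' \near X & i \near 0^'+, P i X'.
  move=> X _; have C1 : 0 < C + 1 by rewrite ltr_wpDl.
  (* Six errors share e: one from the limit at X, three from moving W (time, space and mesh), two
     from moving the limit. *)
  pose r := e / 6 / (C + 1).
  have r0 : 0 < r by rewrite !divr_gt0.
  have Cr : C * r <= e / 6.
    have : (C + 1) * r = e / 6 by rewrite /r mulrC divfK // gt_eqF.
    by clra.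
  have [|d d0 hd] := upper_limit_gt (X := X) (a := upper_limit L W X + e / 6) L0 C0 h.
    by rewrite ltrDl divr_gt0.
  exists ([set X' | `|X'.1 - X.1| < r /\ `|X'.2 - X.2| < r],
          [set i | 0 < i < Num.min d r]).
    split.
      by apply/near2P; exists r.
    rewrite /= /at_right /within /=; apply/near1P.
    exists (Num.min d r); first by rewrite lt_min d0.
    move=> y; rewrite subr0 => yd y0; rewrite /= y0 /=.
    exact: le_lt_trans (ler_norm _) yd.
  move=> [X' i] /= [[x1 x2] /andP[i0]]; rewrite lt_min => /andP[id ir] dt dx ad dxi.
  have b1 := hd dt dx ad (lt_trans dxi id).
  have := (h dt dx ad).1 X' X.
  have b2 := upper_limit_lipschitz_le X X' L0 C0 h.
  have b3 := ler_norm (W dt dx X' - W dt dx X).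
  rewrite (distrC X.1) (distrC X.2) in b2.
  have : C * `|X'.1 - X.1| <= C * r by rewrite ler_wpM2l // ltW.
  have : C * `|X'.2 - X.2| <= C * r by rewrite ler_wpM2l // ltW.
  have : C * dx <= C * r by rewrite ler_wpM2l // ltW // (lt_trans dxi).
  clra.
case=> d /= d0 hd; exists (d / 2); first by clra.
move=> dt dx ad dxd X KX; apply: (hd (d / 2)) => //=; last by clra.
by rewrite sub0r normrN gtr0_norm; clra.
Qed.

End UpperLimit.

(** * Discrete contact and the sub-solution property of the limit *)

Section BarlesSouganidis.
Context {R : realType}.
Implicit Types (phi : R * R -> R) (W : R -> R -> R * R -> R) (X Y : R * R).
Implicit Types (a b c d e k l p q r rho s t x y z dt dx C L T : R).

(** The pattern of [flux] with arbitrary fluxes, so that the sign-reversed scheme is covered too. *)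
Definition node_flux (fL fR f0 : R -> R -> R) (j : int) : R -> R -> R :=
  if j < 0 then fL else if 0 < j then fR else f0.

Lemma quotient_close (D p r h e : R) : 0 < h -> `|D - p * h| <= e * h -> `|r| <= e ->
  `|(D + r * h) / h - p| <= 2 * e.
Proof.
move=> h0 hD re.
have -> : (D + r * h) / h - p = (D - p * h) / h + r by field; rewrite gt_eqF.
have : `|(D - p * h) / h| <= e.
  by rewrite normrM normfV (gtr0_norm h0) ler_pdivrMr.
have := ler_normD ((D - p * h) / h) r; clra.
Qed.

(** The quadratic added to phi makes the contact at X strict. U - psi is maximised over the nodes of
    a box around X; monotonicity and invariance by constants then let psi replace U in one step of
    the scheme ending at the maximising node. *)
Lemma discrete_max L C (u0 : R -> R) W (fL fR f0 : R -> R -> R)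
    (U : R -> R -> nat -> int -> R) T phi X rho :
  0 < L -> 0 <= C -> equi_lipschitz L C u0 W ->
  (forall j, monotone_flux L (node_flux fL fR f0 j)) ->
  (forall dt dx n j, adm L dt dx -> W dt dx (n%:R * dt, j%:~R * dx) = U dt dx n j) ->
  (forall dt dx n j, adm L dt dx -> U dt dx n.+1 j = U dt dx n j -
     dt * node_flux fL fR f0 j ((U dt dx n j - U dt dx n (j - 1)) / dx)
                               ((U dt dx n (j + 1) - U dt dx n j) / dx)) ->
  {within Q T, continuous phi} -> 0 < rho -> rho < X.1 -> rho < T - X.1 ->
  upper_limit L W X = phi X ->
  (forall t x, `|t - X.1| <= rho -> `|x - X.2| <= rho ->
     upper_limit L W (t, x) <= phi (t, x)) ->
  let psi t x := phi (t, x) + ((t - X.1) ^+ 2 + (x - X.2) ^+ 2) in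
  exists dt dx (m : nat) (j : int),
  let t := m%:R * dt in let x := j%:~R * dx in
  [/\ [/\ 0 < dt, dt <= rho / 8, 0 < dx & dx <= rho / 8],
    `|t + dt - X.1| < rho / 2, `|x - X.2| < rho / 2
    & psi (t + dt) x <= psi t x - dt * node_flux fL fR f0 j
        ((psi t x - psi t (x - dx)) / dx) ((psi t (x + dx) - psi t x) / dx)].
Proof.
move=> L0 C0 lipW mono gridE stepE cphi rho0 rX1 rXT touchX hd0 psi.
(* At a node next to X, U - psi will be at least -4 del; at the maximiser it is at most del minus
   the squared distance to X. Hence that squared distance is at most 5 del < 8 del = (rho / 2)^2. *)
pose del := rho ^+ 2 / 32.
have del0 : 0 < del by rewrite divr_gt0 // exprn_gt0.
have delE : del = rho ^+ 2 / 32 by [].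
clearbody del.
have QX : Q T X by split => //=; rewrite in_itv /=; lra.
have [d2 d20 hd2] := within_near cphi QX del0.
pose K := [set` `[X.1 - rho, X.1 + rho]] `*` [set` `[X.2 - rho, X.2 + rho]].
have cK : compact K.
  exact: compact_setX (@segment_compact R _ _) (@segment_compact R _ _).
have [d3 d30 hd3] := upper_limit_uniform L0 C0 lipW cK del0.
pose theta := Num.min (Num.min (rho / 8) (d2 / 2)) (del / 3 / (C + 1)).
have C1' : 0 < C + 1 by lra.
have theta0 : 0 < theta by rewrite !lt_min !divr_gt0.
have [th1 th2 th3] : [/\ theta <= rho / 8, theta <= d2 / 2 & (C + 1) * theta <= del / 3].
  split; first by rewrite !ge_min lexx.
    by rewrite !ge_min lexx orbT.
  by rewrite mulrC -ler_pdivlMr // ge_min lexx orbT.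
clearbody theta.
(* Since dt <= dx / (2 L), the bound dx S < theta puts both dx and dt below theta. *)
pose S := 1 + (2 * L)^-1.
have iL : 0 < (2 * L)^-1 by rewrite invr_gt0 mulr_gt0.
have S1 : 1 <= S by rewrite /S; lra.
have [||dt [dx [ad dxd WX]]] := @upper_limit_lt R L C u0 W X (phi X - del)
  (Num.min d3 (theta / S)) L0 C0 lipW.
- by rewrite touchX; lra.
- by rewrite lt_min d30 divr_gt0 //; lra.
move: dxd; rewrite lt_min ltr_pdivlMr; last by lra.
move=> /andP[dxd3 dxth].
have [dt0 dx0 cfl] := ad.
have dxt : dx <= theta.
  by apply: le_trans (ltW dxth); rewrite ler_peMr // ltW.
have dtt : dt <= theta.
  apply: le_trans (ltW dxth).
  have : dt <= dx * (2 * L)^-1 by rewrite ler_pdivlMr ?mulr_gt0 // mulrC.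
  by rewrite /S; lra.
have {dxth iL S S1} _ := I.
pose tm (n : nat) := n%:R * dt; pose xm (j : int) := j%:~R * dx.
pose P (n : nat) (j : int) := (`|tm n - X.1| <= rho) && (`|xm j - X.2| <= rho).
pose g n j := U dt dx n j - psi (tm n) (xm j).
pose n0 := Num.truncn (X.1 / dt); pose j0 := Num.floor (X.2 / dx).
have tn0 : `|tm n0 - X.1| <= dt.
  have X10 : 0 <= X.1 by clear -rho0 rX1; lra.
  have /truncn_itv : 0 <= X.1 / dt by rewrite divr_ge0 // ltW.
  rewrite -/n0 ler_pdivlMr // ltr_pdivrMr // -natr1 mulrDl mul1r => /andP[h1 h2].
  by rewrite /tm ler_norml; clear -h1 h2 dt0; lra.
have xj0 : `|xm j0 - X.2| <= dx.
  have := floor_itv (X.2 / dx); rewrite -/j0 intrD.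
  rewrite ler_pdivlMr // ltr_pdivrMr // mulrDl mul1r => /andP[h1 h2].
  by rewrite /xm ler_norml; clear -h1 h2 dx0; lra.
have thr : theta <= rho by clear -th1 rho0; lra.
have P0 : P n0 j0.
  apply/andP; split; first exact: le_trans (le_trans tn0 dtt) thr.
  exact: le_trans (le_trans xj0 dxt) thr.
pose N := (Num.truncn ((X.1 + rho) / dt + (`|X.2| + rho) / dx)).+1.
have Nbnd n j : P n j -> (n < N)%N /\ (`|j| < N)%N.
  move=> /andP[h1 h2].
  have A0 : 0 <= (X.1 + rho) / dt.
    by rewrite divr_ge0 ?(ltW dt0) //; clear -rho0 rX1; lra.
  have B0 : 0 <= (`|X.2| + rho) / dx by rewrite divr_ge0 ?(ltW dx0) // addr_ge0 // ltW.
  have AB := truncnS_gt ((X.1 + rho) / dt + (`|X.2| + rho) / dx).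
  rewrite -!(ltr_nat R) natr_absz intr_norm; split.
    apply: le_lt_trans AB.
    have : n%:R <= (X.1 + rho) / dt.
      by rewrite ler_pdivlMr //; move: h1; rewrite /tm ler_norml; clear; lra.
    by clear -B0; lra.
  apply: le_lt_trans AB.
  have : `|j%:~R| <= (`|X.2| + rho) / dx.
    have E : `|j%:~R| * dx = `|xm j| by rewrite /xm normrM (gtr0_norm dx0).
    rewrite ler_pdivlMr // E; have := ler_distD X.2 (xm j) 0; rewrite !subr0.
    by clear -h2; lra.
  by clear -A0; lra.
have [n1 [j1 [P1 gmax]]] := @grid_max R P g N n0 j0 P0 Nbnd.
have inK n j : P n j -> K (tm n, xm j).
  move=> /andP[]; rewrite !ler_norml => h1 h2.
  by split; rewrite /= in_itv /=; clear -h1 h2; lra.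
have sq_le s a : `|s| <= a -> s ^+ 2 <= a ^+ 2.
  move=> sa; rewrite -[X in X <= _]real_normK ?num_real //.
  by rewrite lerXn2r // nnegrE // (le_trans _ sa).
have g0 : - (4 * del) <= g n0 j0.
  have b1 : phi (tm n0, xm j0) < phi X + del.
    have Qg : Q T (tm n0, xm j0).
      split => //=; rewrite in_itv /=; move: (le_trans (le_trans tn0 dtt) thr).
      by rewrite ler_norml; clear -rX1 rXT; lra.
    have thd : theta < d2 by clear -th2 d20; lra.
    have := hd2 (tm n0) (xm j0) (le_lt_trans (le_trans tn0 dtt) thd)
      (le_lt_trans (le_trans xj0 dxt) thd) Qg.
    by rewrite ltr_norml; clear; lra.
  have b2 : W dt dx X - del <= U dt dx n0 j0.
    rewrite -gridE //.
    have := (lipW dt dx ad).1 X (tm n0, xm j0); rewrite /= -/(tm _) -/(xm _).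
    rewrite (distrC X.1) (distrC X.2) => h1.
    have h2 := ler_norm (W dt dx X - W dt dx (tm n0, xm j0)).
    have h3 : C * (`|tm n0 - X.1| + `|xm j0 - X.2| + dx) <= C * (3 * theta).
      by rewrite ler_wpM2l //; clear -tn0 xj0 dxt dtt; lra.
    have E : C * theta + theta = (C + 1) * theta by ring.
    by clear -h1 h2 h3 E th3 theta0; lra.
  have q1 : (tm n0 - X.1) ^+ 2 <= (rho / 8) ^+ 2.
    by apply: sq_le; clear -tn0 dtt th1; lra.
  have q2 : (xm j0 - X.2) ^+ 2 <= (rho / 8) ^+ 2.
    by apply: sq_le; clear -xj0 dxt th1; lra.
  have E : (rho / 8) ^+ 2 = del / 2 by rewrite delE; field.
  by rewrite /g /psi; rewrite E in q1 q2; clear -q1 q2 b1 b2 WX; lra.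
have g1 : - (4 * del) <= g n1 j1 by apply: le_trans g0 (gmax _ _ P0).
have g1' : g n1 j1 <= del - ((tm n1 - X.1) ^+ 2 + (xm j1 - X.2) ^+ 2).
  have h1 := hd3 dt dx ad dxd3 _ (inK _ _ P1).
  rewrite /tm /xm gridE // -/(tm _) -/(xm _) in h1.
  move: P1 => /andP[p1 p2].
  have h2 := hd0 (tm n1) (xm j1) p1 p2.
  by rewrite /g /psi; clear -h1 h2; lra.
have small s : s ^+ 2 <= 5 * del -> `|s| < rho / 2.
  move=> h; rewrite ltNge; apply/negP => le.
  have h1 : (rho / 2) ^+ 2 <= s ^+ 2.
    rewrite -[X in _ <= X]real_normK ?num_real //.
    by rewrite lerXn2r // nnegrE; clear -rho0 le; lra.
  have E : (rho / 2) ^+ 2 = 8 * del by rewrite delE; field.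
  by rewrite E in h1; clear -h h1 del0; lra.
have t1 : `|tm n1 - X.1| < rho / 2.
  by apply: small; have h := sqr_ge0 (xm j1 - X.2); clear -h g1 g1'; lra.
have x1 : `|xm j1 - X.2| < rho / 2.
  by apply: small; have h := sqr_ge0 (tm n1 - X.1); clear -h g1 g1'; lra.
(* The maximising time is within rho / 2 of X.1 > rho, so it is not the initial time and is reached
   by a step of the scheme. *)
have [m nE] : exists m, n1 = m.+1.
  case: n1 t1 {P1 g1 g1' gmax} => [|m _]; last by exists m.
  by rewrite /tm mul0r ltr_norml; clear -rho0 rX1; lra.
subst n1.
have tmS : tm m.+1 = tm m + dt by rewrite /tm -natr1 mulrDl mul1r.
have xmS : xm (j1 + 1) = xm j1 + dx by rewrite /xm intrD mulrDl mul1r.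
have xmP : xm (j1 - 1) = xm j1 - dx by rewrite /xm intrB mulrBl mul1r.
have dxr : dx <= rho / 8 by exact: le_trans dxt th1.
have dtr : dt <= rho / 8 by exact: le_trans dtt th1.
move: (t1) (x1); rewrite !ltr_norml => /andP[t1a t1b] /andP[x1a x1b].
have tmB : `|tm m - X.1| <= rho.
  by rewrite ler_norml; rewrite tmS in t1a t1b; clear -t1a t1b dtr dt0; lra.
have xB : `|xm j1 - X.2| <= rho by clear -x1 rho0; lra.
have xSB : `|xm (j1 + 1) - X.2| <= rho.
  by rewrite xmS ler_norml; clear -x1a x1b dxr dx0; lra.
have xPB : `|xm (j1 - 1) - X.2| <= rho.
  by rewrite xmP ler_norml; clear -x1a x1b dxr dx0; lra.
pose G := g m.+1 j1.
(* At time m the data lie below psi + G at the three nodes of the stencil, which are in the box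
   because one step moves by at most rho / 8. One monotone step carries the bound to the maximising
   node, where it is an equality. *)
have Ule j : `|xm j - X.2| <= rho -> U dt dx m j <= psi (tm m) (xm j) + G.
  move=> xj; have := gmax m j; rewrite /P tmB xj => /(_ isT).
  by rewrite -/G /g; clear; lra.
have := flux_step_le (mono j1) (ltW L0) dt0 dx0 cfl (Ule _ xPB) (Ule _ xB) (Ule _ xSB).
rewrite -stepE //.
have UG : U dt dx m.+1 j1 = psi (tm m.+1) (xm j1) + G.
  by rewrite /G /g addrC subrK.
rewrite UG.
have tr (b c y z : R) : (b + y - (c + y)) / z = (b - c) / z by congr (_ / _); ring.
rewrite !tr xmS xmP tmS => step.
exists dt, dx, m, j1; split => //; first by rewrite -/(tm m) -tmS.
by rewrite -/(tm m) -/(xm j1); clear -step; lra.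
Qed.

(** Difference quotients of psi are within 2 e of the derivatives of phi, one e for phi and one for
    the quadratic. The sign of j tells the side of each quotient; at j = 0 the backward one is on
    the left and the forward one on the right. *)
Lemma discrete_contact L C (u0 : R -> R) W (fL fR f0 : R -> R -> R)
    (U : R -> R -> nat -> int -> R) T phi phit phixL phixR X e :
  0 < L -> 0 <= C -> equi_lipschitz L C u0 W ->
  (forall j, monotone_flux L (node_flux fL fR f0 j)) ->
  (forall dt dx n j, adm L dt dx -> W dt dx (n%:R * dt, j%:~R * dx) = U dt dx n j) ->
  (forall dt dx n j, adm L dt dx -> U dt dx n.+1 j = U dt dx n j -
     dt * node_flux fL fR f0 j ((U dt dx n j - U dt dx n (j - 1)) / dx)
                               ((U dt dx n (j + 1) - U dt dx n j) / dx)) ->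
  C1_wedge T phi phit phixL phixR -> Q T X ->
  touches_above (upper_limit L W) phi X -> 0 < e ->
  exists (j : int) dx a p q, [/\ 0 < dx, `|j%:~R * dx - X.2| < e,
    `|a - phit X| <= 2 * e, a + node_flux fL fR f0 j p q <= 0
    & [/\ j <= 0 -> `|p - phixL X| <= 2 * e, 0 < j -> `|p - phixR X| <= 2 * e,
          j < 0 -> `|q - phixL X| <= 2 * e & 0 <= j -> `|q - phixR X| <= 2 * e]].
Proof.
move=> L0 C0 lipW mono gridE stepE C1 QX [touchX /near2P[d0 d00 hd0]] e0.
have [d1 d10 [incT incL incR]] := C1_wedge_increments C1 QX e0.
have [cphi _ _] := C1.
have X1T : 0 < X.1 < T by case: QX => /= + _; rewrite in_itv.
have [rho rho0 [rd0 rd1 rX1 rXT re]] : exists2 rho, 0 < rho &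
    [/\ rho < d0, rho < d1, rho < X.1, rho < T - X.1 & 2 * rho <= e].
  pose r := Num.min (Num.min d0 d1) (Num.min (Num.min X.1 (T - X.1)) e).
  have r0 : 0 < r by rewrite !lt_min d00 d10 e0; clear -X1T; lra.
  have := lexx r; rewrite {2}/r !le_min.
  move=> /andP[/andP[a1 a2] /andP[/andP[a3 a4] a5]]; clearbody r.
  by exists (r / 2); [|split]; clear -r0 a1 a2 a3 a4 a5; lra.
have [|dt [dx [m [j [[dt0 dtr dx0 dxr] t1 x1 step]]]]] :=
  discrete_max L0 C0 lipW mono gridE stepE cphi rho0 rX1 rXT touchX.
  by move=> t x tr xr; apply: hd0; [exact: le_lt_trans tr rd0|exact: le_lt_trans xr rd0].
have {hd0 touchX lipW mono gridE stepE cphi C1 QX rX1 rXT X1T rd0} _ := I.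
move: t1 x1 step; set t := m%:R * dt; set x := j%:~R * dx => t1 x1 step.
pose psi s y := phi (s, y) + ((s - X.1) ^+ 2 + (y - X.2) ^+ 2).
have {}step : psi (t + dt) x <= psi t x - dt * node_flux fL fR f0 j
  ((psi t x - psi t (x - dx)) / dx) ((psi t (x + dx) - psi t x) / dx) by exact: step.
have psiE s y : psi s y = phi (s, y) + ((s - X.1) ^+ 2 + (y - X.2) ^+ 2) by [].
have near s b : `|s| < rho / 2 -> `|b| <= rho / 8 -> `|s + b| < d1.
  move=> h1 h2; have h3 := ler_normD s b.
  by clear -h1 h2 h3 rd1 rho0; lra.
have bd b : 0 < b -> b <= rho / 8 -> `|b| <= rho / 8 by move=> b0; rewrite gtr0_norm.
have tS : `|t + dt - X.1| < d1 by clear -t1 rd1 rho0; lra.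
have tB : `|t - X.1| < d1.
  have -> : t - X.1 = (t + dt - X.1) + - dt by ring.
  by apply: near => //; rewrite normrN; exact: bd.
have xB : `|x - X.2| < d1 by clear -x1 rd1 rho0; lra.
have xP : `|x - dx - X.2| < d1.
  have -> : x - dx - X.2 = (x - X.2) + - dx by ring.
  by apply: near => //; rewrite normrN; exact: bd.
have xS : `|x + dx - X.2| < d1.
  have -> : x + dx - X.2 = (x - X.2) + dx by ring.
  by apply: near => //; exact: bd.
have rem s b : `|s| < rho / 2 -> `|b| <= rho / 8 -> `|2 * s + b| <= e.
  move=> h1 h2; have h3 := ler_normD (2 * s) b.
  rewrite normrM (@ger0_norm _ 2) // in h3.
  by clear -h1 h2 h3 re rho0; lra.
exists j, dx, ((psi (t + dt) x - psi t x) / dt), ((psi t x - psi t (x - dx)) / dx),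
  ((psi t (x + dx) - psi t x) / dx).
have Pq : psi t x - psi t (x - dx) =
    (phi (t, x) - phi (t, x - dx)) + (2 * (x - X.2) + - dx) * dx.
  by rewrite !psiE; ring.
have Sq : psi t (x + dx) - psi t x =
    (phi (t, x + dx) - phi (t, x)) + (2 * (x - X.2) + dx) * dx.
  by rewrite !psiE; ring.
have Tq : psi (t + dt) x - psi t x =
    (phi (t + dt, x) - phi (t, x)) + (2 * (t + dt - X.1) + - dt) * dt.
  by rewrite !psiE; ring.
have remP : `|2 * (x - X.2) + - dx| <= e.
  by apply: rem => //; rewrite normrN; exact: bd.
have remS : `|2 * (x - X.2) + dx| <= e by apply: rem => //; exact: bd.
have remT : `|2 * (t + dt - X.1) + - dt| <= e.
  by apply: rem => //; rewrite normrN; exact: bd.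
have x_le0 : j <= 0 -> x <= 0 by move=> j_0; rewrite /x pmulr_lle0 // lerz0.
have x_ge0 : 0 <= j -> 0 <= x by move=> j_0; rewrite /x pmulr_lge0 // ler0z.
have xS_le0 : j < 0 -> x + dx <= 0.
  move=> j_0; have -> : x + dx = (j + 1)%:~R * dx by rewrite intrD mulrDl mul1r.
  by rewrite pmulr_lle0 // lerz0 lezD1.
have xP_ge0 : 0 < j -> 0 <= x - dx.
  move=> j_0; have -> : x - dx = (j - 1)%:~R * dx by rewrite intrB mulrBl mul1r.
  by rewrite pmulr_lge0 // ler0z subr_ge0 -gtz0_ge1.
have hP : x - (x - dx) = dx by ring.
have hS : x + dx - x = dx by ring.
have hT : t + dt - t = dt by ring.
have leP_ : x - dx <= x by rewrite gerBl ltW.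
have leS_ : x <= x + dx by rewrite lerDl ltW.
split => //.
- by clear -x1 re rho0; lra.
- rewrite Tq; apply: quotient_close => //.
  by have := incT t (t + dt) x tB tS xB; rewrite hT; apply; rewrite lerDl ltW.
- have : dt * ((psi (t + dt) x - psi t x) / dt + node_flux fL fR f0 j
    ((psi t x - psi t (x - dx)) / dx) ((psi t (x + dx) - psi t x) / dx)) <= dt * 0.
    rewrite mulrDr [dt * (_ / _)]mulrC divfK ?gt_eqF // mulr0.
    by clear -step; lra.
  by rewrite ler_pM2l.
split=> hj.
- rewrite Pq; apply: quotient_close => //.
  by have := incL t (x - dx) x tB xP xB leP_ (x_le0 hj); rewrite hP.
- rewrite Pq; apply: quotient_close => //.
  by have := incR t (x - dx) x tB xP xB leP_ (xP_ge0 hj); rewrite hP.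
- rewrite Sq; apply: quotient_close => //.
  by have := incL t x (x + dx) tB xB xS leS_ (xS_le0 hj); rewrite hS.
- rewrite Sq; apply: quotient_close => //.
  by have := incR t x (x + dx) tB xB xS leS_ (x_ge0 hj); rewrite hS.
Qed.

(** When X.2 = 0, the contact nodes near X may lie to the left of 0, to its right or at 0, and the
    inequality then involves fL, fR or f0. This is the source of the minimum in the junction
    condition. *)
Lemma upper_limit_subsolution L C (u0 : R -> R) W (fL fR f0 : R -> R -> R)
    (U : R -> R -> nat -> int -> R) HL HR T :
  0 < L -> 0 <= C -> equi_lipschitz L C u0 W ->
  (forall j, monotone_flux L (node_flux fL fR f0 j)) ->
  (forall dt dx n j, adm L dt dx -> W dt dx (n%:R * dt, j%:~R * dx) = U dt dx n j) ->
  (forall dt dx n j, adm L dt dx -> U dt dx n.+1 j = U dt dx n j -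
     dt * node_flux fL fR f0 j ((U dt dx n j - U dt dx n (j - 1)) / dx)
                               ((U dt dx n (j + 1) - U dt dx n j) / dx)) ->
  (forall p, fL p p = HL p) -> (forall p, fR p p = HR p) ->
  subsolution HL HR f0 T (upper_limit L W).
Proof.
move=> L0 C0 lipW mono gridE stepE fLE fRE; split.
  move=> X QX a Xa.
  have C1 : 0 < C + 1 by clra.
  have d0 : 0 < (a - upper_limit L W X) / 3 / (C + 1) by rewrite !divr_gt0 // subr_gt0.
  apply/near2P; exists ((a - upper_limit L W X) / 3 / (C + 1)) => // t x.
  rewrite !ltr_pdivlMr // => t1 x1 _.
  have := upper_limit_lipschitz_le (t, x) X L0 C0 lipW.
  rewrite /=; have := normr_ge0 (t - X.1); have := normr_ge0 (x - X.2); clra.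
move=> phi phit phixL phixR C1 X QX touch.
have dc e (pe : 0 < e) := @discrete_contact L C u0 W fL fR f0 U T phi phit phixL phixR X e
  L0 C0 lipW mono gridE stepE C1 QX touch pe.
have cont j p q p' q' e : `|p - p'| <= 2 * e -> `|q - q'| <= 2 * e ->
    node_flux fL fR f0 j p' q' <= node_flux fL fR f0 j p q + 8 * L * e.
  move=> hp hq.
  have hp1 := hp; have hq1 := hq; rewrite ler_norml in hp1; rewrite ler_norml in hq1.
  have /andP[h1 _] := mono j (p' - 2 * e) p (q' + 2 * e) q ltac:(clra) ltac:(clra).
  have e0 : 0 <= 2 * e by apply: le_trans hp.
  have /andP[h2 h3] := mono j (p' - 2 * e) p' (q' + 2 * e) q' ltac:(clra) ltac:(clra).
  clra.
split=> X2.
- apply: (@le_limit0 _ _ _ (2 + 8 * L) (- X.2)); first by clra.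
  move=> e e0 eX; have [j [dx [a [p [q [dx0 xj at_ ineq [hp _ hq _]]]]]]] := dc e e0.
  have j0 : j < 0.
    rewrite -(ltrz0 R) -(pmulr_llt0 _ dx0).
    by move: xj; rewrite ltr_norml; clra.
  have := cont j _ _ _ _ e (hp (ltW j0)) (hq j0).
  move: ineq; rewrite /node_flux j0 fLE => ineq.
  by move: at_; rewrite ler_norml; clra.
- apply: (@le_limit0 _ _ _ (2 + 8 * L) X.2) => //.
  move=> e e0 eX; have [j [dx [a [p [q [dx0 xj at_ ineq [_ hp _ hq]]]]]]] := dc e e0.
  have j0 : 0 < j.
    rewrite -(ltr0z R) -(pmulr_lgt0 _ dx0).
    by move: xj; rewrite ltr_norml; clra.
  have := cont j _ _ _ _ e (hp j0) (hq (ltW j0)).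
  move: ineq; rewrite /node_flux j0 ltNge (ltW j0) /= fRE => ineq.
  by move: at_; rewrite ler_norml; clra.
apply: (@le_limit0 _ _ _ (2 + 8 * L) 1) => // e e0 _.
have [j [dx [a [p [q [dx0 xj at_ ineq [hp1 hp2 hq1 hq2]]]]]]] := dc e e0.
set Fm := Num.min _ _.
have [F1 F2 F3] : [/\ Fm <= fL (phixL X) (phixL X), Fm <= fR (phixR X) (phixR X)
    & Fm <= f0 (phixL X) (phixR X)].
  by rewrite /Fm fLE fRE !ge_min !lexx ?orbT.
rewrite -/Fm; move: at_ ineq; rewrite ler_norml; clearbody Fm.
have [j0|j0|j0] := ltgtP j 0.
- have := cont j _ _ _ _ e (hp1 (ltW j0)) (hq1 j0).
  by rewrite /node_flux j0; clra.
- have := cont j _ _ _ _ e (hp2 j0) (hq2 (ltW j0)).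
  by rewrite /node_flux j0 ltNge (ltW j0) /=; clra.
have := cont j _ _ _ _ e (hp1 _) (hq2 _).
rewrite j0 /node_flux /= => /(_ isT isT); clra.
Qed.

End BarlesSouganidis.

(** * Semi-continuous envelopes and convergence *)

Section Envelopes.
Context {R : realType}.
Implicit Types (u w : R * R -> R) (X Y : R * R) (a e : R).

Definition bounded_near_Qbar w X :=
  exists M : R, \forall Y \near within Qbar (nbhs X), `|w Y| <= M.

(** The local bound makes the limit superior finite, so [fine] does not fall back on its default
    value. *)
Lemma usc_env_fin w X : Qbar X -> bounded_near_Qbar w X ->
  ((w X)%:E <= limf_esup (EFin \o w) (within Qbar (nbhs X)))%E /\
  limf_esup (EFin \o w) (within Qbar (nbhs X)) = (usc_env w X)%:E.
Proof.
move=> QX [M nM].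
have lo : ((w X)%:E <= limf_esup (EFin \o w) (within Qbar (nbhs X)))%E.
  apply: le_ereal_inf_tmp => _ [V nV <-]; apply: ereal_sup_ubound.
  by exists X => //; apply: (nbhs_singleton nV).
have hi : (limf_esup (EFin \o w) (within Qbar (nbhs X)) <= M%:E)%E.
  apply: (@le_trans _ _ (ereal_sup [set (EFin \o w) Y | Y in [set Y | w Y <= M]])).
    apply: ereal_inf_lbound; exists [set Y | w Y <= M] => //.
    by apply: filterS nM => Y /=; exact: le_trans (ler_norm _).
  by apply: ge_ereal_sup => _ [Y /= h <-]; rewrite lee_fin.
split=> //; rewrite /usc_env fineK // fin_numE; apply/andP; split.
  by apply/eqP => E; rewrite E in lo.
by apply/eqP => E; rewrite E in hi.
Qed.

Lemma usc_env_ge w X : Qbar X -> bounded_near_Qbar w X -> w X <= usc_env w X.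
Proof. by move=> QX /(usc_env_fin QX)[+ E]; rewrite E lee_fin. Qed.

Lemma usc_env_le w X a : Qbar X -> bounded_near_Qbar w X ->
  (\forall Y \near within Qbar (nbhs X), w Y <= a) -> usc_env w X <= a.
Proof.
move=> QX bw nX; have [_ E] := usc_env_fin QX bw.
rewrite -lee_fin -E.
apply: (@le_trans _ _ (ereal_sup [set (EFin \o w) Y | Y in [set Y | w Y <= a]])).
  by apply: ereal_inf_lbound; exists [set Y | w Y <= a].
by apply: ge_ereal_sup => _ [Y /= h <-]; rewrite lee_fin.
Qed.

Lemma usc_env_lt w X a : Qbar X -> bounded_near_Qbar w X -> usc_env w X < a ->
  \forall Y \near within Qbar (nbhs X), w Y < a.
Proof.
move=> QX bw; have [_ E] := usc_env_fin QX bw.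
rewrite -lte_fin -E => /ereal_inf_lt[_ [V nV <-] lt].
apply: filterS nV => Y VY; rewrite -lte_fin.
by apply: le_lt_trans lt; apply: ereal_sup_ubound; exists Y.
Qed.

Lemma usc_env_usc w : locally_bounded_on Qbar w -> usc_on Qbar (usc_env w).
Proof.
move=> bw X QX a lt; pose b := (usc_env w X + a) / 2.
have [Xb ba] : usc_env w X < b /\ b < a by rewrite /b; lra.
have /near2P[e e0 he] := usc_env_lt QX (bw X QX) Xb.
apply/near2P; exists (e / 2); first by lra.
move=> t x tX xX Qtx; apply: le_lt_trans ba.
apply: usc_env_le => //; first exact: bw.
apply/near2P; exists (e / 2); first by lra.
move=> s y /= st yx Qsy; apply/ltW/he => //.
  by have := ler_distD t s X.1; lra.
by have := ler_distD x y X.2; lra.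
Qed.

Lemma lsc_envE w X : lsc_env w X = - usc_env (\- w) X.
Proof.
by rewrite /lsc_env /usc_env /limf_einf /= fineN.
Qed.

Lemma bounded_near_QbarN w X : bounded_near_Qbar w X -> bounded_near_Qbar (\- w) X.
Proof. by move=> [M h]; exists M; apply: filterS h => Y /=; rewrite normrN. Qed.

Lemma locally_bounded_onN w : locally_bounded_on Qbar w ->
  locally_bounded_on Qbar (\- w).
Proof. by move=> bw X /bw; exact: bounded_near_QbarN. Qed.

Lemma usc_env_id w X : Qbar X -> bounded_near_Qbar w X -> usc_on Qbar w ->
  usc_env w X = w X.
Proof.
move=> QX bw usc; apply/eqP; rewrite eq_le usc_env_ge // andbT.
apply: (@le_limit0 _ _ _ 1 1) => // e e0 _; rewrite mul1r.
have lt : w X < w X + e by rewrite ltrDl.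
apply: usc_env_le => //; by apply: filterS (usc X QX _ lt) => Y; exact: ltW.
Qed.

Lemma Q_near T X : Q T X -> \forall Y \near X, Q T Y.
Proof.
case=> /=; rewrite in_itv /= => /andP[h1 h2] _.
apply/near2P; exists (Num.min X.1 (T - X.1)); first by rewrite lt_min h1 subr_gt0.
move=> t x; rewrite lt_min !ltr_norml => h _; split => //=; rewrite in_itv /=; lra.
Qed.

(** Meant for a function and its envelope, which are known to agree only for t >= 0: as [Q T] is
    open, touching at one of its points ignores values elsewhere. *)
Lemma subsolution_ext HL HR F T u w : (forall X, Q T X -> u X = w X) ->
  subsolution HL HR F T u -> subsolution HL HR F T w.
Proof.
move=> uw [usc sub]; split.
  move=> X QX a; rewrite -uw // => /(usc X QX a); rewrite !near_withinE.
  by apply: filterS => Y h QY; rewrite -uw //; exact: h.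
move=> phi phit phixL phixR C1 X QX [E nX]; apply: (sub _ _ _ _ C1 X QX).
split; first by rewrite uw.
by apply: filterS2 (Q_near QX) nX => Y QY; rewrite uw.
Qed.

Lemma supersolution_ext HL HR F T u w : (forall X, Q T X -> u X = w X) ->
  supersolution HL HR F T u -> supersolution HL HR F T w.
Proof.
move=> uw /supersolution_dual sup; apply: subsolution_dual.
by apply: subsolution_ext sup => X QX /=; rewrite uw.
Qed.

Lemma Q_Qbar T X : Q T X -> Qbar X.
Proof.
by case=> /= + _; rewrite in_itv /= => /andP[h _]; split => //=; rewrite in_itv /= ltW.
Qed.

End Envelopes.

(** * Structure of the fluxes, convergence and uniqueness *)

Section Convergence.
Context {R : realType}.
Implicit Types (u w : R * R -> R) (X Y : R * R) (a d e L C dt dx p q x y : R).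

Lemma lipschitzP (k : R) (f : R -> R) : k.-lipschitz f ->
  forall p q, `|f p - f q| <= k * `|p - q|.
Proof. by move=> h p q; exact: (h (p, q) (conj I I)). Qed.

Lemma junction_flux L0 L (F : R -> R -> R) : junction_assumption L0 F -> L0 <= L ->
  monotone_flux L F.
Proof.
move=> [[F1 F2] m1 m2 _] L0L a a' b b' aa' b'b.
have h1 := m1 b _ _ aa'; have h2 := m2 a' _ _ b'b.
have h3 := m1 b' _ _ aa'; have h4 := m2 a _ _ b'b.
rewrite /= in h1 h2 h3 h4.
have := le_trans (ler_norm _) (lipschitzP (F1 b) a' a).
have := le_trans (ler_norm _) (lipschitzP (F2 a') b' b).
rewrite (distrC b') !ger0_norm ?subr_ge0 //.
have : L0 * (a' - a) <= L * (a' - a) by rewrite ler_wpM2r // subr_ge0.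
have : L0 * (b - b') <= L * (b - b') by rewrite ler_wpM2r // subr_ge0.
by move=> *; apply/andP; split; lra.
Qed.

Lemma junction_coercive L0 (F : R -> R -> R) : junction_assumption L0 F ->
  coercive_flux F /\ coercive (fun p => F p p).
Proof.
move=> [_ _ _ co]; split.
  move=> A; have [B hB] := co (A + 1); exists B => a b FA.
  have pn (z : R) : 0 <= Num.max 0 z by rewrite le_max lexx.
  have pz (z : R) : z <= Num.max 0 z by rewrite le_max lexx orbT.
  split; rewrite leNgt; apply/negP => h.
    have := hB a b; have := pz a; have := pn (- b).
    by rewrite /pos_part /neg_part => h1 h2 h3; have := h3 ltac:(lra); lra.
  have := hB a b; have := pn a; have := pz (- b).
  by rewrite /pos_part /neg_part => h1 h2 h3; have := h3 ltac:(lra); lra.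
move=> A; have [B hB] := co A; exists B => p pB; apply: hB.
apply: le_trans pB _; rewrite /pos_part /neg_part.
by have [p0|p0] := leP 0 p; [rewrite ger0_norm //|rewrite ltr0_norm //];
  rewrite !maxEle; do ?case: ifP => ?; lra.
Qed.

Lemma lipschitz_coercive_gt0 L (H : R -> R) :
  (forall p q, `|H p - H q| <= L * `|p - q|) -> coercive H -> 0 < L.
Proof.
move=> Hlip Hco; rewrite ltNge; apply/negP => L0.
have [B hB] := Hco (H 0 + 1).
have := hB `|B| ltac:(by rewrite normr_id ler_norm).
have := le_trans (ler_norm _) (Hlip `|B| 0).
have : L * `|(`|B| - 0)| <= 0 by rewrite mulr_le0_ge0.
lra.
Qed.

(** Admissible meshes exist below every threshold, so the two limits are taken along a common
    non-empty family. *)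
Lemma lower_le_upper L C (u0 : R -> R) W X : 0 < L -> 0 <= C ->
  equi_lipschitz L C u0 W -> lower_limit L W X <= upper_limit L W X.
Proof.
move=> L0 C0 h; apply: (@le_limit0 _ _ _ 2 1) => // e e0 _.
have [|d1 d10 h1] := upper_limit_gt (X := X) (a := upper_limit L W X + e) L0 C0 h.
  by rewrite ltrDl.
have [|d2 d20 h2] := upper_limit_gt (X := X)
  (a := upper_limit L (fun dt dx X => - W dt dx X) X + e) L0 C0 (equi_lipschitzN h).
  by rewrite ltrDl.
have [|dt [dx [ad]]] := @adm_exists R L (Num.min d1 d2) L0.
  by rewrite lt_min d10.
rewrite lt_min => /andP[x1 x2]; rewrite /lower_limit.
have := h1 dt dx ad x1; have := h2 dt dx ad x2; lra.
Qed.

Lemma lipschitz_usc C u : 0 <= C ->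
  (forall X Y, `|u X - u Y| <= C * (`|X.1 - Y.1| + `|X.2 - Y.2|)) -> usc_on Qbar u.
Proof.
move=> C0 h X _ a lt.
have C1 : 0 < C + 1 by rewrite ltr_wpDl.
have d0 : 0 < (a - u X) / 3 / (C + 1) by rewrite !divr_gt0 // subr_gt0.
apply/near2P; exists ((a - u X) / 3 / (C + 1)) => // t x.
rewrite !ltr_pdivlMr // => t1 x1 _.
have := le_trans (ler_norm _) (h (t, x) X).
rewrite /=; have := normr_ge0 (t - X.1); have := normr_ge0 (x - X.2); lra.
Qed.

Lemma lipschitz_locally_bounded C u : 0 <= C ->
  (forall X Y, `|u X - u Y| <= C * (`|X.1 - Y.1| + `|X.2 - Y.2|)) ->
  locally_bounded_on Qbar u.
Proof.
move=> C0 h X _; exists (`|u X| + C * 2); apply/near2P; exists 1 => // t x t1 x1 _.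
have := h (t, x) X; have := ler_normD (u (t, x) - u X) (u X); rewrite subrK /=.
have : C * (`|t - X.1| + `|x - X.2|) <= C * 2 by rewrite ler_wpM2l //; lra.
lra.
Qed.

Lemma CFL_adm LL LR L0 dt dx : 0 < Num.max L0 (Num.max LL LR) ->
  0 < dt -> 0 < dx -> CFL LL LR L0 dt dx -> adm (Num.max L0 (Num.max LL LR)) dt dx.
Proof.
move=> L_0 dt0 dx0; rewrite /CFL; set L := Num.max _ _ => cfl; split => //.
by move: cfl; rewrite ler_pdivrMr // mulrC ler_pdivlMr ?mulr_gt0 // mulrC.
Qed.

Lemma monotone_fluxN L (f : R -> R -> R) : monotone_flux L f ->
  monotone_flux L (fun p q => - f (- p) (- q)).
Proof.
move=> mf a a' b b' aa' b'b.
have := mf (- a') (- a) (- b') (- b); rewrite !lerN2 => /(_ aa' b'b)/andP[h1 h2].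
by apply/andP; split; lra.
Qed.

End Convergence.

Theorem theorem1p6 (R : realType) (HL HR : R -> R) (F0 : R -> R -> R)
    (LL LR L0 : R) (u0 : R -> R)
    (hHL : hamiltonian_assumption LL HL)
    (hHR : hamiltonian_assumption LR HR)
    (hF0 : junction_assumption L0 F0)
    (hu0 : initial_assumption u0) :
  exists u : R * R -> R,
    [/\ cauchy_solution HL HR F0 u0 u,
        forall w : R * R -> R, cauchy_solution HL HR F0 u0 w ->
          forall X, Qbar X -> w X = u X
      & forall K : set (R * R), compact K -> K `<=` Qbar ->
          forall e : R, 0 < e ->
          exists2 d : R, 0 < d &
            forall dt dx : R, 0 < dt -> 0 < dx -> CFL LL LR L0 dt dx ->
              dx < d ->
              forall X, K X -> `|u_Delta HL HR F0 u0 dt dx X - u X| < e].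
Proof.
have [/lipschitzP HLlip _ cL] := hHL; have [/lipschitzP HRlip _ cR] := hHR.
have [coF cF] := junction_coercive hF0.
have [[F1 F2] _ _ _] := hF0.
have [[k /lipschitzP u0k] _] := hu0.
pose L := Num.max L0 (Num.max LL LR).
have [L0L LLL LRL] : [/\ L0 <= L, LL <= L & LR <= L] by rewrite !le_max !lexx ?orbT.
have L_gt0 : 0 < L := lt_le_trans (lipschitz_coercive_gt0 HLlip cL) LLL.
have fmono j : monotone_flux L (flux HL HR F0 j).
  apply: (@flux_cases R (monotone_flux L)); [exact: godunov_flux HLlip LLL|exact: godunov_flux HRlip LRL|].
  exact: junction_flux hF0 L0L.
have fcoer j : coercive_flux (flux HL HR F0 j).
  by apply: (@flux_cases R (@coercive_flux R)); [exact: godunov_coercive HLlip cL|exact: godunov_coercive HRlip cR|].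
have k0 : 0 <= `|k| by [].
have u0k' x y : `|u0 x - u0 y| <= `|k| * `|x - y|.
  by apply: le_trans (u0k _ _) _; rewrite ler_wpM2r // ler_norm.
pose W dt dx X := u_Delta HL HR F0 u0 dt dx X.
have [C C0 hW] : exists2 C : R, 0 <= C & equi_lipschitz L C u0 W.
  exact: u_Delta_lipschitz L_gt0 fmono fcoer k0 u0k'.
have hWN := equi_lipschitzN hW.
pose ub := upper_limit L W; pose ul := lower_limit L W.
have ubsub T : subsolution HL HR F0 T ub.
  apply: (upper_limit_subsolution (fL := godunov HL) (fR := godunov HR)
    (U := scheme HL HR F0 u0) T L_gt0 C0 hW fmono).
  - by move=> dt dx n j [dt0 dx0 _]; exact: u_Delta_grid.
  - by move=> dt dx n j _; exact: schemeS.
  - by move=> p; exact: godunov_diag HLlip.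
  - by move=> p; exact: godunov_diag HRlip.
have ulE X : - upper_limit L (fun dt dx X => - W dt dx X) X = ul X by [].
have ulsup T : supersolution HL HR F0 T ul.
  apply: subsolution_dual.
  rewrite (_ : \- ul = upper_limit L (fun dt dx X => - W dt dx X)); last first.
    by apply: boolp.funext => X; rewrite /= /ul /lower_limit opprK.
  (* The negated grid function solves the scheme with fluxes -f(-p, -q), which are again monotone
     and consistent with the dual Hamiltonians; hence -ul is an upper limit of the same kind. *)
  pose dual (f : R -> R -> R) p q := - f (- p) (- q).
  have fluxN j : node_flux (dual (godunov HL)) (dual (godunov HR)) (dualF F0) j =
      dual (flux HL HR F0 j).
    by rewrite /node_flux /flux; case: ifP => // _; case: ifP.
  apply: (upper_limit_subsolution (fL := dual (godunov HL)) (fR := dual (godunov HR))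
    (U := fun dt dx n j => - scheme HL HR F0 u0 dt dx n j) T L_gt0 C0 hWN).
  - by move=> j; rewrite fluxN; exact: monotone_fluxN.
  - by move=> dt dx n j [dt0 dx0 _]; rewrite /W u_Delta_grid.
  - move=> dt dx n j _; rewrite fluxN /dual schemeS.
    have sl (a b c : R) : - ((- a - - b) / c) = (a - b) / c.
      by rewrite -mulNr; congr (_ / _); ring.
    by rewrite !sl mulrN opprK opprB addrC.
  - by move=> p; rewrite /dual (godunov_diag _ HLlip).
  - by move=> p; rewrite /dual (godunov_diag _ HRlip).
have ublip X Y := upper_limit_lipschitz X Y L_gt0 C0 hW.
have ullip X Y : `|(\- ul) X - (\- ul) Y| <= C * (`|X.1 - Y.1| + `|X.2 - Y.2|).
  by have := upper_limit_lipschitz X Y L_gt0 C0 hWN; rewrite /ul /lower_limit /= !opprK.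
have ubusc : usc_on Qbar ub := lipschitz_usc C0 ublip.
have ullsc : lsc_on Qbar ul.
  move=> X QX a lt; have := lipschitz_usc C0 ullip QX (a := - a).
  by rewrite /= ltrN2 => /(_ lt); apply: filterS => Y /=; rewrite ltrN2.
have ub0 x : ub (0, x) = u0 x := upper_limit_init x L_gt0 C0 hW.
have ul0 x : ul (0, x) = u0 x.
  by rewrite /ul /lower_limit (upper_limit_init _ L_gt0 C0 hWN) opprK.
have F1' p p' q : `|F0 p q - F0 p' q| <= L0 * `|p - p'| := lipschitzP (F1 q) p p'.
have F2' p q q' : `|F0 p q - F0 p q'| <= L0 * `|q - q'| := lipschitzP (F2 p) q q'.
have compare := comparison HLlip HRlip F1' F2' cL cR cF.
have ublul X : Qbar X -> ub X = ul X.
  move=> QX; apply/eqP; rewrite eq_le (lower_le_upper X L_gt0 C0 hW) andbT.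
  apply: (compare ub ul) QX => // x; by rewrite ub0 ul0.
have ubbd : locally_bounded_on Qbar ub := lipschitz_locally_bounded C0 ublip.
have ubusc' X : Qbar X -> usc_env ub X = ub X.
  by move=> QX; apply: usc_env_id => //; exact: ubbd.
have ublsc' X : Qbar X -> lsc_env ub X = ub X.
  move=> QX; rewrite lsc_envE usc_env_id //= ?opprK //.
    exact: locally_bounded_onN ubbd X QX.
  apply: (lipschitz_usc C0) => Y Z /=.
  have -> : - ub Y - - ub Z = - (ub Y - ub Z) by ring.
  by rewrite normrN; exact: ublip.
exists ub; split.
- split; last by move=> x; rewrite ubusc' ?ublsc' ?ub0 //; split => //=; rewrite in_itv /= lexx.
  split=> // T T0; split.
    by apply: subsolution_ext (ubsub T) => X /Q_Qbar QX; rewrite ubusc'.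
  by apply: supersolution_ext (ulsup T) => X /Q_Qbar QX; rewrite ublsc' // ublul.
(* Comparison gives usc_env w <= ul = ub <= lsc_env w, while w lies between its envelopes. *)
- move=> w [[wbd wsol] winit] X QX.
  have wNbd := locally_bounded_onN wbd.
  have h1 : usc_env w X <= ul X.
    apply: (compare (usc_env w) ul) QX => //.
    + by move=> T /wsol[].
    + exact: usc_env_usc.
    + by move=> x; rewrite ul0 (winit x).1.
  have h2 : ub X <= lsc_env w X.
    apply: (compare ub (lsc_env w)) QX => //.
    + by move=> T /wsol[].
    + move=> Y QY a; rewrite lsc_envE => lt.
      have := usc_env_usc wNbd QY (a := - a); rewrite -ltrN2 opprK => /(_ lt).
      by apply: filterS => Z; rewrite lsc_envE ltrNr.
    + by move=> x; rewrite ub0 (winit x).2.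
  have h3 := usc_env_ge QX (wbd X QX).
  have h4 := usc_env_ge QX (wNbd X QX).
  apply/eqP; rewrite eq_le; apply/andP; split.
    by rewrite (le_trans h3) // ublul.
  by apply: (le_trans h2); rewrite lsc_envE lerNl.
(* The uniform upper bounds for u_Delta and for -u_Delta close up on K because the two limits
   coincide there. *)
move=> K cK KQ e e0; have e20 : 0 < e / 2 by rewrite divr_gt0.
have [d1 d10 h1] := upper_limit_uniform L_gt0 C0 hW cK e20.
have [d2 d20 h2] := upper_limit_uniform L_gt0 C0 hWN cK e20.
exists (Num.min d1 d2); first by rewrite lt_min d10.
move=> dt dx dt0 dx0 cfl; rewrite lt_min => /andP[x1 x2] X KX.
have ad := CFL_adm L_gt0 dt0 dx0 cfl.
have b1 := h1 dt dx ad x1 X KX; have b2 := h2 dt dx ad x2 X KX.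
have E := ublul X (KQ X KX); rewrite -(ulE X) in E.
rewrite -/(W dt dx X) ltr_norml; rewrite -/ub in b1.
by apply/andP; split; lra.
Qed.
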